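(* Consider the averaged diluted XY model on $\mathbb Z^2$ with $\star\in\{\mathrm{bond},\mathrm{site}\}$. Put $(\alpha,\kappa)=(1,1)$ if $\star=\mathrm{bond}$ and $(\alpha,\kappa)=(2,4)$ if $\star=\mathrm{site}$, and let $H_\kappa(t)=1-e^{-2\kappa t}$. If $p\in(0,1]$ and $\beta\ge0$ satisfy $$p^\alpha H_\kappa(\beta)\ge H_\kappa(\beta_{\mathrm{BKT}}),$$ then the free infinite-volume averaged correlation obeys $$F_\star(p,\beta;x,y)\ge\frac1{8\|x-y\|_\infty}\qquad\text{for all }x,y\in\mathbb Z^2,\ x\ne y.$$ In particular, the algebraic phase survives all sufficiently weak dilution at every $\beta>\beta_{\mathrm{BKT}}$: for every $\beta>\beta_{\mathrm{BKT}}$ there is $p_0<1$ such that for all $p\in[p_0,1]$ there exist $c>0$ and $s\in[0,\infty)$ with $F_\star(p,\beta;0,x)\ge c(1+|x|)^{-s}$ for every $x\in\mathbb Z^2\setminus\{0\}$.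
   Context: XY model. Let $\mathbb T=\mathbb R/(2\pi\mathbb Z)$. For a finite graph $G=(V,E)$ and couplings $J_e\ge0$, the XY Gibbs measure with free boundary conditions is $$d\mu_{G,J}(\theta)=\frac1{Z_{G,J}}\exp\Bigl(\sum_{e=\{u,v\}\in E}J_e\cos(\theta_u-\theta_v)\Bigr)\prod_{v\in V}\frac{d\theta_v}{2\pi},\qquad\theta\in\mathbb T^V,$$ with expectation $\langle\cdot\rangle_{G,J}$. Dilution. In the bond model, $J_e=\beta\omega_e$ with $(\omega_e)$ i.i.d. Bernoulli($p$). In the site model, $J_{\{u,v\}}=\beta\eta_u\eta_v$ with $(\eta_v)$ i.i.d. Bernoulli($p$). All vertices retain their angle variables, including vacant sites, which are isolated and carry independent Haar (uniform) angles. Averaged correlation. $\mathbb Z^2$ carries its nearest-neighbor edges. For $x,y\in\mathbb Z^2$, $F_\star(p,\beta;x,y)=\mathbb E_p\langle\cos(\theta_x-\theta_y)\rangle_{\beta,\star}$ denotes the limit, as the box $[-R,R]^2\cap\mathbb Z^2$ (with all nearest-neighbor edges inside it and free boundary conditions) increases to $\mathbb Z^2$, of the disorder expectation of the finite-volume Gibbs expectation of $\cos(\theta_x-\theta_y)$ (each Gibbs expectation is normalized before averaging). The limit exists by Ginibre monotonicity. Clean critical point. $\beta_{\mathrm{BKT}}\in(0,\infty)$ is the critical inverse temperature of the clean model ($p=1$, all couplings equal to $\beta$) on $\mathbb Z^2$: the supremum of the $\beta\ge0$ for which $F_\star(1,\beta;0,x)$ decays exponentially in $|x|$. By the known exponential/algebraic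 dichotomy of the clean model it equals the infimum of the $\beta\ge 0$ for which $F_\star(1,\beta;0,x)\ge c(1+|x|)^{-s}$ for all $x\neq0$, for some $c>0$, $s\in[0,\infty)$. *)

(* Defs.v *)
From HB Require Import structures.
From mathcomp Require Import all_boot all_order all_algebra finmap.
From mathcomp Require Import zify.
From mathcomp Require Import all_classical all_reals all_analysis.

Set Implicit Arguments.
Unset Strict Implicit.
Unset Printing Implicit Defensive.

Import Order.TTheory GRing.Theory Num.Theory.
Import numFieldNormedType.Exports.

Local Open Scope fset_scope.
Local Open Scope ring_scope.

(** * The XY model on a finite graph

A finite graph is a finite set [V] of vertices of an ambient type [T] together
with a finite set [E] of pairs, in which every undirected edge appears exactly
once, with an arbitrary orientation. Angle configurations are functions on all
of [T]; only the angles of the vertices of [V] are integrated. *)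
Section XY.
Context {R : realType} {T : choiceType}.
Implicit Types (V : {fset T}) (E : {fset T * T}) (J : T * T -> R).

(* \int f(theta) \prod_(v in s) dtheta_v / (2 pi), as an iterated integral;
   the coordinates outside s are frozen at their values in theta. *)
Fixpoint angle_integral (s : seq T) (f : (T -> R) -> R) (theta : T -> R) : R :=
  if s is v :: s' then
    (2 * pi)^-1 *
      \int[lebesgue_measure]_(t in `[0, 2 * pi]%classic)
         angle_integral s' f [eta theta with v |-> t]
  else f theta.

Definition energy E J (theta : T -> R) : R :=
  \sum_(e <- E) J e * cos (theta e.1 - theta e.2).

(* The frozen value 0 is irrelevant when f only depends on the angles in V
   and E is contained in V `*` V. *)
Definition unnormalized V E J (f : (T -> R) -> R) : R :=
  angle_integral V (fun theta => f theta * expR (energy E J theta)) (fun=> 0).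

Definition gibbs V E J (f : (T -> R) -> R) : R :=
  unnormalized V E J f / unnormalized V E J (fun=> 1).

Definition corr V E J (x y : T) : R :=
  gibbs V E J (fun theta => cos (theta x - theta y)).

End XY.

(* Expectation of f(A), where A is the random subset of S that contains each
   element of S independently with probability p. *)
Definition bernoulli_mean {R : realType} {K : choiceType} (p : R)
    (S : {fset K}) (f : {fset K} -> R) : R :=
  \sum_(A <- fpowerset S) p ^+ #|` A| * (1 - p) ^+ #|` S `\` A| * f A.

Notation Z2 := (int * int)%type.

Definition box (n : nat) : {fset Z2} :=
  let I := [fset i%:Z - n%:Z | i in iota 0 n.*2.+1] in I `*` I.

(* Nearest-neighbor edges, oriented rightwards or upwards. *)
Definition box_edges (n : nat) : {fset Z2 * Z2} :=
  [fset e in box n `*` box n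
     | (e.2 == e.1 + (1, 0)) || (e.2 == e.1 + (0, 1))].

Section Norms.
Context {R : realType}.

Definition norm_sup (x : Z2) : R := (Num.max `|x.1| `|x.2|)%:~R.
Definition norm_eucl (x : Z2) : R :=
  Num.sqrt (x.1%:~R ^+ 2 + x.2%:~R ^+ 2).

End Norms.

Inductive dilution := bond | site.

Section Dilution.
Context {R : realType}.
Implicit Types (p beta : R) (x y : Z2).

Definition F_box (star : dilution) p beta (n : nat) x y : R :=
  match star with
  | bond => bernoulli_mean p (box_edges n) (fun A =>
      corr (box n) (box_edges n) (fun e => beta * (e \in A)%:R) x y)
  | site => bernoulli_mean p (box n) (fun A =>
      corr (box n) (box_edges n)
        (fun e => beta * (e.1 \in A)%:R * (e.2 \in A)%:R) x y)
  end.

(* The boxes with [x] or [y] outside are irrelevant for the limit. *)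
Definition F (star : dilution) p beta x y : R :=
  limn (fun n => F_box star p beta n x y).

Definition F_clean beta x y : R :=
  limn (fun n => corr (box n) (box_edges n) (fun=> beta) x y).

Definition exp_decay (f : Z2 -> R) : Prop :=
  exists C m : R, 0 < m /\ forall x, `|f x| <= C * expR (- m * norm_eucl x).

(* The supremum is taken in [\bar R], where it always exists; that it is
   finite is a theorem (Froehlich and Spencer), not built into the
   definition. *)
Definition beta_BKT : \bar R :=
  ereal_sup [set beta%:E | beta in
    [set beta : R | 0 <= beta /\ exp_decay (F_clean beta 0)]]%classic.

Definition alpha (star : dilution) : nat := if star is bond then 1 else 2.
Definition kappa (star : dilution) : R := if star is bond then 1 else 4.

(* H_kappa(t) = 1 - exp(-2 kappa t), with H_kappa(+oo) = 1 for kappa > 0. *)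
Definition H (k : R) (t : \bar R) : \bar R :=
  (1 - expeR (- (2 * k)%:E * t))%E.

Lemma H_fin k (t : R) : H k t%:E = (1 - expR (- (2 * k * t)))%:E.
Proof. by rewrite /H mulNe -EFinM -EFinN /=. Qed.

Lemma bernoulli_mean1 (K : choiceType) (S : {fset K}) (f : {fset K} -> R) :
  bernoulli_mean 1 S f = f S.
Proof.
rewrite /bernoulli_mean (big_fsetD1 S) ?fpowersetE ?fsubset_refl //=.
rewrite fsetDv cardfs0 expr0 expr1n !mul1r big1_seq ?addr0 // => A.
rewrite in_fsetD1 fpowersetE => /andP[_ /andP[AS sAS]].
have: S `\` A != fset0.
  by apply: contra AS; rewrite fsetD_eq0 => sSA; rewrite eqEfsubset sAS.
by rewrite -cardfs_gt0 subrr expr0n; case: #|` _| => // k _; rewrite mulr0 mul0r.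
Qed.

Lemma eq_corr (T : choiceType) (V : {fset T}) (E : {fset T * T})
    (J J' : T * T -> R) (u v : T) :
  {in E, J =1 J'} -> corr V E J u v = corr V E J' u v.
Proof.
move=> JJ'; have eqE : energy E J = energy E J'.
  by apply: funext => th; apply: eq_big_seq => e /JJ' ->.
by rewrite /corr /gibbs /unnormalized eqE.
Qed.

(* At p = 1 both diluted models are the clean model. *)
Lemma F_p1 star beta x y : F star 1 beta x y = F_clean beta x y.
Proof.
congr (limn _); apply: funext => n; case: star => /=;
  rewrite bernoulli_mean1; apply: eq_corr => e.
  by move=> ->; rewrite mulr1.
by rewrite !inE => /andP[/andP[-> ->] _]; rewrite !mulr1.
Qed.

End Dilution.

(* The encoded box is [-n, n]^2. *)
Lemma in_box (n : nat) (x : Z2) :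
  (x \in box n) = (`|x.1| <= n%:Z) && (`|x.2| <= n%:Z).
Proof.
have inI (a : int) :
    (a \in [fset i%:Z - n%:Z | i in iota 0 n.*2.+1]) = (`|a| <= n%:Z).
  rewrite ler_norml; apply/imfsetP/idP => [[i] Hi ->|Ha].
    have {Hi} : i \in iota 0 n.*2.+1 by [].
    by rewrite mem_iota; lia.
  have Hi : `|(a + n%:Z)%R|%N \in iota 0 n.*2.+1 by rewrite mem_iota; lia.
  by exists `|(a + n%:Z)%R|%N; [exact: Hi | lia].
by rewrite in_fsetM !inI.
Qed.

(* Main.v *)
Require Import Defs.
From mathcomp Require Import all_boot all_order all_algebra finmap.
From mathcomp Require Import zify ring lra.
From mathcomp Require Import all_classical all_reals all_analysis.
Import Order.TTheory GRing.Theory Num.Theory.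
Import numFieldNormedType.Exports.
Local Open Scope ring_scope.

Set Implicit Arguments.
Unset Strict Implicit.
Unset Printing Implicit Defensive.

(** The proof compares the diluted model with a clean model at a smaller coupling,
    and bounds the clean model from below at and above its critical point.

    Comparison. Let one coupling, or the couplings at one vertex, be multiplied by
    [t], and let [k] bound the number of couplings involved. The method of
    Ginibre's inequality, applied in two copies of the system, shows that
    [e^{2kt} G'(t)] is nondecreasing for every correlation [G], so [G] is a convex
    function of [1 - e^{-2kt}] ([expect_chord]). Averaging over a Bernoulli variable
    therefore dominates the deterministic coupling [b'] with
    [1 - e^{-2kb'} = p (1 - e^{-2kb})]. In the bond model this is done edge by edge
    with [k = 1]. In the site model it is done vertex by vertex with [k = 4], on the
    even sublattice and then on the odd one, so that the factor [p] appears twice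
    ([bond_comparison], [site_comparison]).

    Clean model. Let [S_N] be the sum, over the 4N points [b] of the l1 sphere of
    radius [N], of the correlation of [0] and [b] when only the couplings that touch
    the open diamond are kept. Rivasseau's inequality ([rivasseau],
    [corr_separation]) bounds the correlation of [0] and any [x] outside the diamond
    by the sum over [b] of these correlations times that of [b] and [x]. If
    [S_N < 1], iteration gives exponential decay. Since [S_N] is a continuous
    function of the coupling, [S_N >= 1] from the critical point on
    ([sphere_sum_ge1]). For [N = 2n], reflections ([reflection_ineq]) show that on
    this sphere the correlation is largest at the corner [(n, n)], and that it is at
    least as large at every point of sup norm [n]: as there are [8n] points, it is
    at least [1/(8n)] there ([F_clean_lower]).

    Method. The three correlation inequalities are obtained in the same way. A change
    of variables [(phi + psi, phi - psi)], between two copies of the system or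
    between the two sides of a reflection, turns the weight and the observables into
    limits of combinations, with nonnegative coefficients, of explicit
    trigonometric functions; only the averages of the latter have to be computed.
    For Rivasseau's inequality they are compared by an integration by parts
    ([ward]), which makes a marked vertex walk until it reaches the separating set. *)

(** * Closed convex cones of functions *)

Section Cone.
Context {R : realType} {X : Type}.
Implicit Types (G : (X -> R) -> Prop) (f g h : X -> R).

(** All positivity below is reduced to that of explicit trigonometric
    generators: Gibbs weights are exponentials of finite sums, hence uniform
    limits of combinations of products of generators. Closing under uniform
    limits inside the inductive definition makes each such transfer one
    induction. *)
Inductive cone G : (X -> R) -> Prop :=
| cone_gen g : G g -> cone G g
| cone0 : cone G (fun=> 0)
| coneD f g : cone G f -> cone G g -> cone G (fun x => f x + g x)
| coneZ c f : 0 <= c -> cone G f -> cone G (fun x => c * f x)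
| cone_lim (u : nat -> X -> R) f : (forall n, cone G (u n)) ->
    (forall e : R, 0 < e -> exists n, forall x, `|f x - u n x| <= e) ->
    cone G f.

Definition bounded_fct f := exists M : R, forall x, `|f x| <= M.

Lemma cone_eq G f g : f =1 g -> cone G f -> cone G g.
Proof. by move=> /funext ->. Qed.

Lemma cone_sum G (I : Type) (r : seq I) (F : I -> X -> R) :
  (forall i, cone G (F i)) -> cone G (fun x => \sum_(i <- r) F i x).
Proof.
move=> GF; elim: r => [|i r IH].
  by apply: cone_eq (cone0 G) => x; rewrite big_nil.
by apply: cone_eq (coneD (GF i) IH) => x; rewrite big_cons.
Qed.

Lemma cone_prod G (I : Type) (r : seq I) (F : I -> X -> R) :
  (forall f g, cone G f -> cone G g -> cone G (fun x => f x * g x)) ->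
  cone G (fun=> 1) ->
  (forall i, cone G (F i)) -> cone G (fun x => \prod_(i <- r) F i x).
Proof.
move=> GM G1 GF; elim: r => [|i r IH].
  by apply: cone_eq G1 => x; rewrite big_nil.
by apply: cone_eq (GM _ _ (GF i) IH) => x; rewrite big_cons.
Qed.

Lemma cone_bounded G f : (forall g, G g -> bounded_fct g) ->
  cone G f -> bounded_fct f.
Proof.
move=> Gb; elim=> [g /Gb //||f1 g1 _ [M Mf] _ [N Ng]|c f1 c0 _ [M Mf]|u f1 _ bu fu].
- by exists 0 => x; rewrite normr0.
- exists (M + N) => x; rewrite (le_trans (ler_normD _ _))// lerD//.
- by exists (c * M) => x; rewrite normrM (ger0_norm c0) ler_wpM2l.
- have [n fn] := fu 1 ltr01; have [M Mu] := bu n.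
  exists (1 + M) => x; rewrite -(subrK (u n x) (f1 x)).
  by rewrite (le_trans (ler_normD _ _))// lerD.
Qed.

(** Boundedness is what lets a product pass to a uniform limit of one of its
    factors. *)
Lemma coneM G f g : (forall g, G g -> bounded_fct g) ->
  (forall g h, G g -> G h -> cone G (fun x => g x * h x)) ->
  cone G f -> cone G g -> cone G (fun x => f x * g x).
Proof.
move=> Gb GM.
have GMr h f1 : G h -> cone G f1 -> cone G (fun x => f1 x * h x).
  move=> Gh; elim=> [g1 Gg||f2 g2 _ IHf _ IHg|c f2 c0 _ IH|u f2 _ IH fu].
  - exact: GM.
  - by apply: cone_eq (cone0 G) => x; rewrite mul0r.
  - by apply: cone_eq (coneD IHf IHg) => x; rewrite mulrDl.
  - by apply: cone_eq (coneZ c0 IH) => x; rewrite mulrA.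
  - apply: cone_lim IH _ => e e0; have [M hM] := Gb _ Gh.
    have M0 : 0 < `|M| + 1 by rewrite ltr_wpDl.
    have [n fn] := fu (e / (`|M| + 1)) (divr_gt0 e0 M0).
    exists n => x; rewrite -mulrBl normrM.
    have -> : e = e / (`|M| + 1) * (`|M| + 1) by rewrite divfK// gt_eqF.
    apply: ler_pM => //; apply: le_trans (hM x) _.
    by rewrite (le_trans (ler_norm _))// lerDl.
move=> Gf; elim=> [g1 Gg||f2 g2 _ IHf _ IHg|c f2 c0 _ IH|u f2 _ IH fu].
- exact: GMr.
- by apply: cone_eq (cone0 G) => x; rewrite mulr0.
- by apply: cone_eq (coneD IHf IHg) => x; rewrite mulrDr.
- by apply: cone_eq (coneZ c0 IH) => x; rewrite mulrCA.
- apply: cone_lim IH _ => e e0; have [M hM] := cone_bounded Gb Gf.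
  have M0 : 0 < `|M| + 1 by rewrite ltr_wpDl.
  have [n fn] := fu (e / (`|M| + 1)) (divr_gt0 e0 M0).
  exists n => x; rewrite -mulrBr normrM.
  have -> : e = (`|M| + 1) * (e / (`|M| + 1)) by rewrite mulrC divfK// gt_eqF.
  apply: ler_pM => //; apply: le_trans (hM x) _.
  by rewrite (le_trans (ler_norm _))// lerDl.
Qed.

End Cone.

Arguments cone0 {R X G}.

(** The two maps allow for sums and differences of the values of one function
    at two points, which is how the duplicated systems below enter. *)
Lemma cone_map {R : realType} {X Y : Type} (G : (X -> R) -> Prop)
    (G' : (Y -> R) -> Prop) (s s' : Y -> X) (c : R) f :
  (forall g, G g -> cone G' (fun y => g (s y) + c * g (s' y))) ->
  cone G f -> cone G' (fun y => f (s y) + c * f (s' y)).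
Proof.
move=> GG'; elim=> [g /GG'//||f2 g2 _ IHf _ IHg|d f2 d0 _ IH|u f2 _ IH fu].
- by apply: cone_eq cone0 => x; rewrite mulr0 addr0.
- by apply: cone_eq (coneD IHf IHg) => x; ring.
- by apply: cone_eq (coneZ d0 IH) => x; ring.
- apply: cone_lim IH _ => e e0.
  have c0 : 0 < 1 + `|c| by rewrite ltr_wpDr.
  have [n fn] := fu (e / (1 + `|c|)) (divr_gt0 e0 c0).
  exists n => x.
  have -> : e = e / (1 + `|c|) + `|c| * (e / (1 + `|c|)).
    by field; rewrite gt_eqF.
  have -> : f2 (s x) + c * f2 (s' x) - (u n (s x) + c * u n (s' x)) =
     (f2 (s x) - u n (s x)) + c * (f2 (s' x) - u n (s' x)) by ring.
  rewrite (le_trans (ler_normD _ _))// lerD//.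
  by rewrite normrM ler_wpM2l.
Qed.

Lemma cone_comp {R : realType} {X Y : Type} (G : (X -> R) -> Prop)
    (G' : (Y -> R) -> Prop) (s : Y -> X) f :
  (forall g, G g -> cone G' (fun y => g (s y))) ->
  cone G f -> cone G' (fun y => f (s y)).
Proof.
move=> GG' Gf; have : cone G' (fun y => f (s y) + 0 * f (s y)).
  apply: cone_map Gf => g /GG'; apply: cone_eq => x.
  by rewrite mul0r addr0.
by apply: cone_eq => x; rewrite mul0r addr0.
Qed.

Lemma cone_sub {R : realType} {X : Type} (G G' : (X -> R) -> Prop) f :
  (forall g, G g -> cone G' g) -> cone G f -> cone G' f.
Proof. by move=> GG'; exact: (@cone_comp _ _ _ G G' id). Qed.

Section ConeExp.
Local Open Scope classical_set_scope.
Local Open Scope ring_scope.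
Context {R : realType}.

(** The exponential series converges uniformly on bounded sets: its tails
    are dominated by the tail at the largest argument. *)
Lemma expR_partial_sum (M x : R) n : `|x| <= M ->
  `|expR x - series (exp_coeff x) n| <= expR M - series (exp_coeff M) n.
Proof.
move=> xM.
have cvx y : series (@exp_coeff R y) @ \oo --> expR y.
  exact: is_cvg_series_exp_coeff.
have le1 m : (n <= m)%N ->
    `|series (exp_coeff x) m - series (exp_coeff x) n| <=
    series (exp_coeff M) m - series (exp_coeff M) n.
  move=> nm; rewrite !sub_series_geq// (le_trans (ler_norm_sum _ _ _))//.
  apply: ler_sum => i _; rewrite /exp_coeff/= normrM normrX.
  rewrite [X in _ * X]ger0_norm ?invr_ge0// ler_wpM2r ?invr_ge0//.
  by rewrite lerXn2r// nnegrE// (le_trans _ xM).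
have cn : (fun m => `|series (exp_coeff x) m - series (exp_coeff x) n| -
    (series (exp_coeff M) m - series (exp_coeff M) n)) @ \oo -->
    `|expR x - series (exp_coeff x) n| - (expR M - series (exp_coeff M) n).
  apply: cvgB; first by apply: cvg_norm; apply: cvgB (cvx x) (cvg_cst _).
  exact: cvgB (cvx M) (cvg_cst _).
rewrite -subr_le0; apply: (cvgr_to_le cn).
by exists n => // m /= nm; rewrite subr_le0 le1.
Qed.

(** The exponential series has nonnegative coefficients. The constant term is
    subtracted because differences of Gibbs weights have the form
    [e^g (e^f - 1)]. *)
Lemma cone_expB1 (X : Type) (G : (X -> R) -> Prop) f :
  (forall g, G g -> bounded_fct g) ->
  (forall f g, cone G f -> cone G g -> cone G (fun x => f x * g x)) ->
  cone G f -> cone G (fun x => expR (f x) - 1).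
Proof.
move=> Gb GM Gf; have [M fM] := cone_bounded Gb Gf.
have GX n : cone G (fun x => f x ^+ n.+1).
  elim: n => [|n IH]; first by apply: cone_eq Gf => x; rewrite expr1.
  by apply: cone_eq (GM _ _ Gf IH) => x; rewrite [in RHS]exprS.
pose u n x := \sum_(0 <= i < n) (i.+1`!%:R)^-1 * f x ^+ i.+1.
have Gu n : cone G (u n).
  by apply: cone_sum => i; apply: coneZ; rewrite ?invr_ge0.
have uE n x : u n x = series (exp_coeff (f x)) n.+1 - 1.
  rewrite /u /series/= big_nat_recl//= /exp_coeff/= expr0 fact0 divr1 addrC addKr.
  by apply: eq_bigr => i _; rewrite mulrC.
apply: cone_lim Gu _ => e e0.
have cvM : series (@exp_coeff R M) @ \oo --> expR M.
  exact: is_cvg_series_exp_coeff.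
move/cvgrPdist_le: cvM => /(_ e e0)[n _ cvM].
exists n => x; rewrite uE opprB addrA subrK.
apply: le_trans (expR_partial_sum n.+1 (fM x)) _.
exact: le_trans (ler_norm _) (cvM n.+1 (leqnSn n)).
Qed.

Lemma cone_exp (X : Type) (G : (X -> R) -> Prop) f :
  (forall g, G g -> bounded_fct g) ->
  (forall f g, cone G f -> cone G g -> cone G (fun x => f x * g x)) ->
  cone G (fun=> 1) ->
  cone G f -> cone G (fun x => expR (f x)).
Proof.
move=> Gb GM G1 Gf.
by apply: cone_eq (coneD (cone_expB1 Gb GM Gf) G1) => x; rewrite subrK.
Qed.

End ConeExp.

(** * Averages of trigonometric functions over angles *)

Section CosIntegral.
Context {R : realType}.
Local Open Scope classical_set_scope.
Local Open Scope ring_scope.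
Local Notation mu := (@lebesgue_measure R).

Lemma sin_periodic_int (x : R) (k : int) : sin (x + k%:~R * (2 * pi)) = sin x.
Proof.
have pos (n : nat) (y : R) : sin (y + n%:R * (2 * pi)) = sin y.
  rewrite -[RHS](periodicn (@sinD2pi R) n); congr (sin (_ + _)).
  by rewrite !mulr_natl.
case: k => n; first by rewrite pos.
rewrite -(pos n.+1 (x + _)) NegzE; congr sin.
by rewrite mulrNz -pmulrn; ring.
Qed.

Lemma continuous_integrable (f : R -> R) (a b : R) : continuous f ->
  mu.-integrable `[a, b] (EFin \o f).
Proof.
move=> cf; apply: continuous_compact_integrable; first exact: segment_compact.
exact: continuous_subspaceT.
Qed.

Lemma continuous_cos_affine (k c : R) : continuous (fun t : R => cos (k * t + c)).
Proof.
move=> t; apply: differentiable_continuous; apply/derivable1_diffP.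
exact: ex_derive.
Qed.

Lemma Rintegral_cos (k : int) (c : R) : k != 0 ->
  \int[mu]_(t in `[0, 2 * pi]) cos (k%:~R * t + c) = 0.
Proof.
move=> k0; have kR0 : (k%:~R : R) != 0 by rewrite intr_eq0.
pose F (t : R) := k%:~R^-1 * sin (k%:~R * t + c).
have dF (t : R) : is_derive t 1 F (cos (k%:~R * t + c)).
  apply: is_derive_eq.
  by rewrite /GRing.scale/= ?(mulr1, mulr0, addr0, add0r) mulrCA mulVf ?mulr1.
have cF : continuous F.
  by move=> t; apply: differentiable_continuous; apply/derivable1_diffP; case: (dF t).
have cf : continuous (fun t : R => cos (k%:~R * t + c)).
  exact: continuous_cos_affine.
have pi20 : (0 : R) < 2 * pi by rewrite mulr_gt0// pi_gt0.
rewrite /Rintegral (@continuous_FTC2 _ _ F)//.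
- rewrite /F mulr0 add0r [_ + c]addrC sin_periodic_int.
  by rewrite -EFinB subrr.
- exact: continuous_subspaceT.
- split.
  + by move=> t _; case: (dF t).
  + exact: cvg_at_right_filter (cF _).
  + exact: cvg_at_left_filter (cF _).
- by move=> t _; rewrite derive1E; case: (dF t).
Qed.

End CosIntegral.

Section Trig.
Context {R : realType} {S : finType}.
Implicit Types (m : {ffun S -> int}) (a c : R) (th : S -> R) (v : S).

Definition dot m th : R := \sum_v (m v)%:~R * th v.

Lemma dotD m m' th : dot (m + m') th = dot m th + dot m' th.
Proof.
by rewrite -big_split; apply: eq_bigr => v _; rewrite ffunE intrD mulrDl.
Qed.

Lemma dotN m th : dot (- m) th = - dot m th.
Proof.
by rewrite -sumrN; apply: eq_bigr => v _; rewrite ffunE mulrNz mulNr.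
Qed.

Lemma dotB m m' th : dot (m - m') th = dot m th - dot m' th.
Proof. by rewrite dotD dotN. Qed.

Lemma dot0 th : dot 0 th = 0.
Proof. by apply: big1 => v _; rewrite ffunE mul0r. Qed.

Definition unit_charge v : {ffun S -> int} := [ffun w => (w == v)%:Z].

Lemma dot_unit v th : dot (unit_charge v) th = th v.
Proof.
rewrite /dot (bigD1 v)//= ffunE eqxx mul1r big1 ?addr0// => w /negbTE wv.
by rewrite ffunE wv mul0r.
Qed.

Definition upd (T : eqType) (eta : T -> R) x t : T -> R := [eta eta with x |-> t].

Lemma updE (T : eqType) (eta : T -> R) y t x :
  upd eta y t x = if x == y then t else eta x.
Proof. by []. Qed.

Lemma dot_upd m th v t :
  dot m (upd th v t) = (m v)%:~R * t + dot m (upd th v 0).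
Proof.
rewrite /dot (bigD1 v)//= [in RHS](bigD1 v)//= !updE eqxx mulr0 add0r.
by congr (_ + _); apply: eq_bigr => w /negbTE wv; rewrite !updE wv.
Qed.

(** A free phase covers sines, negative signs and translations of the angles
    at the same time. *)
Inductive trig : ((S -> R) -> R) -> Prop :=
| Trig m a : trig (fun th => cos (dot m th + a)).

(** The uniform closure of the trigonometric polynomials: iterated integrals,
    products and exponentials stay inside it, and two continuous functionals on it
    agree as soon as they agree on characters. *)
Definition nice := cone trig.

Inductive cosine : ((S -> R) -> R) -> Prop :=
| Cosine m : cosine (fun th => cos (dot m th)).

(** The continuous even functions of positive type; their averages are
    nonnegative by orthogonality of characters. *)
Definition pcone := cone cosine.

Lemma trig_bounded f : trig f -> bounded_fct f.
Proof.
case=> m a; exists 1 => th; rewrite ler_norml cos_le1.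
by rewrite cos_geN1.
Qed.

Lemma cosine_trig f : cosine f -> trig f.
Proof.
case=> m; rewrite (_ : (fun _ => _) = fun th => cos (dot m th + 0)).
  exact: Trig.
by apply: funext => th; rewrite addr0.
Qed.

Lemma pcone_nice f : pcone f -> nice f.
Proof. by apply: cone_sub => g /cosine_trig /cone_gen. Qed.

Lemma nice_bounded f : nice f -> bounded_fct f.
Proof. exact: cone_bounded trig_bounded. Qed.

Lemma cosM (x y : R) : cos x * cos y = 2^-1 * cos (x + y) + 2^-1 * cos (x - y).
Proof. by rewrite cosD cosB; field. Qed.

Lemma half_ge0 : 0 <= 2^-1 :> R.
Proof. by rewrite invr_ge0. Qed.

Lemma niceM f g : nice f -> nice g -> nice (fun th => f th * g th).
Proof.
apply: coneM; first exact: trig_bounded.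
move=> _ _ [m a] [n b].
apply: cone_eq (coneD (coneZ half_ge0 (cone_gen (Trig (m + n) (a + b))))
  (coneZ half_ge0 (cone_gen (Trig (m - n) (a - b))))) => th.
by rewrite cosM dotD dotB; congr (_ * cos _ + _ * cos _); ring.
Qed.

Lemma pconeM f g : pcone f -> pcone g -> pcone (fun th => f th * g th).
Proof.
apply: coneM; first by move=> h /cosine_trig /trig_bounded.
move=> _ _ [m] [n].
apply: cone_eq (coneD (coneZ half_ge0 (cone_gen (Cosine (m + n))))
  (coneZ half_ge0 (cone_gen (Cosine (m - n))))) => th.
by rewrite cosM dotD dotB.
Qed.

Lemma pcone1 : pcone (fun=> 1).
Proof. by apply: cone_eq (cone_gen (Cosine 0)) => th; rewrite dot0 cos0. Qed.

Lemma pcone_cst c : 0 <= c -> pcone (fun=> c).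
Proof. by move=> c0; apply: cone_eq (coneZ c0 pcone1) => th; rewrite mulr1. Qed.

Lemma niceD f g : nice f -> nice g -> nice (fun th => f th + g th).
Proof. exact: coneD. Qed.

Lemma nice_cst c : nice (fun=> c).
Proof.
have [c0|/ltW c0] := leP 0 c; first exact/pcone_nice/pcone_cst.
have N1 : nice (fun=> -1).
  by apply: cone_eq (cone_gen (Trig 0 pi)) => th; rewrite dot0 add0r cospi.
have Nc : 0 <= - c by rewrite oppr_ge0.
by apply: cone_eq (coneZ Nc N1) => th; rewrite mulrNN mulr1.
Qed.

Lemma niceZ c f : nice f -> nice (fun th => c * f th).
Proof. exact: niceM (nice_cst c). Qed.

Lemma niceN f : nice f -> nice (fun th => - f th).
Proof. by move=> /(niceZ (-1)); apply: cone_eq => th; rewrite mulN1r. Qed.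

Lemma niceB f g : nice f -> nice g -> nice (fun th => f th - g th).
Proof. by move=> nf /niceN; exact: niceD. Qed.

Lemma nice_sum (I : Type) (r : seq I) F :
  (forall i, nice (F i)) -> nice (fun th => \sum_(i <- r) F i th).
Proof. exact: cone_sum. Qed.

Lemma nice_exp f : nice f -> nice (fun th => expR (f th)).
Proof.
exact: cone_exp trig_bounded niceM (nice_cst 1).
Qed.

Lemma pcone_exp f : pcone f -> pcone (fun th => expR (f th)).
Proof.
by apply: cone_exp pconeM pcone1 => g /cosine_trig /trig_bounded.
Qed.

Lemma nice_cos m a : nice (fun th => cos (dot m th + a)).
Proof. exact/cone_gen/Trig. Qed.

Lemma nice_sin m a : nice (fun th => sin (dot m th + a)).
Proof.
by apply: cone_eq (nice_cos m (a - pi / 2)) => th; rewrite addrA cosBpihalf.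
Qed.

(** ** The Haar average *)
Local Open Scope classical_set_scope.
Local Open Scope ring_scope.
Local Notation mu := (@lebesgue_measure R).

Definition avg v (f : (S -> R) -> R) th : R :=
  (2 * pi)^-1 * \int[mu]_(t in `[0, 2 * pi]) f (upd th v t).

Lemma nice_continuous f v th : nice f -> continuous (fun t => f (upd th v t)).
Proof.
elim=> [_ [m a]||f1 g1 _ cf _ cg|c f1 _ _ cf|u f1 _ cu fu] t.
- rewrite (_ : (fun _ => _) =
      fun t => cos ((m v)%:~R * t + (dot m (upd th v 0) + a))); last first.
    by apply: funext => s; rewrite dot_upd addrA.
  exact: continuous_cos_affine.
- exact: cst_continuous.
- exact: continuousD (cf t) (cg t).
- by apply: (@continuousM _ _ (fun=> c) (fun t => f1 (upd th v t)) t); 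
    [exact: cst_continuous|exact: cf].
- apply/cvgrPdist_le => e e0; have e3 : 0 < e / 3 by rewrite divr_gt0.
  have [n fn] := fu _ e3.
  have /cvgrPdist_le /(_ _ e3) := cu n t.
  apply: filterS => s hs.
  rewrite (_ : _ - _ = (f1 (upd th v t) - u n (upd th v t)) +
    (u n (upd th v t) - u n (upd th v s)) - (f1 (upd th v s) - u n (upd th v s))); last by ring.
  rewrite (le_trans (ler_normB _ _))// (_ : e = e / 3 + e / 3 + e / 3); last by field.
  by rewrite lerD// (le_trans (ler_normD _ _))// lerD.
Qed.

Lemma nice_integrable f v th a b : nice f ->
  mu.-integrable `[a, b] (EFin \o (fun t => f (upd th v t))).
Proof. by move=> nf; apply: continuous_integrable; exact: nice_continuous. Qed.

Let pi20 : 0 < 2 * pi :> R. Proof. by rewrite mulr_gt0// pi_gt0. Qed.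

Lemma avg_const v th c : avg v (fun=> c) th = c.
Proof.
have H : lebesgue_measure `[0, 2 * pi : R] = (2 * pi)%:E.
  by rewrite lebesgue_measure_itv/= lte_fin pi20 oppr0 adde0.
rewrite /avg Rintegral_cst// [X in fine X](_ : _ = (2 * pi)%:E)//=.
by rewrite mulrCA mulVf ?mulr1// gt_eqF.
Qed.

Lemma avgD v f g th : nice f -> nice g ->
  avg v (fun th => f th + g th) th = avg v f th + avg v g th.
Proof.
move=> nf ng; rewrite /avg -mulrDr; congr (_ * _).
by apply: RintegralD => //; exact: nice_integrable.
Qed.

Lemma avgZ v c f th : nice f -> avg v (fun th => c * f th) th = c * avg v f th.
Proof.
move=> nf; rewrite /avg (_ : Rintegral _ _ _ = c * \int[mu]_(t in `[0, 2 * pi]) f (upd th v t)).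
  by rewrite mulrCA.
by apply: RintegralZl => //; exact: nice_integrable.
Qed.

Lemma le_avg v f g th : nice f -> nice g -> (forall th, f th <= g th) ->
  avg v f th <= avg v g th.
Proof.
move=> nf ng fg; rewrite /avg ler_wpM2l ?invr_ge0 ?(ltW pi20)//.
by apply: le_Rintegral => //; exact: nice_integrable.
Qed.

Lemma avg_dist v f g th e : nice f -> nice g ->
  (forall th, `|f th - g th| <= e) -> `|avg v f th - avg v g th| <= e.
Proof.
move=> nf ng fg.
rewrite (_ : avg v f th - avg v g th = avg v (fun th => f th - g th) th); last first.
  rewrite avgD//; last exact: niceN.
  congr (_ + _); rewrite -mulN1r -avgZ//; congr avg.
  by apply: funext => th'; rewrite mulN1r.
have nh := niceB nf ng.
rewrite ler_norml -{1}(avg_const v th (- e)) -{2}(avg_const v th e).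
apply/andP; split; apply: le_avg => // [|th']; try exact: nice_cst;
by have := fg th'; rewrite ler_norml => /andP[].
Qed.

Lemma avg_trig v m a th :
  avg v (fun th => cos (dot m th + a)) th =
  if m v == 0 then cos (dot m th + a) else 0.
Proof.
have [mv0|mv0] := eqVneq (m v) 0.
  rewrite -[RHS](avg_const v th); congr (_ * _); apply: eq_Rintegral => t _.
  rewrite dot_upd mv0 mul0r add0r; congr (cos (_ + _)).
  apply: eq_bigr => w _; rewrite updE; case: eqP => // ->.
  by rewrite mv0 !mul0r.
rewrite /avg (_ : Rintegral _ _ _ = 0) ?mulr0//.
rewrite -[RHS](Rintegral_cos (dot m (upd th v 0) + a) mv0).
by apply: eq_Rintegral => t _; rewrite dot_upd addrA.
Qed.

Lemma nice_avg v f : nice f -> nice (avg v f).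
Proof.
elim=> [_ [m a]||f1 g1 nf cf ng cg|c f1 c0 nf cf|u f1 nu cu fu].
- have [mv0|mv0] := boolP (m v == 0).
    by apply: cone_eq (nice_cos m a) => th; rewrite avg_trig mv0.
  by apply: cone_eq cone0 => th; rewrite avg_trig (negbTE mv0).
- by apply: cone_eq cone0 => th; rewrite avg_const.
- by apply: cone_eq (coneD cf cg) => th; rewrite avgD.
- by apply: cone_eq (coneZ c0 cf) => th; rewrite avgZ.
- apply: cone_lim cu _ => e e0; have [n fn] := fu e e0.
  by exists n => th; apply: avg_dist => //; exact: cone_lim nu fu.
Qed.

Definition haar (f : (S -> R) -> R) : R := angle_integral (enum S) f (fun=> 0).

Lemma angle_integral_cons (s : seq S) v f th :
  angle_integral (v :: s) f th = avg v (angle_integral s f) th.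
Proof. by []. Qed.

Lemma nice_angle s f : nice f -> nice (angle_integral s f).
Proof. by move=> nf; elim: s => // v s IH; exact: nice_avg. Qed.

Lemma haar_const c : haar (fun=> c) = c.
Proof.
rewrite /haar; move: (fun=> 0); elim: (enum S) => //= v s IH th.
rewrite -[RHS](avg_const v th); congr (_ * _).
by apply: eq_Rintegral => t _; rewrite IH.
Qed.

Lemma haarD f g : nice f -> nice g ->
  haar (fun th => f th + g th) = haar f + haar g.
Proof.
move=> nf ng; rewrite /haar; move: (fun=> 0); elim: (enum S) => // v s IH th.
rewrite !angle_integral_cons -avgD; try exact: nice_angle.
by congr (_ * _); apply: eq_Rintegral => t _; rewrite IH.
Qed.

Lemma haarZ c f : nice f -> haar (fun th => c * f th) = c * haar f.
Proof.
move=> nf; rewrite /haar; move: (fun=> 0); elim: (enum S) => // v s IH th.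
rewrite !angle_integral_cons -avgZ; try exact: nice_angle.
by congr (_ * _); apply: eq_Rintegral => t _; rewrite IH.
Qed.

Lemma le_haar f g : nice f -> nice g -> (forall th, f th <= g th) ->
  haar f <= haar g.
Proof.
move=> nf ng fg; rewrite /haar; move: (fun=> 0); elim: (enum S) => // v s IH th.
by rewrite !angle_integral_cons; apply: le_avg => //; exact: nice_angle.
Qed.

Lemma eq_haar f g : f =1 g -> haar f = haar g.
Proof. by move=> /funext ->. Qed.

Lemma haarN f : nice f -> haar (fun th => - f th) = - haar f.
Proof.
by move=> nf; rewrite -mulN1r -haarZ//; apply: eq_haar => th; rewrite mulN1r.
Qed.

Lemma haarB f g : nice f -> nice g ->
  haar (fun th => f th - g th) = haar f - haar g.
Proof. by move=> nf ng; rewrite haarD ?haarN//; exact: niceN. Qed.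

Lemma haar_sum (I : Type) (r : seq I) F : (forall i, nice (F i)) ->
  haar (fun th => \sum_(i <- r) F i th) = \sum_(i <- r) haar (F i).
Proof.
move=> nF; elim: r => [|i r IH].
  by rewrite big_nil -[RHS](haar_const 0); apply: eq_haar => th; rewrite big_nil.
rewrite big_cons -IH -haarD//; last exact: nice_sum.
by apply: eq_haar => th; rewrite big_cons.
Qed.

Lemma haar_ge0 f : nice f -> (forall th, 0 <= f th) -> 0 <= haar f.
Proof. by move=> nf f0; rewrite -(haar_const 0); apply: le_haar => //; exact: nice_cst. Qed.

Lemma haar_dist f g e : nice f -> nice g ->
  (forall th, `|f th - g th| <= e) -> `|haar f - haar g| <= e.
Proof.
move=> nf ng fg; have nh := niceB nf ng.
rewrite -haarB// ler_norml -{1}(haar_const (- e)) -{2}(haar_const e).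
apply/andP; split; apply: le_haar => // [|th]; try exact: nice_cst;
by have := fg th; rewrite ler_norml => /andP[].
Qed.

(** Orthogonality of characters: each coordinate with a nonzero charge
    averages the character to 0. *)
Lemma haar_trig m a :
  haar (fun th => cos (dot m th + a)) = if m == 0 then cos a else 0.
Proof.
have main s th : angle_integral s (fun th => cos (dot m th + a)) th =
    if all (fun v => m v == 0) s then cos (dot m th + a) else 0.
  elim: s th => //= v s IH th.
  rewrite -[LHS]/(avg v _ th) (_ : angle_integral s _ = fun th =>
    if all (fun v => m v == 0) s then cos (dot m th + a) else 0); last exact: funext.
  by case: (all _ _); rewrite ?andbF ?avg_const// andbT avg_trig.
rewrite /haar main.
have -> : all (fun v => m v == 0) (enum S) = (m == 0).
  apply/allP/eqP => [h|-> v _]; last by rewrite ffunE.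
  by apply/ffunP => v; rewrite ffunE; apply/eqP/h; rewrite mem_enum.
case: eqP => // ->; by rewrite dot0 add0r.
Qed.

Lemma haar_cosine m : haar (fun th => cos (dot m th)) = (m == 0)%:R.
Proof.
transitivity (haar (fun th => cos (dot m th + 0))).
  by apply: eq_haar => th; rewrite addr0.
by rewrite haar_trig cos0; case: eqP.
Qed.

(** Checking a correlation inequality on the generators of the cone of weights
    is enough, since [f] enters linearly and continuously. *)
Lemma haar_cone_ge0 G w f : (forall g, G g -> nice g) -> nice w ->
  (forall g, G g -> 0 <= haar (fun th => g th * w th)) ->
  cone G f -> 0 <= haar (fun th => f th * w th).
Proof.
move=> Gn nw G0.
have Gn' f1 : cone G f1 -> nice f1 by exact: cone_sub.
elim=> [g /G0//||f1 g1 nf cf ng cg|c f1 c0 nf cf|u f1 nu cu fu].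
- have -> : haar (fun th => 0 * w th) = 0.
    by rewrite -[RHS]haar_const; apply: eq_haar => th; rewrite mul0r.
  by [].
- rewrite (_ : haar _ = haar (fun th => f1 th * w th) + haar (fun th => g1 th * w th)) ?addr_ge0//.
  rewrite -haarD; [|exact: niceM (Gn' _ nf) nw|exact: niceM (Gn' _ ng) nw].
  by apply: eq_haar => th; rewrite mulrDl.
- rewrite (_ : haar _ = c * haar (fun th => f1 th * w th)) ?mulr_ge0//.
  rewrite -haarZ; last exact: niceM (Gn' _ nf) nw.
  by apply: eq_haar => th; rewrite mulrA.
- have nf1 : nice f1 by apply: cone_lim fu => n; exact: Gn'.
  have [M wM] := nice_bounded nw.
  apply/ler_addgt0Pr => e e0.
  have M0 : 0 < `|M| + 1 by rewrite ltr_wpDl.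
  have [n fn] := fu _ (divr_gt0 e0 M0).
  have : `|haar (fun th => f1 th * w th) - haar (fun th => u n th * w th)| <= e.
    apply: haar_dist; [exact: niceM nf1 nw|exact: niceM (Gn' _ (nu n)) nw|].
    move=> th; rewrite -mulrBl normrM.
    have -> : e = e / (`|M| + 1) * (`|M| + 1) by rewrite divfK// gt_eqF.
    apply: ler_pM => //; apply: le_trans (wM th) _.
    by rewrite (le_trans (ler_norm _))// lerDl.
  rewrite ler_distlC => /andP[_]; apply: le_trans.
  exact: cu.
Qed.

Lemma haar_pcone_ge0 f : pcone f -> 0 <= haar f.
Proof.
move=> pf; have -> : haar f = haar (fun th => f th * 1).
  by apply: eq_haar => th; rewrite mulr1.
apply: haar_cone_ge0 pf => [g [m]| |_ [m]].
- exact/pcone_nice/cone_gen/Cosine.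
- exact: nice_cst.
- have -> : haar (fun th => cos (dot m th) * 1) = haar (fun th => cos (dot m th)).
    by apply: eq_haar => th; rewrite mulr1.
  by rewrite haar_cosine.
Qed.

End Trig.

Arguments nice_cst {R S}.

(** * Changes of variables *)

Section Functional.
Context {R : realType} {S : finType}.
Implicit Types (f g : (S -> R) -> R) (th : S -> R).

(** The factor [K] and the Lipschitz constant make the lemma apply to products
    of averages, one factor at a time. *)
Lemma haar_unique (L : ((S -> R) -> R) -> R) (K C : R) :
  (forall f g, nice f -> nice g -> L (fun th => f th + g th) = L f + L g) ->
  (forall c f, nice f -> L (fun th => c * f th) = c * L f) ->
  (forall f g e, nice f -> nice g -> (forall th, `|f th - g th| <= e) ->
     `|L f - L g| <= C * e) ->
  (forall m a, L (fun th => cos (dot m th + a)) = if m == 0 then K * cos a else 0) ->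
  forall f, nice f -> L f = K * haar f.
Proof.
move=> LD LZ LC Lt f; elim=> [_ [m a]||f1 g1 nf cf ng cg|c f1 c0 nf cf|u f1 nu cu fu].
- by rewrite Lt haar_trig; case: eqP => //; rewrite mulr0.
- rewrite haar_const mulr0 -[RHS](mul0r (L (fun=> 1))) -LZ; last exact: nice_cst.
  by congr L; apply: funext => th; rewrite mul0r.
- by rewrite LD// haarD// cf cg mulrDr.
- by rewrite LZ// haarZ// cf mulrCA.
- have nf1 : nice f1 by exact: cone_lim fu.
  apply/eqP; rewrite -subr_eq0 -normr_le0; apply/ler_addgt0Pr => e e0; rewrite add0r.
  have D0 : 0 < `|C| + `|K| + 1 by rewrite ltr_wpDl// addr_ge0.
  have e1 : 0 < e / (`|C| + `|K| + 1) by rewrite divr_gt0.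
  have [n fn] := fu _ e1.
  have h1 := LC _ _ _ nf1 (nu n) fn.
  have h2 := haar_dist nf1 (nu n) fn.
  rewrite (_ : _ - _ = (L f1 - L (u n)) - K * (haar f1 - haar (u n))); last first.
    by rewrite cu; ring.
  rewrite (le_trans (ler_normB _ _))// normrM.
  rewrite (_ : e = (`|C| + `|K| + 1) * (e / (`|C| + `|K| + 1))); last first.
    by rewrite mulrC divfK// gt_eqF.
  rewrite 2!mulrDl mul1r -[leLHS]addr0 lerD// ?(ltW e1)// lerD//.
    by rewrite (le_trans h1)// ler_wpM2r ?(ltW e1)// ler_norm.
  by rewrite ler_wpM2l.
Qed.

End Functional.

Section Substitution.
Context {R : realType} {S S' : finType}.
Implicit Types (s : (S' -> R) -> (S -> R)).

(** Maps that are affine with integer coefficients and whose dual map on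
    characters is injective: exactly those under which the Haar average is
    invariant. Relabellings, inclusions of vertex sets, sign changes and the
    rotations of a duplicated system are all of this kind. *)
Definition affine_map s := forall m : {ffun S -> int}, exists m' c,
  (forall th, dot m (s th) = dot m' th + c) /\ (m' = 0 -> m = 0).

Lemma nice_subst s f : affine_map s -> nice f -> nice (fun th => f (s th)).
Proof.
move=> As; apply: cone_comp => _ [m a]; have [m' [c [E _]]] := As m.
by apply: cone_eq (nice_cos m' (c + a)) => th; rewrite E addrA.
Qed.

Lemma haar_subst s f : affine_map s -> nice f ->
  haar (fun th => f (s th)) = haar f.
Proof.
move=> As nf; rewrite -[RHS]mul1r; pose L (f : (S -> R) -> R) := haar (fun th => f (s th)).
apply: (@haar_unique _ _ L 1 1) nf => [f1 g1 nf1 ng1|c f1 nf1|f1 g1 e nf1 ng1 fg|m a].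
- by apply: haarD; exact: nice_subst.
- by apply: haarZ; exact: nice_subst.
- by rewrite mul1r; apply: haar_dist => //; exact: nice_subst.
- have [m' [c [E m0]]] := As m; rewrite /L mul1r.
  case: eqP => [->|mn0].
    by rewrite -[RHS](@haar_const _ S'); apply: eq_haar => th; rewrite dot0 add0r.
  transitivity (haar (fun th : S' -> R => cos (dot m' th + (c + a)))).
    by apply: eq_haar => th; rewrite E addrA.
  by rewrite haar_trig; case: eqP => // /m0.
Qed.

End Substitution.

Section Relabel.
Context {R : realType} {S S' : finType}.

Lemma affine_relabel (j : S -> S') : injective j ->
  @affine_map R S S' (fun th v => th (j v)).
Proof.
move=> ij m; exists [ffun w => \sum_(v | j v == w) m v], 0; split => [th|m0].
  rewrite addr0 /dot (partition_big j predT)//=; apply: eq_bigr => w _.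
  rewrite ffunE rmorph_sum mulr_suml; by apply: eq_bigr => v /eqP <-.
apply/ffunP => v; move/ffunP: m0 => /(_ (j v)).
by rewrite !ffunE (big_pred1 v)// => w; rewrite /= (inj_eq ij).
Qed.

Lemma affine_flip (s : S -> int) (c : S -> R) : (forall v, s v != 0) ->
  @affine_map R S S (fun th v => (s v)%:~R * th v + c v).
Proof.
move=> s0 m; exists [ffun w => m w * s w], (\sum_v (m v)%:~R * c v); split => [th|m0].
  rewrite /dot -big_split; apply: eq_bigr => v _; rewrite ffunE intrM/=; ring.
apply/ffunP => v; move/ffunP: m0 => /(_ v); rewrite !ffunE.
by move/eqP; rewrite mulf_eq0 (negbTE (s0 v)) orbF => /eqP.
Qed.

End Relabel.

Lemma haar_opp {R : realType} {S : finType} (f : (S -> R) -> R) : nice f ->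
  haar (fun th => f (fun v => - th v)) = haar f.
Proof.
move=> nf; rewrite -(haar_subst (affine_flip (s := fun=> -1) (fun=> 0) (fun=> isT)) nf).
by apply: eq_haar => th; congr f; apply: funext => v; rewrite addr0 mulN1r.
Qed.

Section Doubling.
Context {R : realType} {S S' : finType}.
Implicit Types (th : S + S' -> R).

Definition lpart th v := th (inl v).
Definition rpart th v := th (inr v).

Lemma affine_lpart : @affine_map R S (S + S')%type lpart.
Proof. by apply: affine_relabel => x y []. Qed.

Lemma affine_rpart : @affine_map R S' (S + S')%type rpart.
Proof. by apply: affine_relabel => x y []. Qed.

Lemma dot_sum (m : {ffun S + S' -> int}) th : dot m th =
  dot [ffun v => m (inl v)] (lpart th) + dot [ffun v => m (inr v)] (rpart th).
Proof.
by rewrite /dot big_sumType; congr (_ + _); apply: eq_bigr => v _; rewrite ffunE.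
Qed.

Lemma dot_pair (m : {ffun S -> int}) (m' : {ffun S' -> int}) th :
  dot m (lpart th) + dot m' (rpart th) =
  dot [ffun v => match v with inl v => m v | inr v => m' v end] th.
Proof.
by rewrite dot_sum; congr (_ + _); apply: eq_bigr => v _; rewrite !ffunE.
Qed.

Lemma nice_lpart f : nice f -> nice (fun th => f (lpart th)).
Proof. exact: nice_subst affine_lpart. Qed.

Lemma nice_rpart f : nice f -> nice (fun th => f (rpart th)).
Proof. exact: nice_subst affine_rpart. Qed.

Lemma haar_prod (f : (S -> R) -> R) (g : (S' -> R) -> R) : nice f -> nice g ->
  haar (fun th => f (lpart th) * g (rpart th)) = haar f * haar g.
Proof.
have bnd (T : finType) (h : (T -> R) -> R) : nice h -> exists2 M, 0 <= M & forall x, `|h x| <= M.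
  move=> /nice_bounded[M hM]; exists `|M| => // th.
  exact: le_trans (hM th) (ler_norm _).
move=> nf ng; have nf' := nice_lpart nf; have ng' := nice_rpart ng.
have [Mf Mf0 fM] := bnd _ _ nf.
rewrite mulrC [RHS]mulrC.
pose L (g : (S' -> R) -> R) := haar (fun th => f (lpart th) * g (rpart th)).
apply: (@haar_unique _ _ L (haar f) Mf) ng => [f1 g1 nf1 ng1|c f1 nf1|f1 g1 e nf1 ng1 fg|m a].
- rewrite -haarD; try by apply: niceM nf' _; exact: nice_rpart.
  by apply: eq_haar => th; rewrite mulrDr.
- rewrite -haarZ; try by apply: niceM nf' _; exact: nice_rpart.
  by apply: eq_haar => th; rewrite mulrCA.
- apply: haar_dist; try by apply: niceM nf' _; exact: nice_rpart.
  by move=> th; rewrite -mulrBr normrM ler_pM.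
have nc := nice_rpart (nice_cos m a).
have -> : (if m == 0 then haar f * cos a else 0) = (m == 0)%:R * cos a * haar f.
  by case: (m == 0); rewrite ?mul1r ?mul0r// mulrC.
pose L' (f : (S -> R) -> R) := haar (fun th => f (lpart th) * cos (dot m (rpart th) + a)).
apply: (@haar_unique _ _ L' ((m == 0)%:R * cos a) 1) nf => [f1 g1 nf1 ng1|c f1 nf1|f1 g1 e nf1 ng1 fg|n b].
- rewrite -haarD; try by apply: niceM nc; exact: nice_lpart.
  by apply: eq_haar => th; rewrite mulrDl.
- rewrite -haarZ; try by apply: niceM nc; exact: nice_lpart.
  by apply: eq_haar => th; rewrite mulrA.
- apply: haar_dist; try by apply: niceM nc; exact: nice_lpart.
  move=> th; rewrite -mulrBl normrM mulrC ler_pM// ler_norml.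
  by rewrite cos_le1 cos_geN1.
pose mn s : {ffun S + S' -> int} := [ffun v => match v with inl v => n v | inr v => s * m v end].
have mnE s th : dot (mn s) th = dot n (lpart th) + s%:~R * dot m (rpart th).
  rewrite dot_sum; congr (_ + _); first by apply: eq_bigr => v _; rewrite !ffunE.
  by rewrite mulr_sumr; apply: eq_bigr => v _; rewrite !ffunE intrM mulrA.
have mn0 s : s != 0 -> (mn s == 0) = (n == 0) && (m == 0).
  move=> s0; apply/eqP/andP => [/ffunP E|[/eqP n0 /eqP m0]]; last first.
    by apply/ffunP => -[] v; rewrite ffunE ?n0 ?m0 !ffunE ?mulr0.
  split; apply/eqP/ffunP => v; first by have := E (inl v); rewrite !ffunE.
  have := E (inr v); rewrite !ffunE => /eqP.
  by rewrite mulf_eq0 (negbTE s0) => /eqP.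
transitivity (2^-1 * haar (fun th : S + S' -> R => cos (dot (mn 1) th + (b + a))) +
              2^-1 * haar (fun th : S + S' -> R => cos (dot (mn (-1)) th + (b - a)))).
  have n1 := @nice_cos R _ (mn 1) (b + a); have n2 := @nice_cos R _ (mn (-1)) (b - a).
  rewrite -(haarZ _ n1) -(haarZ _ n2) -haarD; [|exact: niceZ|exact: niceZ].
  apply: eq_haar => th; rewrite cosM !mnE mul1r mulN1r.
  by congr (_ * cos _ + _ * cos _); ring.
rewrite !haar_trig !mn0//; case: (n == 0); rewrite /= ?mulr0 ?addr0//.
case: (m == 0); rewrite ?mulr0 ?mul0r ?addr0// mul1r.
by rewrite -cosM mulrC.
Qed.

End Doubling.

Section Doubling2.
Context {R : realType} {S : finType}.
Implicit Types (th : S + S -> R).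

(** The change of variables of the duplicated system: an arbitrary pair
    [(phi, psi)] of configurations is sent to [(phi + psi, phi - psi)]. It is
    not a bijection of the torus but it preserves the Haar average, because a
    character is killed by the dual map only if it is trivial. *)
Definition rotate th (v : S + S) : R :=
  match v with inl v => th (inl v) + th (inr v) | inr v => th (inl v) - th (inr v) end.

Lemma affine_rotate : @affine_map R (S + S)%type (S + S)%type rotate.
Proof.
move=> m; exists [ffun v => match v with inl v => m (inl v) + m (inr v)
  | inr v => m (inl v) - m (inr v) end], 0; split => [th|/ffunP m0].
  rewrite addr0 !dot_sum /dot -!big_split; apply: eq_bigr => v _ /=.
  rewrite !ffunE /lpart /rpart /rotate intrD intrB; ring.
have E v : m (inl v) = 0 /\ m (inr v) = 0.
  by have := m0 (inl v); have := m0 (inr v); rewrite !ffunE; lia.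
by apply/ffunP => -[] v; have [] := E v; rewrite ffunE.
Qed.

Lemma dot_rotl m th : dot m (lpart (rotate th)) = dot m (lpart th) + dot m (rpart th).
Proof. by rewrite /dot -big_split; apply: eq_bigr => v _ /=; rewrite -mulrDr. Qed.

Lemma dot_rotr m th : dot m (rpart (rotate th)) = dot m (lpart th) - dot m (rpart th).
Proof. by rewrite /dot -sumrB; apply: eq_bigr => v _; rewrite -mulrBr. Qed.

End Doubling2.

(** * Gibbs expectations and Ginibre's inequality *)

Section Ginibre.
Context {R : realType} {S : finType}.

(** In the rotated variables a sum [cos(m.th) + cos(m.th')] is
    [2 cos(m.phi) cos(m.psi)] and a difference is a product of two sines, so
    sums and differences of functions of positive type become combinations of
    the functions [F(phi) F(psi)], whose averages are squares. *)
Inductive tensor_square : (((S + S)%type -> R) -> R) -> Prop :=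
| TensorSquare F : nice F -> tensor_square (fun th => F (lpart th) * F (rpart th)).

Lemma tensor_square_nice f : tensor_square f -> nice f.
Proof. by case=> F nF; apply: niceM; [exact: nice_lpart|exact: nice_rpart]. Qed.

Lemma tensor_square_bounded f : tensor_square f -> bounded_fct f.
Proof. by move=> /tensor_square_nice /nice_bounded. Qed.

Lemma cone_tensor_squareM f g : cone tensor_square f -> cone tensor_square g ->
  cone tensor_square (fun th => f th * g th).
Proof.
apply: coneM; first exact: tensor_square_bounded.
move=> _ _ [F nF] [G nG].
by apply: cone_eq (cone_gen (TensorSquare (niceM nF nG))) => th; rewrite mulrACA.
Qed.

Lemma cone_tensor_square_cst (c : R) : 0 <= c -> cone tensor_square (fun=> c).
Proof.
move=> c0; apply: cone_eq (coneZ c0 (cone_gen (TensorSquare (nice_cst 1)))) => th.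
by rewrite !mulr1.
Qed.

Lemma cone_tensor_square_exp f : cone tensor_square f ->
  cone tensor_square (fun th => expR (f th)).
Proof.
apply: cone_exp tensor_square_bounded cone_tensor_squareM _.
exact: cone_tensor_square_cst.
Qed.

Lemma cone_tensor_square_nice f : cone tensor_square f -> nice f.
Proof. exact: cone_sub tensor_square_nice. Qed.

Lemma haar_tensor_square_ge0 f : cone tensor_square f -> 0 <= haar f.
Proof.
move=> cf; have -> : haar f = haar (fun th => f th * 1).
  by apply: eq_haar => th; rewrite mulr1.
apply: haar_cone_ge0 cf => [g /tensor_square_nice//| |_ [F nF]]; first exact: nice_cst.
have -> : haar (fun th => F (lpart th) * F (rpart th) * 1) = haar F * haar F.
  by rewrite -haar_prod//; apply: eq_haar => th; rewrite mulr1.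
by rewrite -expr2 sqr_ge0.
Qed.

Implicit Types (f g H w : (S -> R) -> R).

Lemma rotate_add f : pcone f ->
  cone tensor_square (fun th => f (lpart (rotate th)) + f (rpart (rotate th))).
Proof.
move=> pf; apply: (@cone_eq _ _ _ (fun th => f (lpart (rotate th)) + 1 * f (rpart (rotate th)))).
  by move=> th; rewrite mul1r.
apply: cone_map pf => _ [m].
have nc : @nice R S (fun th => cos (dot m th)) by exact/pcone_nice/cone_gen/Cosine.
apply: cone_eq (coneZ (ler0n _ 2) (cone_gen (TensorSquare nc))) => th.
by rewrite dot_rotl dot_rotr cosB cosD; ring.
Qed.

Lemma rotate_sub f : pcone f ->
  cone tensor_square (fun th => f (rpart (rotate th)) - f (lpart (rotate th))).
Proof.
move=> pf; apply: (@cone_eq _ _ _ (fun th => f (rpart (rotate th)) + -1 * f (lpart (rotate th)))).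
  by move=> th; rewrite mulN1r.
apply: cone_map pf => _ [m].
have nc : @nice R S (fun th => sin (dot m th)).
  by apply: cone_eq (nice_sin m 0) => th; rewrite addr0.
apply: cone_eq (coneZ (ler0n _ 2) (cone_gen (TensorSquare nc))) => th.
by rewrite dot_rotl dot_rotr cosB cosD; ring.
Qed.

(** A covariance is half the average, over two independent copies, of the
    product of the differences. *)
Lemma haar_cov f g w : nice f -> nice g -> nice w ->
  haar (fun th => f th * g th * w th) * haar w -
  haar (fun th => f th * w th) * haar (fun th => g th * w th) =
  2^-1 * haar (fun th : S + S -> R =>
    (f (rpart (rotate th)) - f (lpart (rotate th))) *
    (g (rpart (rotate th)) - g (lpart (rotate th))) *
    (w (lpart (rotate th)) * w (rpart (rotate th)))).
Proof.
move=> nf ng nw.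
have nfw := niceM nf nw; have ngw := niceM ng nw; have nfgw := niceM (niceM nf ng) nw.
have nlr f1 f2 : nice f1 -> nice f2 -> @nice R (S + S)%type (fun th => f1 (lpart th) * f2 (rpart th)).
  by move=> n1 n2; apply: niceM; [exact: nice_lpart|exact: nice_rpart].
pose k (th : S + S -> R) := (f (rpart th) - f (lpart th)) * (g (rpart th) - g (lpart th)) *
   (w (lpart th) * w (rpart th)).
have nk : nice k.
  apply: niceM; last exact: nlr.
  by apply: niceM; apply: niceB; try exact: nice_lpart; exact: nice_rpart.
rewrite (haar_subst (@affine_rotate _ _) nk).
have -> : haar k = haar (fun th : S + S -> R =>
    (w (lpart th) * (f (rpart th) * g (rpart th) * w (rpart th)) -
     (f (lpart th) * w (lpart th)) * (g (rpart th) * w (rpart th))) -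
    ((g (lpart th) * w (lpart th)) * (f (rpart th) * w (rpart th)) -
     (f (lpart th) * g (lpart th) * w (lpart th)) * w (rpart th))).
  by apply: eq_haar => th; rewrite /k; ring.
have n1 := nlr _ _ nw nfgw; have n2 := nlr _ _ nfw ngw.
have n3 := nlr _ _ ngw nfw; have n4 := nlr _ _ nfgw nw.
rewrite haarB; [|exact: niceB|exact: niceB].
rewrite (haarB n1 n2) (haarB n3 n4).
rewrite (haar_prod nw nfgw) (haar_prod nfw ngw) (haar_prod ngw nfw) (haar_prod nfgw nw).
by field.
Qed.

(** Ginibre's inequality. In the rotated copies both differences are combinations
    of tensor squares, and so is the weight. *)
Lemma ginibre f g H : pcone f -> pcone g -> pcone H ->
  0 <= haar (fun th => f th * g th * expR (H th)) * haar (fun th => expR (H th)) -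
    haar (fun th => f th * expR (H th)) * haar (fun th => g th * expR (H th)).
Proof.
move=> pf pg pH; rewrite haar_cov; try exact: pcone_nice; last exact/nice_exp/pcone_nice.
rewrite mulr_ge0 ?half_ge0//; apply: haar_tensor_square_ge0.
apply: cone_tensor_squareM; first by apply: cone_tensor_squareM; exact: rotate_sub.
apply: cone_eq (cone_tensor_square_exp (rotate_add pH)) => th.
by rewrite expRD.
Qed.

Definition expect H f : R := haar (fun th => f th * expR (H th)) / haar (fun th => expR (H th)).

Lemma partition_gt0 H : nice H -> 0 < haar (fun th => expR (H th)).
Proof.
move=> nH; have [M hM] := nice_bounded nH.
apply: (@lt_le_trans _ _ (expR (- M))); first exact: expR_gt0.
rewrite -(@haar_const _ S (expR (- M))); apply: le_haar; [exact: nice_cst|exact: nice_exp|].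
by move=> th; rewrite ler_expR; have := hM th; rewrite ler_norml => /andP[].
Qed.

Lemma expect_ge0 H f : pcone H -> pcone f -> 0 <= expect H f.
Proof.
move=> pH pf; rewrite divr_ge0 ?(ltW (partition_gt0 (pcone_nice pH)))//.
by apply: haar_pcone_ge0; apply: pconeM => //; exact: pcone_exp.
Qed.

Lemma expect_le H f c : nice H -> nice f -> (forall th, f th <= c) -> expect H f <= c.
Proof.
move=> nH nf fc; rewrite ler_pdivrMr ?partition_gt0//.
rewrite -haarZ; last exact: nice_exp.
apply: le_haar; [exact: niceM nf (nice_exp nH)|exact: niceZ (nice_exp nH)|].
by move=> th; rewrite ler_wpM2r// expR_ge0.
Qed.

(** Multiplying the weight by [e^D] adds a covariance with [e^D], which is again
    of positive type: no derivative in the coupling is needed. *)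
Lemma expect_mono H D f : pcone H -> pcone D -> pcone f ->
  expect H f <= expect (fun th => H th + D th) f.
Proof.
move=> pH pD pf; have nH := pcone_nice pH.
have nHD : nice (fun th => H th + D th) by apply: niceD nH (pcone_nice pD).
rewrite ler_pdivrMr ?partition_gt0// mulrAC ler_pdivlMr ?partition_gt0//.
have := ginibre pf (pcone_exp pD) pH; rewrite subr_ge0.
congr (_ * _ <= _ * _); apply: eq_haar => th; rewrite expRD; ring.
Qed.

End Ginibre.

Section Derivative.
Context {R : realType} {S : finType}.
Local Open Scope classical_set_scope.
Local Open Scope ring_scope.

Lemma expR_remainder (x : R) : `|x| <= 2^-1 -> `|expR x - 1 - x| <= 2 * x ^+ 2.
Proof.
rewrite ler_norml => /andP[x1 x2].
have h1 := expR_ge1Dx x; have h2 := expR_ge1Dx (- x).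
have e0 := expR_gt0 x.
rewrite ger0_norm; last by lra.
have : expR x * (1 - x) <= 1.
  by rewrite -[leRHS](expRxMexpNx_1 x) ler_wpM2l// ltW.
move=> h3; have x0 : 0 < 1 - x by lra.
have : expR x <= (1 - x)^-1 by rewrite -[leRHS]mul1r ler_pdivlMr.
move=> h4; have : (1 - x)^-1 <= 1 + x + 2 * x ^+ 2.
  rewrite -[leLHS]mul1r ler_pdivrMr//.
  have -> : (1 + x + 2 * x ^+ 2) * (1 - x) = 1 + x ^+ 2 * (1 - 2 * x) by ring.
  by rewrite lerDl mulr_ge0 ?sqr_ge0//; lra.
lra.
Qed.

(** Differentiation under the average, from a uniform quadratic bound on the
    remainder of the exponential. *)
Lemma is_derive_haar (w B : (S -> R) -> R) (t : R) : nice w -> nice B ->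
  is_derive t 1 (fun t => haar (fun th => w th * expR (t * B th)))
    (haar (fun th => w th * B th * expR (t * B th))).
Proof.
move=> nw nB.
have nE s : nice (fun th => expR (s * B th)) by exact/nice_exp/niceZ.
have [M0 hM] := nice_bounded (niceM nw (nE t)).
have [K0 hK] := nice_bounded nB.
pose M := `|M0| + 1; pose K := `|K0| + 1.
have M_gt0 : 0 < M by rewrite ltr_wpDl.
have K_gt0 : 0 < K by rewrite ltr_wpDl.
have {}hM th : `|w th * expR (t * B th)| <= M.
  by rewrite (le_trans (hM th))// (le_trans (ler_norm _))// lerDl.
have {}hK th : `|B th| <= K.
  by rewrite (le_trans (hK th))// (le_trans (ler_norm _))// lerDl.
pose N s := haar (fun th => w th * expR (s * B th)).
pose N' := haar (fun th => w th * B th * expR (t * B th)).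
have main : (fun h : R => h^-1 *: (N (h *: 1 + t) - N t)) @ 0^' --> N'.
  apply/cvgrPdist_le => e e0.
  have C0 : 0 < M * (2 * K ^+ 2) by rewrite !mulr_gt0// exprn_gt0.
  pose d := Order.min (2^-1 / K) (e / (M * (2 * K ^+ 2))).
  have d0 : 0 < d by rewrite lt_min !divr_gt0//.
  near=> h.
  have h0 : h != 0 by near: h; exact: nbhs_dnbhs_neq.
  have hd : `|h| <= d.
    near: h; apply: nbhs_dnbhs; apply/nbhs_ballP; exists d => //= h.
    by rewrite /ball/= sub0r normrN => /ltW.
  have hK' : `|h| * K <= 2^-1.
    by rewrite -ler_pdivlMr// (le_trans hd)// ge_min lexx.
  have hC : M * (2 * K ^+ 2) * `|h| <= e.
    by rewrite mulrC -ler_pdivlMr// (le_trans hd)// ge_min lexx orbT.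
  rewrite distrC /N /N' /GRing.scale/= mulr1.
  have n1 := niceM nw (nE (h + t)); have n2 := niceM nw (nE t).
  rewrite -(haarB n1 n2) -haarZ; last exact: niceB.
  apply: haar_dist; [exact/niceZ/niceB|exact: niceM (niceM nw nB) (nE t)|move=> th].
  have -> : h^-1 * (w th * expR ((h + t) * B th) - w th * expR (t * B th)) -
      w th * B th * expR (t * B th) =
      (w th * expR (t * B th)) * (h^-1 * (expR (h * B th) - 1 - h * B th)).
    by rewrite mulrDl expRD; field.
  rewrite normrM [X in _ * X]normrM normfV.
  apply: le_trans hC; rewrite -mulrA; apply: ler_pM => //.
  rewrite mulrC ler_pdivrMr ?normr_gt0//.
  have hB : `|h * B th| <= `|h| * K by rewrite normrM ler_wpM2l.
  apply: le_trans (expR_remainder (le_trans hB hK')) _.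
  have -> : 2 * K ^+ 2 * `|h| * `|h| = 2 * (`|h| * K) ^+ 2 by ring.
  rewrite ler_wpM2l// -real_normK ?num_real//.
  by rewrite lerXn2r ?nnegrE ?mulr_ge0 ?(ltW K_gt0).
split; first exact: cvgP main.
exact: (cvg_lim (@Rhausdorff R) main).
Unshelve. all: by end_near.
Qed.

End Derivative.

(** * Convexity in the coupling *)

(** Along [H + t B], the derivative of the expectation [G] of [f] is a covariance
    divided by [Z^2]. In two copies the covariance is a nondecreasing function of
    [t], because [B + B'] is of positive type in the rotated variables, while
    [Z e^{-kt}] is nonincreasing as soon as [B <= k]. Hence [e^{2kt} G'(t)] is
    nondecreasing: [G] is a convex function of [1 - e^{-2kt}], which explains
    the form of the condition on [p] and [beta]. *)

Section Convexity.
Context {R : realType} {S : finType}.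
Variables (f H B : (S -> R) -> R) (k : R).
Hypotheses (pf : pcone f) (pH : pcone H) (pB : pcone B).
Hypothesis Bk : forall th, B th <= k.
Local Open Scope classical_set_scope.
Local Open Scope ring_scope.

Let nf : nice f. Proof. exact: pcone_nice. Qed.
Let nH : nice H. Proof. exact: pcone_nice. Qed.
Let nB : nice B. Proof. exact: pcone_nice. Qed.

Let w t th := expR (H th + t * B th).
Let nw t : nice (w t). Proof. by apply: nice_exp; apply: niceD nH _; exact: niceZ. Qed.
Let N t := haar (fun th => f th * w t th).
Let Z t := haar (w t).
Let N' t := haar (fun th => f th * B th * w t th).
Let Z' t := haar (fun th => B th * w t th).
Let G t := expect (fun th => H th + t * B th) f.

Let Z_gt0 t : 0 < Z t.
Proof. by apply: partition_gt0; apply: niceD nH _; exact: niceZ. Qed.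

Let dN (t : R) : is_derive t 1 N (N' t).
Proof.
have E : N = fun t => haar (fun th => (f th * expR (H th)) * expR (t * B th)).
  by apply: funext => s; apply: eq_haar => th; rewrite /w expRD mulrA.
rewrite E; have := is_derive_haar t (niceM nf (nice_exp nH)) nB.
congr is_derive; apply: eq_haar => th; rewrite /w expRD; ring.
Qed.

Let dZ (t : R) : is_derive t 1 Z (Z' t).
Proof.
have E : Z = fun t => haar (fun th => expR (H th) * expR (t * B th)).
  by apply: funext => s; apply: eq_haar => th; rewrite /w expRD.
rewrite E; have := is_derive_haar t (nice_exp nH) nB.
congr is_derive; apply: eq_haar => th; rewrite /w expRD; ring.
Qed.

Let C t := N' t * Z t - N t * Z' t.

Let dG (t : R) : is_derive t 1 G (C t / Z t ^+ 2).
Proof.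
have -> : G = N * (fun t => (Z t)^-1) by [].
have Z0 : Z t != 0 by rewrite gt_eqF.
apply: (is_derive_eq (is_deriveM (dN t) (is_deriveV Z0 (dZ t)))).
rewrite /C /GRing.scale/=; field; exact: Z0.
Qed.

Lemma expect_continuous : continuous G.
Proof.
move=> t; apply: differentiable_continuous; apply/derivable1_diffP.
by case: (dG t).
Qed.

Let C_cone t : C t = 2^-1 * haar (fun th : S + S -> R =>
    (f (rpart (rotate th)) - f (lpart (rotate th))) *
    (B (rpart (rotate th)) - B (lpart (rotate th))) *
    (w t (lpart (rotate th)) * w t (rpart (rotate th)))).
Proof. by rewrite -haar_cov. Qed.

Let W t (th : S + S -> R) := w t (lpart (rotate th)) * w t (rpart (rotate th)).

Let W_cone t : 0 <= t -> cone tensor_square (W t).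
Proof.
move=> t0; have pHB : pcone (fun th => H th + t * B th) by apply: coneD pH _; exact: coneZ.
apply: cone_eq (cone_tensor_square_exp (rotate_add pHB)) => th.
by rewrite /W /w [in RHS]expRD -!expRD; congr expR; ring.
Qed.

Let C_ge0 t : 0 <= t -> 0 <= C t.
Proof.
move=> t0; rewrite C_cone mulr_ge0 ?half_ge0//; apply: haar_tensor_square_ge0.
apply: cone_tensor_squareM; last exact: W_cone.
by apply: cone_tensor_squareM; exact: rotate_sub.
Qed.

Let C_homo s t : 0 <= s -> s <= t -> C s <= C t.
Proof.
move=> s0 st; have t0 := le_trans s0 st.
pose X (th : S + S -> R) := (f (rpart (rotate th)) - f (lpart (rotate th))) *
    (B (rpart (rotate th)) - B (lpart (rotate th))).
have cX : cone tensor_square X by apply: cone_tensor_squareM; exact: rotate_sub.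
have nX := cone_tensor_square_nice cX.
have nW u : 0 <= u -> nice (W u) by move=> /W_cone /cone_tensor_square_nice.
rewrite !C_cone ler_wpM2l ?half_ge0// -subr_ge0.
rewrite -haarB; [|exact: niceM nX (nW _ t0)|exact: niceM nX (nW _ s0)].
apply: haar_tensor_square_ge0.
have pD : pcone (fun th => (t - s) * B th) by apply: coneZ pB; rewrite subr_ge0.
have cD := cone_expB1 tensor_square_bounded cone_tensor_squareM (rotate_add pD).
apply: cone_eq (cone_tensor_squareM cX (cone_tensor_squareM (W_cone s0) cD)) => th.
rewrite /X -mulrBr; congr (_ * _); rewrite mulrBr mulr1 /W /w -!expRD.
by congr (expR _ - _); ring.
Qed.

Let E_homo s t : s <= t -> expR (k * s) / Z s <= expR (k * t) / Z t.
Proof.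
move=> st; rewrite ler_pdivrMr// mulrAC ler_pdivlMr// mulrC [leRHS]mulrC.
rewrite /Z mulrC [leRHS]mulrC -!haarZ//.
apply: le_haar; [exact: niceZ|exact: niceZ|move=> th].
rewrite /w -!expRD ler_expR.
have := ler_wpM2l (_ : 0 <= t - s) (Bk th); rewrite subr_ge0 => /(_ st).
by rewrite !mulrBl; lra.
Qed.

Let g t := expR (2 * k * t) * (C t / Z t ^+ 2).

Let g_homo s t : 0 <= s -> s <= t -> g s <= g t.
Proof.
move=> s0 st.
have gE u : g u = C u * (expR (k * u) / Z u) ^+ 2.
  by rewrite /g expr_div_n [expR _ ^+ 2]expr2 -expRD mulrCA; congr (_ * (expR _ * _)); ring.
rewrite !gE; apply: ler_pM; rewrite ?sqr_ge0 ?C_ge0 ?C_homo//.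
have E0 u : 0 <= expR (k * u) / Z u by rewrite divr_ge0 ?expR_ge0 ?(ltW (Z_gt0 u)).
by rewrite lerXn2r ?nnegrE ?E0 ?E_homo.
Qed.

(** The coupling [b'] is the one at which [1 - e^{-2kt}] takes its mean value
    over the two random couplings [0] and [b]. Subtracting from [G] the tangent at
    [b'], in the variable [1 - e^{-2kt}], leaves a function which is minimal at [b']. *)
Lemma expect_chord p b b' : 0 < k -> 0 <= p -> p <= 1 -> 0 <= b' -> b' <= b ->
  1 - expR (- (2 * k * b')) = p * (1 - expR (- (2 * k * b))) ->
  expect (fun th => H th + b' * B th) f <=
  (1 - p) * expect H f + p * expect (fun th => H th + b * B th) f.
Proof.
move=> k0 p0 p1 b'0 b'b ub.
pose u t := 1 - expR (- (2 * k * t)).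
pose c := g b' / (2 * k).
pose Phi := G - (fun t => c * u t).
have du (t : R) : is_derive t 1 (fun t => c * u t) (g b' * expR (- (2 * k * t))).
  apply: is_derive_eq; rewrite /GRing.scale/= /c.
  by field; rewrite gt_eqF.
have dPhi (t : R) : is_derive t 1 Phi (expR (- (2 * k * t)) * (g t - g b')).
  have := dG t; have := du t => du' dG'.
  have gt : expR (- (2 * k * t)) * g t = C t / Z t ^+ 2.
    by rewrite /g mulrA -expRD addNr expR0 mul1r.
  apply: (is_derive_eq (is_deriveB dG' du')).
  by rewrite mulrBr gt [X in _ - X]mulrC.
have cPhi : continuous Phi.
  move=> t; apply: differentiable_continuous; apply/derivable1_diffP.
  by case: (dPhi t).
have min0 : Phi b' <= Phi 0.
  have [d] := MVT_segment b'0 (fun x _ => dPhi x) (continuous_subspaceT cPhi).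
  rewrite in_itv/= => /andP[d0 db'] E; rewrite -subr_le0 E subr0.
  rewrite mulr_le0_ge0// mulr_ge0_le0 ?expR_ge0// subr_le0; exact: g_homo.
have min1 : Phi b' <= Phi b.
  have [d] := MVT_segment b'b (fun x _ => dPhi x) (continuous_subspaceT cPhi).
  rewrite in_itv/= => /andP[d0 db'] E; rewrite -subr_ge0 E.
  rewrite mulr_ge0 ?subr_ge0// mulr_ge0 ?expR_ge0// subr_ge0; exact: g_homo.
have G0 : G 0 = expect H f.
  by congr expect; apply: funext => th; rewrite mul0r addr0.
rewrite -G0 -/(G b) -/(G b').
have PE t : Phi t = G t - c * u t by [].
have u0 : u 0 = 0 by rewrite /u mulr0 oppr0 expR0 subrr.
have : (1 - p) * Phi b' + p * Phi b' <= (1 - p) * Phi 0 + p * Phi b.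
  by rewrite lerD// ler_wpM2l// subr_ge0.
rewrite !PE u0 /u ub; lra.
Qed.

End Convexity.

(** * Integration by parts on the torus *)

Section Ward.
Context {R : realType} {S : finType}.
Implicit Types (th : S -> R) (P : seq (S * S)).

(** Derivatives with respect to the angle at [v] are encoded as formal
    derivatives of trigonometric polynomials: Leibniz's rule and the vanishing of
    their averages are then algebraic facts on characters. *)
Inductive partial (v : S) : ((S -> R) -> R) -> ((S -> R) -> R) -> Prop :=
| partial_cos m a :
    partial v (fun th => cos (dot m th + a)) (fun th => - (m v)%:~R * sin (dot m th + a))
| partialD f f' g g' : partial v f f' -> partial v g g' ->
    partial v (fun th => f th + g th) (fun th => f' th + g' th)
| partialZ c f f' : partial v f f' ->
    partial v (fun th => c * f th) (fun th => c * f' th).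

Lemma partial_eq v f f' g g' : f =1 g -> f' =1 g' -> partial v f f' -> partial v g g'.
Proof. by move=> /funext -> /funext ->. Qed.

Lemma partial_nice v f f' : partial v f f' -> nice f /\ nice f'.
Proof.
elim=> [m a|f1 f1' g g' _ [nf nf'] _ [ng ng']|c f1 f1' _ [nf nf']]; split.
- exact: nice_cos.
- by apply: niceZ; exact: nice_sin.
- exact: niceD.
- exact: niceD.
- exact: niceZ.
- exact: niceZ.
Qed.

Lemma haar_partial v f f' : partial v f f' -> haar f' = 0.
Proof.
elim=> [m a|f1 f1' g g' df IH1 dg IH2|c f1 f1' df IH].
- rewrite haarZ; last exact: nice_sin.
  have -> : haar (fun th => sin (dot m th + a)) =
      haar (fun th => cos (dot m th + (a - pi / 2))).
    by apply: eq_haar => th; rewrite addrA cosBpihalf.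
  rewrite haar_trig; case: eqP => [->|_]; last by rewrite mulr0.
  by rewrite ffunE oppr0 mul0r.
- by rewrite haarD ?IH1 ?IH2 ?addr0//; [case: (partial_nice df)|case: (partial_nice dg)].
- by rewrite haarZ ?IH ?mulr0//; case: (partial_nice df).
Qed.

Lemma partial_sin v m a :
  partial v (fun th => sin (dot m th + a)) (fun th => (m v)%:~R * cos (dot m th + a)).
Proof.
apply: partial_eq (partial_cos v m (a - pi / 2)) => th.
  by rewrite addrA cosBpihalf.
by rewrite addrA sinBpihalf mulrNN.
Qed.

Lemma partialM v f f' g g' : partial v f f' -> partial v g g' ->
  partial v (fun th => f th * g th) (fun th => f' th * g th + f th * g' th).
Proof.
move=> df; elim=> [n b|g1 g1' g2 g2' _ IH1 _ IH2|c g1 g1' _ IH]; last 2 first.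
- by apply: partial_eq (partialD IH1 IH2) => th; ring.
- by apply: partial_eq (partialZ c IH) => th; ring.
elim: df => [m a|g1 g1' g2 g2' _ IH1 _ IH2|c g1 g1' _ IH]; last 2 first.
- by apply: partial_eq (partialD IH1 IH2) => th; ring.
- by apply: partial_eq (partialZ c IH) => th; ring.
apply: partial_eq (partialD (partialZ 2^-1 (partial_cos v (m + n) (a + b)))
  (partialZ 2^-1 (partial_cos v (m - n) (a - b)))) => th.
  by rewrite cosM dotD dotB; congr (_ * cos _ + _ * cos _); ring.
rewrite !dotD dotN.
have -> : dot m th + dot n th + (a + b) = (dot m th + a) + (dot n th + b) by ring.
have -> : dot m th - dot n th + (a - b) = (dot m th + a) - (dot n th + b) by ring.
by rewrite !ffunE sinB sinD !intrD mulrNz; field.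
Qed.

Definition edge_product P th : R := \prod_(e <- P) cos (th e.1 - th e.2).

(** The terms of the derivative at [a]: each factor incident to [a] is removed
    in turn, and its other end is recorded. Loops are constant, hence skipped. *)
Fixpoint steps (a : S) P : seq (S * seq (S * S)) :=
  if P is e :: P' then
    (if (e.1 == a) && (e.2 != a) then [:: (e.2, P')] else
     if (e.2 == a) && (e.1 != a) then [:: (e.1, P')] else [::]) ++
    [seq (s.1, e :: s.2) | s <- steps a P']
  else [::].

Definition edge_charge (e : S * S) : {ffun S -> int} :=
  unit_charge e.1 - unit_charge e.2.

Lemma dot_edge e th : dot (edge_charge e) th = th e.1 - th e.2.
Proof. by rewrite dotB !dot_unit. Qed.

Lemma edge_product_cons e P th :
  edge_product (e :: P) th = cos (th e.1 - th e.2) * edge_product P th.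
Proof. by rewrite /edge_product big_cons. Qed.

Lemma edge_product_pcone P : pcone (edge_product P).
Proof.
elim: P => [|e P IH].
  by apply: cone_eq pcone1 => th; rewrite /edge_product big_nil.
apply: cone_eq (pconeM (cone_gen (Cosine (edge_charge e))) IH) => th.
by rewrite edge_product_cons dot_edge.
Qed.

Lemma steps_product a P s th : s \in steps a P ->
  edge_product P th = cos (th a - th s.1) * edge_product s.2 th.
Proof.
elim: P s => // e P IH s /=; rewrite mem_cat => /orP[|/mapP[s' /IH E ->]] /=.
  rewrite edge_product_cons.
  case: ifP => [/andP[/eqP <- _]|_]; first by rewrite inE => /eqP ->.
  case: ifP => [/andP[/eqP <- _]|//]; rewrite inE => /eqP -> /=.
  by rewrite -cosN opprB.
by rewrite !edge_product_cons E mulrCA.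
Qed.

Lemma steps_size a P s : s \in steps a P -> (size s.2 < size P)%N.
Proof.
elim: P s => // e P IH s /=; rewrite mem_cat => /orP[|/mapP[s' /IH E ->]] //.
case: ifP => [_|_]; first by rewrite inE => /eqP ->.
by case: ifP => // _; rewrite inE => /eqP ->.
Qed.

Lemma steps_mem a P s : s \in steps a P -> {subset s.2 <= P}.
Proof.
elim: P s => // e P IH s /=; rewrite mem_cat => /orP[|/mapP[s' /IH E ->]] /=.
  have sub : {subset P <= e :: P} by move=> x xP; rewrite inE xP orbT.
  case: ifP => [_|_]; first by rewrite inE => /eqP ->.
  by case: ifP => // _; rewrite inE => /eqP ->.
by move=> x; rewrite !inE => /orP[->//|/E ->]; rewrite orbT.
Qed.

Lemma steps_edge a P s : s \in steps a P -> ((a, s.1) \in P) || ((s.1, a) \in P).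
Proof.
elim: P s => // e P IH s /=; rewrite mem_cat => /orP[|/mapP[s' /IH E ->]] /=.
  case: e => e1 e2 /=; case: ifP => [/andP[/eqP <- _]|_].
    by rewrite inE => /eqP -> /=; rewrite inE eqxx.
  by case: ifP => // /andP[/eqP <- _]; rewrite inE => /eqP -> /=; rewrite !inE eqxx orbT.
by rewrite !inE; case/orP: E => ->; rewrite !orbT.
Qed.

Lemma partial_edge_product a P : partial a (edge_product P)
  (fun th => - \sum_(s <- steps a P) sin (th a - th s.1) * edge_product s.2 th).
Proof.
elim: P => [|e P IH].
  apply: partial_eq (partial_cos a 0 0) => th /=.
    by rewrite dot0 addr0 cos0 /edge_product big_nil.
  by rewrite dot0 addr0 sin0 big_nil mulr0; exact/esym/oppr0.
apply: partial_eq (partialM (partial_cos a (edge_charge e) 0) IH) => th.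
  by rewrite dot_edge addr0 edge_product_cons.
rewrite /= big_cat big_map opprD; congr (_ + _); last first.
  rewrite mulrN mulr_sumr; congr (- _); apply: eq_bigr => s _ /=.
  by rewrite dot_edge addr0 edge_product_cons mulrCA.
rewrite dot_edge addr0 !ffunE (eq_sym a e.1) (eq_sym a e.2).
case: (eqVneq e.1 a) => [e1|e1]; case: (eqVneq e.2 a) => [e2|e2] /=.
- by rewrite big_nil subrr mulr0z !oppr0 !mul0r.
- by rewrite big_seq1 subr0 e1 /=; ring.
- by rewrite big_seq1 /= e2 sub0r mulrN1z opprK mul1r -mulNr -sinN opprB.
- by rewrite big_nil subrr mulr0z !oppr0 !mul0r.
Qed.

(** The derivative at [a] of [sin (th a - x) * edge_product P] has average 0,
    where [x] does not involve the angle at [a]. Writing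
    [sin (th a - x) * sin (th a - th w)] as
    [cos (th w - x) - cos (th a - x) * cos (th a - th w)] turns this into a
    recursion that moves the marked vertex from [a] to a neighbour [w]. *)
Lemma ward a P (n : {ffun S -> int}) : n a = 0 ->
  (1 + (size (steps a P))%:R) *
    haar (fun th => edge_product P th * cos (th a - dot n th)) =
  \sum_(s <- steps a P) haar (fun th => edge_product s.2 th * cos (th s.1 - dot n th)).
Proof.
move=> na.
have cE v th : dot (unit_charge v - n) th + 0 = th v - dot n th.
  by rewrite addr0 dotB dot_unit.
have nP Q := pcone_nice (edge_product_pcone Q).
have nC v : nice (fun th : S -> R => cos (th v - dot n th)).
  by apply: cone_eq (nice_cos (unit_charge v - n) 0) => th; rewrite cE.
have := haar_partial (partialM (partial_edge_product a P) (partial_sin a (unit_charge a - n) 0)).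
have -> : (unit_charge a - n) a = 1 by rewrite !ffunE na eqxx subr0.
pose F th := (1 + (size (steps a P))%:R) * (edge_product P th * cos (th a - dot n th)) -
  \sum_(s <- steps a P) edge_product s.2 th * cos (th s.1 - dot n th).
rewrite (_ : haar _ = haar F); last first.
  apply: eq_haar => th; rewrite /F cE mul1r mulNr mulr_suml addrC mulrDl mul1r -addrA.
  congr (_ + _); rewrite -sum1_size natr_sum mulr_suml -sumrB -sumrN.
  rewrite !big_seq; apply: eq_bigr => s sP; rewrite mul1r (steps_product th sP).
  have -> : th s.1 - dot n th = (th a - dot n th) - (th a - th s.1) by ring.
  by rewrite [cos (_ - _ - _)]cosB; ring.
rewrite haarB; last 2 first.
- by apply: niceZ; apply: niceM.
- by apply: nice_sum => s; apply: niceM.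
rewrite haarZ; last exact: niceM.
rewrite haar_sum; last by move=> s; exact: niceM.
by move/eqP; rewrite subr_eq0 => /eqP.
Qed.

End Ward.

Section Rivasseau.
Context {R : realType} {S : finType}.
Variables (A : {pred S}) (B : seq S).
Hypothesis BA : {in B, forall b, b \notin A}.
Implicit Types (P : seq (S * S)) (n : {ffun S -> int}).

Definition inner_edge (e : S * S) :=
  ((e.1 \in A) ==> (e.2 \in A) || (e.2 \in B)) &&
  ((e.2 \in A) ==> (e.1 \in A) || (e.1 \in B)).

Definition twice_unit b n : {ffun S -> int} := unit_charge b + unit_charge b - n.

Lemma dot_twice b n (th : S -> R) : dot (twice_unit b n) th = th b + th b - dot n th.
Proof. by rewrite dotB dotD !dot_unit. Qed.

Lemma pcone_charge (v : S) n : pcone (fun th : S -> R => cos (th v - dot n th)).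
Proof.
by apply: cone_eq (cone_gen (Cosine (unit_charge v - n))) => th; rewrite dotB dot_unit.
Qed.

(** The recursion of [ward] is applied simultaneously to both sides: the marked
    vertex walks inside [A] along the factors of [P], which are used up, until it
    hits [B]. There the left side equals the term [b = a] of the right side, up to
    an overall sign of the angles, and the other terms are nonnegative. *)
Lemma walk_ineq P a n : all inner_edge P -> (a \in A) || (a \in B) ->
  {in A, forall v, n v = 0} ->
  haar (fun th : S -> R => edge_product P th * cos (th a - dot n th)) <=
  \sum_(b <- B) haar (fun th => edge_product P th * cos (th a - dot (twice_unit b n) th)) :> R.
Proof.
move=> okP aAB nA; have [k] := ubnP (size P); elim: k => // k IH in P a okP aAB *.
rewrite ltnS => Pk.
have nP Q : pcone (@edge_product R S Q) by exact: edge_product_pcone.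
have h0 v m : 0 <= haar (fun th : S -> R => edge_product P th * cos (th v - dot m th)).
  by apply: haar_pcone_ge0; apply: pconeM => //; exact: pcone_charge.
have [aB|aB] := boolP (a \in B).
  rewrite (big_rem a)//= -[leLHS]addr0 lerD//; last by apply: sumr_ge0.
  rewrite le_eqVlt; apply/orP; left; apply/eqP/eq_haar => th; congr (_ * _).
  by rewrite dot_twice -cosN; congr cos; ring.
have aA : a \in A by move: aAB; rewrite (negbTE aB) orbF.
have d0 : 0 < 1 + (size (steps a P))%:R :> R by rewrite ltr_wpDr.
rewrite -(ler_pM2l d0) mulr_sumr (ward _ (nA _ aA)).
rewrite [leRHS](_ : _ = \sum_(b <- B) \sum_(s <- steps a P)
  haar (fun th : S -> R => edge_product s.2 th * cos (th s.1 - dot (twice_unit b n) th))); last first.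
  rewrite !big_seq; apply: eq_bigr => b bB; apply: ward.
  have /negP ba : a != b by apply: contraNneq (BA bB) => <-.
  by rewrite !ffunE nA//; case: eqP => // /eqP /ba.
rewrite exchange_big/= !big_seq; apply: ler_sum => s sP; apply: IH.
- by apply/allP => e /(steps_mem sP); apply/allP.
- have /orP[] := steps_edge sP => /(allP okP); rewrite /inner_edge/= aA /=.
    by case/andP.
  by case/andP.
- exact: leq_trans (steps_size sP) Pk.
Qed.

Lemma haar_odd (w : (S -> R) -> R) m : nice w -> (forall th, w (fun v => - th v) = w th) ->
  haar (fun th => w th * sin (dot m th)) = 0.
Proof.
move=> nw ew; have ns : nice (fun th => w th * sin (dot m th)).
  by apply: niceM nw _; apply: cone_eq (nice_sin m 0) => th; rewrite addr0.
have := haar_opp ns.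
have -> : haar (fun th => w (fun v => - th v) * sin (dot m (fun v => - th v))) =
    - haar (fun th => w th * sin (dot m th)).
  rewrite -haarN//; apply: eq_haar => th; rewrite ew -mulrN -sinN; congr (_ * sin _).
  by rewrite /dot -sumrN; apply: eq_bigr => v _; rewrite mulrN.
lra.
Qed.

(** Only products of cosines survive, sines being odd. *)
Lemma haar_pair_cos (w w' : (S -> R) -> R) m m' : nice w -> nice w' ->
  (forall th, w (fun v => - th v) = w th) ->
  haar (fun th : S + S -> R => w (lpart th) * w' (rpart th) *
      cos (dot m (lpart th) + dot m' (rpart th))) =
  haar (fun th => w th * cos (dot m th)) * haar (fun th => w' th * cos (dot m' th)).
Proof.
move=> nw nw' ew.
have nc k : nice (fun th : S -> R => cos (dot k th)).
  by apply: cone_eq (nice_cos k 0) => th; rewrite addr0.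
have ns k : nice (fun th : S -> R => sin (dot k th)).
  by apply: cone_eq (nice_sin k 0) => th; rewrite addr0.
have nlr (f1 f2 : (S -> R) -> R) : nice f1 -> nice f2 ->
    @nice R (S + S)%type (fun th => f1 (lpart th) * f2 (rpart th)).
  by move=> n1 n2; apply: niceM; [exact: nice_lpart|exact: nice_rpart].
transitivity (haar (fun th : S + S -> R =>
  (w (lpart th) * cos (dot m (lpart th))) * (w' (rpart th) * cos (dot m' (rpart th))) -
  (w (lpart th) * sin (dot m (lpart th))) * (w' (rpart th) * sin (dot m' (rpart th))))).
  by apply: eq_haar => th; rewrite cosD; ring.
rewrite haarB; last 2 first.
- exact: nlr (niceM nw (nc m)) (niceM nw' (nc m')).
- exact: nlr (niceM nw (ns m)) (niceM nw' (ns m')).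
rewrite (haar_prod (niceM nw (nc m)) (niceM nw' (nc m'))).
rewrite (haar_prod (niceM nw (ns m)) (niceM nw' (ns m'))).
by rewrite (haar_odd m nw ew) mul0r subr0.
Qed.

Variables (E : seq (S * S)) (J : S * S -> R).
Hypotheses (J0 : forall e, 0 <= J e) (Eok : all inner_edge E).

Definition edge_energy (th : S -> R) : R := \sum_(e <- E) J e * cos (th e.1 - th e.2).

Lemma edge_energy_pcone : pcone edge_energy.
Proof.
apply: cone_sum => e; apply: coneZ => //.
by apply: cone_eq (cone_gen (Cosine (edge_charge e))) => th; rewrite dot_edge.
Qed.

(** The two copies of the interaction become [2 J cos(phi_e) cos(psi_e)] in the
    rotated variables, so that their weight is a combination of functions with
    the same polynomial [edge_product P] in both copies. *)
Inductive inner_pair : ((S + S -> R) -> R) -> Prop :=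
| InnerPair P : all inner_edge P ->
    inner_pair (fun th => edge_product P (lpart th) * edge_product P (rpart th)).

Lemma inner_pair_nice f : inner_pair f -> nice f.
Proof.
by case=> P _; apply: niceM; [apply: nice_lpart|apply: nice_rpart];
  exact/pcone_nice/edge_product_pcone.
Qed.

Lemma inner_pairM f g : cone inner_pair f -> cone inner_pair g ->
  cone inner_pair (fun th => f th * g th).
Proof.
apply: coneM => [h /inner_pair_nice /nice_bounded//|_ _ [P hP] [Q hQ]].
have hPQ : all inner_edge (P ++ Q) by rewrite all_cat hP.
by apply: cone_eq (cone_gen (InnerPair hPQ)) => th; rewrite /edge_product !big_cat mulrACA.
Qed.

Lemma inner_pair1 : cone inner_pair (fun=> 1).
Proof.
have h : all inner_edge [::] by [].
by apply: cone_eq (cone_gen (InnerPair h)) => th; rewrite /edge_product !big_nil mulr1.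
Qed.

Lemma inner_pair_weight : cone inner_pair (fun th : S + S -> R =>
  expR (edge_energy (lpart (rotate th))) * expR (edge_energy (rpart (rotate th)))).
Proof.
apply: (@cone_eq _ _ _ (fun th : S + S -> R => expR (\sum_(e <- E) (2 * J e) *
   (edge_product [:: e] (lpart th) * edge_product [:: e] (rpart th))))).
  move=> th; rewrite -expRD /edge_energy -big_split/=; congr expR.
  apply: eq_bigr => e _; rewrite /edge_product !big_seq1.
  have := dot_rotl (edge_charge e) th; have := dot_rotr (edge_charge e) th.
  rewrite !dot_edge => -> ->.
  move: (lpart th e.1 - _) (rpart th e.1 - _) => x y; rewrite cosB cosD; ring.
apply: cone_exp inner_pairM inner_pair1 _.
  by move=> g /inner_pair_nice /nice_bounded.
elim: E Eok => [_|e E' IH /= /andP[he hE']].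
  by apply: cone_eq cone0 => th; rewrite big_nil.
have {}he : all inner_edge [:: e] by rewrite /= he.
have J2 : 0 <= 2 * J e by rewrite mulr_ge0.
by apply: cone_eq (coneD (coneZ J2 (cone_gen (InnerPair he))) (IH hE')) => th; rewrite big_cons.
Qed.

Let w (th : S -> R) := expR (edge_energy th).

Let nw : nice w. Proof. exact/nice_exp/pcone_nice/edge_energy_pcone. Qed.

Lemma even_edge_product P (th : S -> R) :
  edge_product P (fun v => - th v) = edge_product P th :> R.
Proof.
by rewrite /edge_product; apply: eq_bigr => e _; rewrite -opprD cosN.
Qed.

Lemma even_weight th : w (fun v => - th v) = w th.
Proof.
by congr expR; apply: eq_bigr => e _; rewrite -opprD cosN.
Qed.

(** Rivasseau's inequality for a character outside the inner region. Both sides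
    are averages over two copies; after the rotation, they have the same
    dependence on [phi], which contributes a common nonnegative factor, and the
    [psi] part is [walk_ineq]. *)
Lemma rivasseau_character a n : (a \in A) || (a \in B) -> {in A, forall v, n v = 0} ->
  haar (fun th => w th * cos (th a - dot n th)) * haar w <=
  \sum_(b <- B) haar (fun th => w th * cos (th a - th b)) *
                haar (fun th => w th * cos (th b - dot n th)).
Proof.
move=> aAB nA.
have nW := cone_sub inner_pair_nice inner_pair_weight.
pose Phi := unit_charge a - n.
pose obs m m' (th : S + S -> R) := cos (dot m (lpart th) + dot m' (rpart th)).
have nobs m m' : nice (obs m m').
  apply: cone_eq (nice_cos [ffun v => match v with inl v => m v | inr v => m' v end] 0) => th.
  by rewrite addr0 -dot_pair.
pose W (th : S + S -> R) := w (lpart th) * w (rpart th).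
have nWW : nice W by apply: niceM; [exact: nice_lpart|exact: nice_rpart].
have rot m m' k k' : (forall th : S + S -> R, dot m (lpart (rotate th)) + dot m' (rpart (rotate th)) =
    dot k (lpart th) + dot k' (rpart th)) ->
    haar (fun th => w th * cos (dot m th)) * haar (fun th => w th * cos (dot m' th)) =
    haar (fun th => (w (lpart (rotate th)) * w (rpart (rotate th))) * obs k k' th).
  move=> E1; rewrite -(haar_pair_cos m m' nw nw even_weight).
  rewrite -(haar_subst (@affine_rotate _ _) (niceM nWW (nobs m m'))).
  by apply: eq_haar => th; rewrite /W /obs E1.
have -> : haar (fun th => w th * cos (th a - dot n th)) * haar w =
    haar (fun th => (w (lpart (rotate th)) * w (rpart (rotate th))) * obs Phi Phi th).
  rewrite -(rot Phi 0) => [|th]; last by rewrite dot0 addr0 dot_rotl.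
  congr (_ * _); apply: eq_haar => th; last by rewrite dot0 cos0 mulr1.
  by rewrite dotB dot_unit.
have E1 b : haar (fun th => w th * cos (th a - th b)) *
    haar (fun th => w th * cos (th b - dot n th)) =
    haar (fun th => (w (lpart (rotate th)) * w (rpart (rotate th))) *
      obs Phi (twice_unit b n - unit_charge a) th).
  rewrite mulrC -(rot (unit_charge b - n) (unit_charge a - unit_charge b)) => [|th].
    by congr (_ * _); apply: eq_haar => th; rewrite !dotB !dot_unit.
  by rewrite dot_rotl dot_rotr /Phi /twice_unit !dotB !dotD !dot_unit; ring.
under eq_bigr do rewrite E1.
rewrite -subr_ge0 -haar_sum; last by move=> b; exact: niceM nW (nobs _ _).
rewrite -haarB; last 2 first.
- by apply: nice_sum => b; exact: niceM nW (nobs _ _).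
- exact: niceM nW (nobs _ _).
rewrite (_ : haar _ = haar (fun th => (w (lpart (rotate th)) * w (rpart (rotate th))) *
   (\sum_(b <- B) obs Phi (twice_unit b n - unit_charge a) th - obs Phi Phi th))); last first.
  by apply: eq_haar => th; rewrite mulrBr mulr_sumr.
apply: haar_cone_ge0 inner_pair_weight.
- exact: inner_pair_nice.
- by apply: niceB => //; exact: nice_sum.
move=> _ [P okP].
have nP := pcone_nice (@edge_product_pcone R S P).
have nPP : nice (fun th : S + S -> R => edge_product P (lpart th) * edge_product P (rpart th)).
  by apply: niceM; [exact: nice_lpart|exact: nice_rpart].
rewrite (_ : haar _ = haar (fun th : S + S -> R =>
   \sum_(b <- B) edge_product P (lpart th) * edge_product P (rpart th) *
         obs Phi (twice_unit b n - unit_charge a) th -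
   edge_product P (lpart th) * edge_product P (rpart th) * obs Phi Phi th)); last first.
  by apply: eq_haar => th; rewrite mulrBr mulr_sumr.
rewrite haarB; last 2 first.
- by apply: nice_sum => b; exact: niceM.
- exact: niceM.
rewrite haar_sum; last by move=> b; exact: niceM.
under eq_bigr do rewrite (haar_pair_cos _ _ nP nP (even_edge_product P)).
rewrite (haar_pair_cos _ _ nP nP (even_edge_product P)) -mulr_sumr -mulrBr.
have pc m : 0 <= haar (fun th : S -> R => edge_product P th * cos (dot m th)).
  by apply: haar_pcone_ge0; apply: pconeM (edge_product_pcone P) _; exact/cone_gen/Cosine.
rewrite mulr_ge0// subr_ge0.
have := walk_ineq okP aAB nA.
congr (_ <= _); first by apply: eq_haar => th; rewrite dotB dot_unit.
apply: eq_bigr => b _; apply: eq_haar => th.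
by rewrite dotB dot_unit -cosN opprB.
Qed.

Inductive outer_cosine : ((S -> R) -> R) -> Prop :=
| OuterCosine (m : {ffun S -> int}) : {in A, forall v, m v = 0} -> outer_cosine (fun th => cos (dot m th)).

Lemma outer_cosine_cosine f : outer_cosine f -> cosine f.
Proof. by case. Qed.

Lemma outer_cosine_exp U : cone outer_cosine U ->
  cone outer_cosine (fun th => expR (U th)).
Proof.
apply: cone_exp.
- by move=> g /outer_cosine_cosine /cosine_trig /trig_bounded.
- move=> f g; apply: coneM; first by move=> h /outer_cosine_cosine /cosine_trig /trig_bounded.
  move=> _ _ [m hm] [n hn].
  have hD : {in A, forall v, (m + n) v = 0} by move=> v vA; rewrite ffunE hm// hn.
  have hB : {in A, forall v, (m - n) v = 0} by move=> v vA; rewrite !ffunE hm// hn.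
  apply: cone_eq (coneD (coneZ (half_ge0 (R := R)) (cone_gen (OuterCosine hD)))
    (coneZ (half_ge0 (R := R)) (cone_gen (OuterCosine hB)))) => th.
  by rewrite cosM dotD dotB.
- have h0 : {in A, forall v, (0 : {ffun S -> int}) v = 0} by move=> v _; rewrite ffunE.
  by apply: cone_eq (cone_gen (OuterCosine h0)) => th; rewrite dot0 cos0.
Qed.

(** Rivasseau's inequality. The weight of the outer region is expanded into
    characters that do not involve the inner vertices; they shift the character
    of the endpoint [x] by [m] and [- m]. *)
Lemma rivasseau U a x : cone outer_cosine U ->
  (a \in A) || (a \in B) -> x \notin A ->
  expect (fun th => edge_energy th + U th) (fun th => cos (th a - th x)) <=
  \sum_(b <- B) expect edge_energy (fun th => cos (th a - th b)) *
    expect (fun th => edge_energy th + U th) (fun th => cos (th b - th x)).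
Proof.
move=> cU aAB xA.
have nU : nice U by apply: cone_sub cU => g /outer_cosine_cosine /cosine_trig /cone_gen.
have nH := pcone_nice edge_energy_pcone.
pose V th := expR (U th).
have nV : nice V by exact: nice_exp.
have cV : cone outer_cosine V by exact: outer_cosine_exp.
pose c b := haar (fun th => w th * cos (th a - th b)).
pose D (n : {ffun S -> int}) th := w th * (\sum_(b <- B) c b * cos (th b - dot n th) - haar w * cos (th a - dot n th)).
have nc v n : nice (fun th : S -> R => cos (th v - dot n th)) by exact/pcone_nice/pcone_charge.
have nD n : nice (D n).
  apply: niceM nw _; apply: niceB; last exact: niceZ.
  by apply: nice_sum => b; exact: niceZ.
have D_ge0 n : {in A, forall v, n v = 0} -> 0 <= haar (D n).
  move=> nA; have := rivasseau_character aAB nA; rewrite -subr_ge0.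
  congr (_ <= _); rewrite /D.
  rewrite (_ : haar (fun th => w th * (_ - _)) = haar (fun th =>
     \sum_(b <- B) c b * (w th * cos (th b - dot n th)) - haar w * (w th * cos (th a - dot n th)))); last first.
    apply: eq_haar => th; rewrite mulrBr mulr_sumr mulrCA; congr (_ - _).
    by apply: eq_bigr => b _; rewrite mulrCA.
  rewrite haarB; last 2 first.
  - by apply: nice_sum => b; apply: niceZ; exact: niceM.
  - by apply: niceZ; exact: niceM.
  rewrite haar_sum; last by move=> b; apply: niceZ; exact: niceM.
  rewrite haarZ; last exact: niceM.
  rewrite [X in _ - X = _]mulrC; congr (_ - _); apply: eq_bigr => b _.
  by rewrite haarZ//; exact: niceM.
have [n nx nA] : exists2 n : {ffun S -> int}, forall th : S -> R, dot n th = th x &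
    {in A, forall v, n v = 0}.
  exists (unit_charge x) => [th|v vA]; first exact: dot_unit.
  by rewrite ffunE; case: eqP vA => // ->; rewrite (negbTE xA).
have main : 0 <= haar (fun th => V th * D n th).
  apply: haar_cone_ge0 cV => // [g /outer_cosine_cosine /cosine_trig /cone_gen //|_ [m hm]].
  have hD : {in A, forall v, (n + m) v = 0} by move=> v vA; rewrite ffunE nA// hm.
  have hB : {in A, forall v, (n - m) v = 0} by move=> v vA; rewrite !ffunE nA// hm.
  rewrite (_ : haar _ = haar (fun th => 2^-1 * D (n + m) th + 2^-1 * D (n - m) th)).
    rewrite haarD; [|exact: niceZ|exact: niceZ].
    by rewrite !haarZ// addr_ge0// mulr_ge0 ?half_ge0 ?D_ge0.
  apply: eq_haar => th; rewrite /D.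
  have key v : cos (dot m th) * cos (th v - dot n th) =
     2^-1 * cos (th v - dot (n + m) th) + 2^-1 * cos (th v - dot (n - m) th).
    by rewrite mulrC cosM dotD dotB addrC; congr (_ * cos _ + _ * cos _); ring.
  rewrite mulrCA mulrBr mulrCA key mulr_sumr.
  rewrite (eq_bigr (fun b => 2^-1 * (c b * cos (th b - dot (n + m) th)) +
     2^-1 * (c b * cos (th b - dot (n - m) th)))) => [|b _]; last by rewrite mulrCA key; ring.
  by rewrite big_split/= -!mulr_sumr; ring.
have Zw : 0 < haar w by exact: partition_gt0.
have nHU : nice (fun th => edge_energy th + U th) by exact: niceD.
have Zv := partition_gt0 nHU.
have nwV := niceM nw nV.
have Ez v : expect (fun th => edge_energy th + U th) (fun th => cos (th v - th x)) =
   haar (fun th => V th * (w th * cos (th v - dot n th))) / haar (fun th => expR (edge_energy th + U th)).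
  by congr (_ / _); apply: eq_haar => th; rewrite nx expRD /V /w; ring.
rewrite Ez (eq_bigr (fun b => (c b / haar w) *
   (haar (fun th => V th * (w th * cos (th b - dot n th))) / haar (fun th => expR (edge_energy th + U th))))); last first.
  by move=> b _; rewrite Ez; congr (_ / _ * _); apply: eq_haar => th; rewrite mulrC.
under eq_bigr do rewrite mulrA.
rewrite -mulr_suml ler_wpM2r ?invr_ge0 ?(ltW Zv)//.
under eq_bigr do rewrite mulrAC.
rewrite -mulr_suml ler_pdivlMr// -subr_ge0; move: main; congr (_ <= _).
rewrite (_ : haar _ = haar (fun th =>
     \sum_(b <- B) c b * (V th * (w th * cos (th b - dot n th))) - haar w * (V th * (w th * cos (th a - dot n th))))); last first.
  apply: eq_haar => th; rewrite /D mulrBr mulr_sumr mulrBr mulr_sumr; congr (_ - _); last ring.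
  by apply: eq_bigr => b _; ring.
have nn v : nice (fun th => V th * (w th * cos (th v - dot n th))) by apply: niceM nV _; exact: niceM.
rewrite haarB; last 2 first.
- by apply: nice_sum => b; exact: niceZ.
- exact: niceZ.
rewrite haar_sum; last by move=> b; exact: niceZ.
rewrite haarZ// [X in _ - X = _]mulrC; congr (_ - _); apply: eq_bigr => b _.
by rewrite haarZ.
Qed.

End Rivasseau.

(** * Reflections *)

(** The reflection is an involution [rho] of the vertices, with [s] equal to 1 and
    -1 on its two sides and to 0 on its fixed vertices. Write the angles at a
    vertex [v] of the positive side and at its image as [phi_v + psi_v] and
    [phi_v - psi_v]. A coupling inside a side, together with its mirror image, then
    becomes [2 cos(phi_u - phi_v) cos(psi_u - psi_v)], and a coupling between [v]
    and its image becomes [cos(2 psi_v) = 2 cos^2(psi_v) - 1]; up to an additive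
    constant all of them are nonnegative combinations of monomials in
    [cos(m.phi)], [cos(psi_v)] and [sin(psi_v)], whose averages are nonnegative. *)

Section Reflection.
Context {R : realType} {S : finType}.
Variables (rho : S -> S) (s : S -> int).
Hypotheses (rhoK : involutive rho) (s_rho : forall v, s (rho v) = - s v)
  (s_val : forall v, [|| s v == 1, s v == 0 | s v == -1])
  (s_fix : forall v, s v = 0 -> rho v = v).

(** The vertex of the nonnegative side that carries the two new angles of
    [v] and of its image. *)
Definition rep v := if s v == -1 then rho v else v.

Definition reflected_angles (th : S + S -> R) (v : S) : R :=
  th (inl (rep v)) + (s v)%:~R * th (inr (rep v)).

Lemma rep_rho v : rep (rho v) = rep v.
Proof.
rewrite /rep s_rho; case/or3P: (s_val v) => /eqP E; rewrite E//= ?rhoK//.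
exact: s_fix.
Qed.

Lemma rep_eq u v : rep u = rep v -> u = v \/ u = rho v.
Proof.
rewrite /rep; do 2 case: ifP => _; move=> E; [left|right|right|left] => //.
- by rewrite -(rhoK u) E rhoK.
- by rewrite -E rhoK.
Qed.

Lemma affine_unfold : @affine_map R S (S + S)%type reflected_angles.
Proof.
move=> m; exists [ffun w => match w with
  | inl w => \sum_(v | rep v == w) m v
  | inr w => \sum_(v | rep v == w) s v * m v end], 0; split => [th|/ffunP m0].
  rewrite addr0 dot_sum /dot -big_split/=.
  rewrite (partition_big rep predT)//=; apply: eq_bigr => w _.
  rewrite !ffunE !rmorph_sum !mulr_suml -big_split/=; apply: eq_bigr => v /eqP <-.
  by rewrite /reflected_angles /lpart /rpart intrM; ring.
apply/ffunP => v; rewrite [RHS]ffunE.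
have := m0 (inl (rep v)); have := m0 (inr (rep v)); rewrite !ffunE.
rewrite (bigD1 v)//= [in X in _ -> X = 0 -> _](bigD1 v)//=.
have [rv|rv] := eqVneq (rho v) v.
  rewrite !big1; first by rewrite !addr0.
    by move=> u /andP[/eqP /rep_eq[->|->]]; rewrite ?rv eqxx.
  by move=> u /andP[/eqP /rep_eq[->|->]]; rewrite ?rv eqxx.
have P u : (rep u == rep v) && (u != v) = (u == rho v).
  apply/andP/eqP => [[/eqP/rep_eq[->|//]]|->]; first by rewrite eqxx.
  by rewrite rep_rho eqxx.
rewrite !(eq_bigl _ _ P) !big_pred1_eq s_rho.
have sv : s v != 0 by apply: contraNneq rv => /s_fix ->.
move=> /eqP; rewrite mulNr -mulrBr mulf_eq0 (negbTE sv) => /eqP.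
by lia.
Qed.

Lemma unfold_rho th v :
  reflected_angles th (rho v) = th (inl (rep v)) - (s v)%:~R * th (inr (rep v)).
Proof. by rewrite /reflected_angles rep_rho s_rho mulrNz mulNr. Qed.

Definition monomial (a b : S -> nat) (th : S -> R) : R :=
  \prod_v (cos (th v) ^+ a v * sin (th v) ^+ b v).

Lemma nice_monomial a b : nice (monomial a b).
Proof.
have ncos v : nice (fun th : S -> R => cos (th v)).
  by apply: cone_eq (nice_cos (unit_charge v) 0) => th; rewrite dot_unit addr0.
have nsin v : nice (fun th : S -> R => sin (th v)).
  by apply: cone_eq (nice_sin (unit_charge v) 0) => th; rewrite dot_unit addr0.
have nX f k : nice f -> nice (fun th : S -> R => f th ^+ k).
  move=> nf; elim: k => [|k IH]; first by apply: cone_eq (nice_cst 1) => th.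
  by apply: cone_eq (niceM nf IH) => th; rewrite exprS.
apply: cone_prod => [f g nf ng||v]; [exact: niceM|exact: nice_cst|].
by apply: niceM; exact: nX.
Qed.

(** A function that is odd under a change of variables has average 0. *)
Lemma haar_flip_ge0 (f : (S -> R) -> R) (sg : S -> int) (c : S -> R) : nice f ->
  (forall v, sg v != 0) ->
  (forall th, f (fun v => (sg v)%:~R * th v + c v) = - f th) -> 0 <= haar f.
Proof.
move=> nf sg0 fE; have := haar_subst (affine_flip c sg0) nf.
have -> : haar (fun th => f (fun v => (sg v)%:~R * th v + c v)) = - haar f.
  by rewrite -haarN//; apply: eq_haar.
lra.
Qed.

(** An odd exponent makes the average vanish, by the change of variable
    [psi_u -> - psi_u] for sines and [psi_u -> pi - psi_u] for cosines. *)
Lemma haar_monomial_ge0 a b : 0 <= haar (monomial a b).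
Proof.
have nM := nice_monomial a b.
have [/existsP[u ou]|] := boolP [exists u, odd (b u)].
  pose sg v : int := if v == u then -1 else 1.
  apply: (@haar_flip_ge0 _ sg (fun=> 0)) => // [v|th]; first by rewrite /sg; case: (v == u).
  rewrite /monomial (bigD1 u)//= [in RHS](bigD1 u)//= -mulNr; congr (_ * _).
    by rewrite /sg eqxx mulN1r addr0 cosN sinN exprNn -signr_odd ou; ring.
  by apply: eq_bigr => v /negbTE vu; rewrite /sg vu mul1r addr0.
rewrite negb_exists => /forallP eb.
have [/existsP[u ou]|] := boolP [exists u, odd (a u)].
  pose sg v : int := if v == u then -1 else 1.
  apply: (@haar_flip_ge0 _ sg (fun v => if v == u then pi else 0)) => // [v|th].
    by rewrite /sg; case: (v == u).
  rewrite /monomial (bigD1 u)//= [in RHS](bigD1 u)//= -mulNr; congr (_ * _).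
    rewrite /sg eqxx mulN1r cosDpi sinDpi cosN sinN opprK.
    by rewrite exprNn -signr_odd ou; ring.
  by apply: eq_bigr => v /negbTE vu; rewrite /sg vu mul1r addr0.
rewrite negb_exists => /forallP ea.
apply: haar_ge0 => // th; apply: prodr_ge0 => v _.
have ev (x : R) k : ~~ odd k -> 0 <= x ^+ k.
  by move=> k0; rewrite -(odd_double_half k) (negbTE k0) -mul2n exprM exprn_ge0// sqr_ge0.
by rewrite mulr_ge0 ?ev.
Qed.

Inductive folded : ((S + S -> R) -> R) -> Prop :=
| Folded m a b : folded (fun th => cos (dot m (lpart th)) * monomial a b (rpart th)).

Lemma folded_nice f : folded f -> nice f.
Proof.
case=> m a b.
have nc : nice (fun th : S -> R => cos (dot m th)) by exact/pcone_nice/cone_gen/Cosine.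
by apply: niceM; [exact: nice_lpart nc|exact: nice_rpart (nice_monomial a b)].
Qed.

Lemma folded_bounded f : folded f -> bounded_fct f.
Proof. by move=> /folded_nice /nice_bounded. Qed.

Lemma foldedM f g : cone folded f -> cone folded g -> cone folded (fun th => f th * g th).
Proof.
apply: coneM; first exact: folded_bounded.
move=> _ _ [m a b] [n c d].
pose ac v := (a v + c v)%N; pose bd v := (b v + d v)%N.
have ME (th : S -> R) : monomial ac bd th = monomial a b th * monomial c d th.
  rewrite /monomial -big_split; apply: eq_bigr => v _ /=.
  by rewrite !exprD; ring.
apply: cone_eq (coneD (coneZ (half_ge0 (R := R)) (cone_gen (Folded (m + n) ac bd)))
  (coneZ (half_ge0 (R := R)) (cone_gen (Folded (m - n) ac bd)))) => th.
rewrite !ME dotD dotB mulrACA cosM; ring.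
Qed.

Lemma monomial0 th : monomial (fun=> 0%N) (fun=> 0%N) th = 1.
Proof. by apply: big1 => v _; rewrite !expr0 mulr1. Qed.

Lemma folded1 : cone folded (fun=> 1).
Proof.
apply: cone_eq (cone_gen (Folded 0 (fun=> 0%N) (fun=> 0%N))) => th.
by rewrite dot0 cos0 monomial0 mulr1.
Qed.

Lemma folded_cos m : cone folded (fun th => cos (dot m (lpart th))).
Proof.
by apply: cone_eq (cone_gen (Folded m (fun=> 0%N) (fun=> 0%N))) => th; rewrite monomial0 mulr1.
Qed.

Lemma folded_cosr u : cone folded (fun th => cos (rpart th u)).
Proof.
apply: cone_eq (cone_gen (Folded 0 (fun v => (v == u) : nat) (fun=> 0%N))) => th.
rewrite dot0 cos0 mul1r /monomial (bigD1 u)//= eqxx expr1 expr0 mulr1 big1 ?mulr1// => v /negbTE ->.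
by rewrite !expr0 mulr1.
Qed.

Lemma folded_sinr u : cone folded (fun th => sin (rpart th u)).
Proof.
apply: cone_eq (cone_gen (Folded 0 (fun=> 0%N) (fun v => (v == u) : nat))) => th.
rewrite dot0 cos0 mul1r /monomial (bigD1 u)//= eqxx expr1 expr0 mul1r big1 ?mulr1// => v /negbTE ->.
by rewrite !expr0 mulr1.
Qed.

Lemma haar_folded_ge0 f : cone folded f -> 0 <= haar f.
Proof.
move=> cf; have -> : haar f = haar (fun th => f th * 1).
  by apply: eq_haar => th; rewrite mulr1.
apply: haar_cone_ge0 cf => [g /folded_nice//| |_ [m a b]]; first exact: nice_cst.
have nc : nice (fun th : S -> R => cos (dot m th)) by exact/pcone_nice/cone_gen/Cosine.
rewrite (_ : haar _ = haar (fun th : S -> R => cos (dot m th)) * haar (monomial a b)).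
  by rewrite haar_cosine mulr_ge0 ?haar_monomial_ge0.
rewrite -(haar_prod nc (nice_monomial a b)); apply: eq_haar => th.
by rewrite mulr1.
Qed.

Lemma folded_cos_sign u v : cone folded (fun th => cos ((s u)%:~R * rpart th v)).
Proof.
case/or3P: (s_val u) => /eqP E; rewrite E.
- by apply: cone_eq (folded_cosr v) => th; rewrite mul1r.
- by apply: cone_eq folded1 => th; rewrite mul0r cos0.
- by apply: cone_eq (folded_cosr v) => th; rewrite mulN1r cosN.
Qed.

Lemma folded_sin_sign u v : 0 <= s u * s v ->
  cone folded (fun th => sin ((s u)%:~R * rpart th (rep u)) * sin ((s v)%:~R * rpart th (rep v))).
Proof.
have ss := foldedM (folded_sinr (rep u)) (folded_sinr (rep v)).
case/or3P: (s_val u) => /eqP ->; case/or3P: (s_val v) => /eqP -> // _.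
- by apply: cone_eq ss => th; rewrite !mul1r.
- by apply: cone_eq cone0 => th; rewrite mul0r sin0 mulr0.
- by apply: cone_eq cone0 => th; rewrite mul0r sin0 mul0r.
- by apply: cone_eq cone0 => th; rewrite mul0r sin0 mul0r.
- by apply: cone_eq cone0 => th; rewrite mul0r sin0 mul0r.
- by apply: cone_eq cone0 => th; rewrite mul0r sin0 mulr0.
- by apply: cone_eq ss => th; rewrite !mulN1r !sinN mulrNN.
Qed.

Variable K : S -> S -> R.
Hypotheses (K0 : forall u v, 0 <= K u v) (K_rho : forall u v, K (rho u) (rho v) = K u v)
  (K_cross : forall u v, s u * s v = -1 -> K u v != 0 -> v = rho u).

Definition pair_energy (th : S -> R) : R := \sum_u \sum_v K u v * cos (th u - th v).

Lemma pair_energy_pcone : pcone pair_energy.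
Proof.
apply: cone_sum => u; apply: cone_sum => v; apply: coneZ => //.
by apply: cone_eq (cone_gen (Cosine (edge_charge (u, v)))) => th; rewrite dot_edge.
Qed.

Lemma rho_inj : injective rho. Proof. exact: inv_inj. Qed.

Lemma pair_energy_rho th : pair_energy (fun v => th (rho v)) = pair_energy th.
Proof.
rewrite /pair_energy [RHS](reindex_inj rho_inj); apply: eq_bigr => u _ /=.
by rewrite [RHS](reindex_inj rho_inj); apply: eq_bigr => v _ /=; rewrite K_rho.
Qed.

Lemma unfold_pair th u v :
  cos (reflected_angles th u - reflected_angles th v) +
  cos (reflected_angles th (rho u) - reflected_angles th (rho v)) =
  2 * (cos (dot (edge_charge (rep u, rep v)) (lpart th)) *
   (cos ((s u)%:~R * rpart th (rep u)) * cos ((s v)%:~R * rpart th (rep v)) +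
    sin ((s u)%:~R * rpart th (rep u)) * sin ((s v)%:~R * rpart th (rep v)))).
Proof.
rewrite !unfold_rho /reflected_angles dot_edge /= /lpart /rpart.
set x := _%:~R * _; set y := _%:~R * _.
rewrite -cosB; set a := th _; set b := th _.
have -> : a + x - (b + y) = (a - b) + (x - y) by ring.
have -> : a - x - (b - y) = (a - b) - (x - y) by ring.
by rewrite [cos (_ + (_ - _))]cosD [cos (_ - _ - _)]cosB; ring.
Qed.

Lemma unfold_energy : exists h c, cone folded h /\
  forall th, pair_energy (reflected_angles th) = h th + c.
Proof.
pose good u v := 0 <= s u * s v.
pose h0 u v (th : S + S -> R) := if good u v then
   cos (dot (edge_charge (rep u, rep v)) (lpart th)) *
   (cos ((s u)%:~R * rpart th (rep u)) * cos ((s v)%:~R * rpart th (rep v)) +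
    sin ((s u)%:~R * rpart th (rep u)) * sin ((s v)%:~R * rpart th (rep v)))
   else 2 * (cos (rpart th (rep u)) * cos (rpart th (rep u))).
have ch u v : cone folded (h0 u v).
  rewrite /h0; have [g|g] := boolP (good u v); last first.
    by apply: coneZ => //; apply: foldedM; exact: folded_cosr.
  apply: foldedM; first exact: folded_cos.
  by apply: coneD; [apply: foldedM; exact: folded_cos_sign|exact: folded_sin_sign].
exists (fun th => \sum_u \sum_v K u v * h0 u v th),
  (- \sum_u \sum_v (if good u v then 0 else K u v)); split.
  by apply: cone_sum => u; apply: cone_sum => v; exact: coneZ.
move=> th.
have key u v : K u v * (cos (reflected_angles th u - reflected_angles th v) +
    cos (reflected_angles th (rho u) - reflected_angles th (rho v))) =
   2 * (K u v * h0 u v th - (if good u v then 0 else K u v)).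
  have [->|Kuv] := eqVneq (K u v) 0; first by case: ifP; rewrite !mul0r subrr mulr0.
  rewrite unfold_pair /h0; have [g|] := boolP (good u v); first by rewrite subr0; ring.
  rewrite /good -ltNge => sg; have suv : s u * s v = -1.
    by move: sg; case/or3P: (s_val u) => /eqP ->; case/or3P: (s_val v) => /eqP ->.
  rewrite (K_cross suv Kuv) rep_rho s_rho dot_edge subrr cos0 mulrNz mulNr cosN sinN.
  have su : s u = 1 \/ s u = -1.
    by case/or3P: (s_val u) suv => /eqP ->; [left|rewrite mul0r|right].
  have sq := cos2Dsin2 (rpart th (rep u)).
  have {}sq : sin (rpart th (rep u)) * sin (rpart th (rep u)) =
     1 - cos (rpart th (rep u)) * cos (rpart th (rep u)) by rewrite -sq; ring.
  case: su => ->; rewrite ?mul1r ?mulN1r ?cosN ?sinN mulrN ?mulNr ?opprK ?mulrN ?opprK sq; ring.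
have half (x y : R) : x + x = 2 * y -> x = y by lra.
apply: half; rewrite -{2}pair_energy_rho /pair_energy -big_split/=.
rewrite -sumrB mulr_sumr; apply: eq_bigr => u _.
rewrite -big_split/= -sumrB mulr_sumr; apply: eq_bigr => v _.
by rewrite -mulrDr key.
Qed.

(** The inequality of Messager and Miracle-Sole. Averaged over the reflection, the
    difference of the two observables is
    [2 cos(phi_a - phi_x) sin(psi_a) sin(psi_x)], which has nonnegative
    coefficients when [a] and [x] are on the same side. *)
Lemma reflection_ineq a x : 0 <= s a -> 0 <= s x ->
  expect pair_energy (fun th => cos (th a - th (rho x))) <=
  expect pair_energy (fun th => cos (th a - th x)).
Proof.
move=> sa sx; have pH := pair_energy_pcone; have nH := pcone_nice pH.
have nE := nice_exp nH.
rewrite ler_wpM2r ?invr_ge0 ?(ltW (partition_gt0 nH))//.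
have nc u v : nice (fun th : S -> R => cos (th u - th v)).
  by apply: cone_eq (nice_cos (edge_charge (u, v)) 0) => th; rewrite addr0 dot_edge.
have nce u v := niceM (nc u v) nE.
have rhoE u v : haar (fun th => cos (th (rho u) - th (rho v)) * expR (pair_energy th)) =
    haar (fun th => cos (th u - th v) * expR (pair_energy th)).
  rewrite -(haar_subst (affine_relabel rho_inj) (nce u v)).
  by apply: eq_haar => th; rewrite pair_energy_rho.
pose f (th : S -> R) := ((cos (th a - th x) + cos (th (rho a) - th (rho x))) -
   (cos (th a - th (rho x)) + cos (th (rho a) - th x))) * expR (pair_energy th).
have nf : nice f.
  by apply: niceM nE; apply: niceB; apply: niceD.
have fE : haar f = 2 * (haar (fun th => cos (th a - th x) * expR (pair_energy th)) -
    haar (fun th => cos (th a - th (rho x)) * expR (pair_energy th))).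
  have n1 := niceD (nce a x) (nce (rho a) (rho x)).
  have n2 := niceD (nce a (rho x)) (nce (rho a) x).
  transitivity (haar (fun th =>
    (cos (th a - th x) * expR (pair_energy th) + cos (th (rho a) - th (rho x)) * expR (pair_energy th)) -
    (cos (th a - th (rho x)) * expR (pair_energy th) + cos (th (rho a) - th x) * expR (pair_energy th)))).
    by apply: eq_haar => th; rewrite /f; ring.
  rewrite (haarB n1 n2) !haarD// rhoE.
  by have := rhoE a (rho x); rewrite rhoK => ->; ring.
suff : 0 <= haar f by rewrite fE; lra.
rewrite -(haar_subst affine_unfold nf).
have [h [c [ch hE]]] := unfold_energy.
apply: haar_folded_ge0.
have eh := cone_exp folded_bounded foldedM folded1 ch.
have c4 : 0 <= 4 * expR c by rewrite mulr_ge0 ?expR_ge0.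
have sax : 0 <= s a * s x by rewrite mulr_ge0.
apply: cone_eq (coneZ c4 (foldedM (foldedM (folded_cos (edge_charge (rep a, rep x)))
   (folded_sin_sign sax)) eh)) => th.
rewrite /f unfold_pair hE expRD.
have -> : cos (reflected_angles th a - reflected_angles th (rho x)) +
    cos (reflected_angles th (rho a) - reflected_angles th x) =
    cos (reflected_angles th a - reflected_angles th (rho x)) +
    cos (reflected_angles th (rho a) - reflected_angles th (rho (rho x))) by rewrite rhoK.
rewrite unfold_pair rep_rho s_rho mulrNz mulNr cosN sinN; ring.
Qed.

End Reflection.

(** * Correlations in a finite set of vertices *)

Section FinitePart.
Context {R : realType} {T : choiceType}.
Implicit Types (V : {fset T}) (E : {fset T * T}) (J : T * T -> R).
Local Open Scope fset_scope.
Local Open Scope ring_scope.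

Definition extend V (eta : V -> R) (x : T) : R :=
  if insub x is Some v then eta v else 0.

Lemma extend_val V (eta : V -> R) (v : V) : extend eta (val v) = eta v.
Proof. by rewrite /extend valK. Qed.

Lemma extend_out V (eta : V -> R) x : x \notin V -> extend eta x = 0.
Proof. by move=> xV; rewrite /extend insubN. Qed.

(** Transports the iterated integral over the vertices of [V] to the finite
    type of its elements, where the general theory applies. *)
Lemma angle_integral_extend V (s : seq V) f (eta : V -> R) :
  angle_integral (map val s) f (extend eta) =
  angle_integral s (fun eta => f (extend eta)) eta.
Proof.
elim: s eta => //= v s IH eta; congr (_ * _); apply: eq_Rintegral => t _.
rewrite -IH; congr angle_integral; apply: funext => x /=.
case: (boolP (x \in V)) => xV; last first.
  rewrite !extend_out//; case: eqP => // xv.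
  by move: xV; rewrite xv (valP v).
rewrite -[x]/(val [` xV]) !extend_val /=.
by rewrite (_ : (x == _) = ([` xV] == v)).
Qed.

Lemma angle_integral_haar V f :
  angle_integral V f (fun=> 0) = haar (fun eta : V -> R => f (extend eta)).
Proof.
rewrite /haar -angle_integral_extend enum_fsetE; congr angle_integral.
by apply: funext => x; rewrite /extend; case: insubP.
Qed.

Lemma corr_expect V E J (x y : V) : corr V E J (val x) (val y) =
  expect (fun eta => energy E J (extend eta)) (fun eta => cos (eta x - eta y)).
Proof.
rewrite /corr /gibbs /unnormalized !angle_integral_haar; congr (_ / _).
  by apply: eq_haar => eta; rewrite !extend_val.
by apply: eq_haar => eta; rewrite mul1r.
Qed.

Definition edges_in E V := {subset E <= V `*` V}.

Lemma edge1_in E V e : edges_in E V -> e \in E -> e.1 \in V.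
Proof. by move=> EV /EV; rewrite in_fsetM => /andP[]. Qed.

Lemma edge2_in E V e : edges_in E V -> e \in E -> e.2 \in V.
Proof. by move=> EV /EV; rewrite in_fsetM => /andP[]. Qed.

Lemma pcone_cos_diff (S : finType) (u v : S) : pcone (fun th : S -> R => cos (th u - th v)).
Proof.
by apply: cone_eq (cone_gen (Cosine (edge_charge (u, v)))) => th; rewrite dot_edge.
Qed.

Lemma cone_sum_seq (X : Type) (G : (X -> R) -> Prop) (I : eqType) (r : seq I) (F : I -> X -> R) :
  {in r, forall i, cone G (F i)} -> cone G (fun x => \sum_(i <- r) F i x).
Proof.
elim: r => [|i r IH] h; first by apply: cone_eq cone0 => x; rewrite big_nil.
have hi := h i (mem_head _ _).
have hr : {in r, forall i, cone G (F i)} by move=> j jr; apply: h; rewrite inE jr orbT.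
by apply: cone_eq (coneD hi (IH hr)) => x; rewrite big_cons.
Qed.

Lemma energy_pcone V E J : edges_in E V -> {in E, forall e, 0 <= J e} ->
  pcone (fun eta : V -> R => energy E J (extend eta)).
Proof.
move=> EV J0; apply: cone_sum_seq => e eE; apply: coneZ; first exact: J0.
have e1 := edge1_in EV eE; have e2 := edge2_in EV eE.
rewrite -[e.1]/(val [` e1]) -[e.2]/(val [` e2]).
by apply: cone_eq (pcone_cos_diff [` e1] [` e2]) => eta; rewrite !extend_val.
Qed.

Lemma nice_energy V E J : edges_in E V ->
  nice (fun eta : V -> R => energy E J (extend eta)).
Proof.
move=> EV; apply: cone_sum_seq => e eE; apply: niceZ.
have e1 := edge1_in EV eE; have e2 := edge2_in EV eE.
rewrite -[e.1]/(val [` e1]) -[e.2]/(val [` e2]).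
by apply: cone_eq (pcone_nice (pcone_cos_diff [` e1] [` e2])) => eta; rewrite !extend_val.
Qed.

Lemma corr_ge0 V E J x y : edges_in E V -> {in E, forall e, 0 <= J e} ->
  x \in V -> y \in V -> 0 <= corr V E J x y.
Proof.
move=> EV J0 xV yV; rewrite (corr_expect E J [` xV] [` yV]).
by apply: expect_ge0; [exact: energy_pcone|exact: pcone_cos_diff].
Qed.

Lemma corr_le1 V E J x y : edges_in E V -> x \in V -> y \in V -> corr V E J x y <= 1.
Proof.
move=> EV xV yV; rewrite (corr_expect E J [` xV] [` yV]).
apply: expect_le; [exact: nice_energy|exact/pcone_nice/pcone_cos_diff|].
by move=> th; exact: cos_le1.
Qed.

Lemma energyD E J J' th : energy E (fun e => J e + J' e) th = energy E J th + energy E J' th :> R.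
Proof. by rewrite /energy -big_split; apply: eq_bigr => e _; rewrite mulrDl. Qed.

Lemma energyZ E c J th : energy E (fun e => c * J e) th = c * energy E J th :> R.
Proof. by rewrite /energy mulr_sumr; apply: eq_bigr => e _; rewrite mulrA. Qed.

Lemma corr_coupling_mono V E J J' x y : edges_in E V ->
  {in E, forall e, 0 <= J e <= J' e} -> x \in V -> y \in V ->
  corr V E J x y <= corr V E J' x y.
Proof.
move=> EV J0 xV yV; rewrite !(corr_expect E _ [` xV] [` yV]).
have -> : (fun eta : V -> R => energy E J' (extend eta)) =
    fun eta => energy E J (extend eta) + energy E (fun e => J' e - J e) (extend eta).
  by apply: funext => eta; rewrite -energyD; apply: eq_bigr => e _; rewrite subrKC.
apply: expect_mono; last exact: pcone_cos_diff.
- by apply: energy_pcone => // e /J0 /andP[].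
- by apply: energy_pcone => // e /J0 /andP[_]; rewrite subr_ge0.
Qed.

(** The bound [k] on the total strength of the varied couplings is also a bound
    on the corresponding part of the energy. *)
Lemma corr_chord V E J J1 k p b b' x y : edges_in E V ->
  {in E, forall e, 0 <= J e} -> {in E, forall e, 0 <= J1 e} ->
  \sum_(e <- E) J1 e <= k -> x \in V -> y \in V ->
  0 < k -> 0 <= p -> p <= 1 -> 0 <= b' -> b' <= b ->
  1 - expR (- (2 * k * b')) = p * (1 - expR (- (2 * k * b))) ->
  corr V E (fun e => J e + b' * J1 e) x y <=
  (1 - p) * corr V E J x y + p * corr V E (fun e => J e + b * J1 e) x y.
Proof.
move=> EV J0 J10 Jk xV yV k0 p0 p1 b0 bb' hb.
rewrite !(corr_expect E _ [` xV] [` yV]).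
have E1 t : (fun eta : V -> R => energy E (fun e => J e + t * J1 e) (extend eta)) =
    fun eta => energy E J (extend eta) + t * energy E J1 (extend eta).
  by apply: funext => eta; rewrite energyD energyZ.
rewrite !E1; apply: (@expect_chord R _ _ _ _ k) => //.
- exact: pcone_cos_diff.
- exact: energy_pcone.
- exact: energy_pcone.
- move=> th; apply: le_trans Jk; rewrite /energy [leLHS]big_seq [leRHS]big_seq.
  by apply: ler_sum => e eE; rewrite ler_piMr ?cos_le1// J10.
Qed.

Lemma corr_continuous V E J x y : edges_in E V ->
  {in E, forall e, 0 <= J e} -> x \in V -> y \in V ->
  continuous (fun t : R => corr V E (fun e => t * J e) x y).
Proof.
move=> EV J0 xV yV.
have -> : (fun t : R => corr V E (fun e => t * J e) x y) =
    fun t => expect (fun eta : V -> R => 0 + t * energy E J (extend eta))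
      (fun eta => cos (eta [` xV] - eta [` yV])).
  apply: funext => t; rewrite (corr_expect E _ [` xV] [` yV]); congr expect.
  by apply: funext => eta; rewrite energyZ add0r.
have pf : pcone (fun th : V -> R => cos (th [` xV] - th [` yV])) by exact: pcone_cos_diff.
have p0 : @pcone R V (fun=> 0) by exact: cone0.
exact: expect_continuous pf p0 (energy_pcone EV J0).
Qed.

End FinitePart.

Section Relabelling.
Context {R : realType} {T : choiceType}.
Implicit Types (V : {fset T}) (E : {fset T * T}) (J : T * T -> R).
Local Open Scope fset_scope.
Local Open Scope ring_scope.

Lemma energy_local V E J (th th' : T -> R) : edges_in E V ->
  {in V, th =1 th'} -> energy E J th = energy E J th'.
Proof.
move=> EV e; apply: eq_big_seq => f fE.
by rewrite !e ?(edge1_in EV fE) ?(edge2_in EV fE).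
Qed.

(** Vertices of [V'] outside the image of [g] carry no interaction, so their
    angles integrate out; this compares different volumes and moves a volume by a
    lattice automorphism. *)
Lemma corr_relabel V V' E E' J J' (g : T -> T) x y : edges_in E V ->
  {in V &, injective g} -> {in V, forall v, g v \in V'} ->
  (forall th, energy E' J' th = energy E J (fun v => th (g v))) ->
  x \in V -> y \in V -> corr V' E' J' (g x) (g y) = corr V E J x y.
Proof.
move=> EV gi gV eE xV yV.
pose j (v : V) : V' := [` gV (val v) (valP v)].
have ij : injective j.
  move=> u v /(congr1 val) /= /gi uv; apply: val_inj; apply: uv; exact: valP.
rewrite (corr_expect E J [` xV] [` yV]).
rewrite -[g x]/(val (j [` xV])) -[g y]/(val (j [` yV])) corr_expect.
have eE' (th : V' -> R) : energy E' J' (extend th) =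
    energy E J (extend (fun v : V => th (j v))).
  rewrite eE; apply: energy_local EV _ => v vV.
  by rewrite -[g v]/(val (j [` vV])) -[v]/(val [` vV]) !extend_val.
have nE := nice_energy J EV.
have nc := pcone_nice (@pcone_cos_diff R _ [` xV] [` yV]).
congr (_ / _).
  rewrite -(haar_subst (affine_relabel ij) (niceM nc (nice_exp nE))).
  by apply: eq_haar => th; rewrite eE'.
rewrite -(haar_subst (affine_relabel ij) (nice_exp nE)).
by apply: eq_haar => th; rewrite eE'.
Qed.

Lemma corr_mono V V' E E' J J' x y : V `<=` V' -> edges_in E V -> edges_in E' V' ->
  E `<=` E' -> {in E, forall e, 0 <= J e <= J' e} -> {in E', forall e, 0 <= J' e} ->
  x \in V -> y \in V -> corr V E J x y <= corr V' E' J' x y.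
Proof.
move=> VV EV EV' EE JJ J0 xV yV; have sV := fsubsetP VV.
rewrite -(@corr_relabel V V' E E' J (fun e => if e \in E then J e else 0) id)//; last first.
  move=> th; rewrite /energy (bigID (mem E))/= [X in _ + X]big1 ?addr0; last first.
    by move=> e /negbTE ->; rewrite mul0r.
  rewrite -big_filter; apply: etrans (perm_big E _) _.
    apply: uniq_perm; [exact/filter_uniq/fset_uniq|exact: fset_uniq|].
    move=> e; rewrite mem_filter; apply: andb_idr => eE.
    exact: (fsubsetP EE).
  by apply: eq_big_seq => e eE; rewrite eE.
apply: corr_coupling_mono => //; [|exact: sV|exact: sV].
by move=> e eE'; case: ifP => [/JJ//|_]; rewrite lexx J0.
Qed.

End Relabelling.

Section Separation.
Context {R : realType} {T : choiceType}.
Implicit Types (V : {fset T}) (E : {fset T * T}) (J : T * T -> R).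
Local Open Scope fset_scope.
Local Open Scope ring_scope.

Lemma energy_extend V E J (eta : V -> R) : edges_in E V ->
  energy E J (extend eta) =
  \sum_(e : V * V | (val e.1, val e.2) \in E) J (val e.1, val e.2) * cos (eta e.1 - eta e.2).
Proof.
move=> EV; pose F e := J e * cos (extend eta e.1 - extend eta e.2).
pose vv (e : V * V) := (val e.1, val e.2).
transitivity (\sum_(e <- [seq vv e | e <- enum {: V * V} & vv e \in E]) F e).
  apply: perm_big; apply: uniq_perm; first exact: fset_uniq.
    rewrite map_inj_uniq; first exact/filter_uniq/enum_uniq.
    by move=> [u v] [u' v'] [] /val_inj -> /val_inj ->.
  move=> e; apply/idP/mapP => [eE|[e' + ->]]; last by rewrite mem_filter => /andP[].
  exists ([` edge1_in EV eE], [` edge2_in EV eE]); last by case: e eE.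
  by rewrite mem_filter mem_enum andbT /vv/=; case: e eE.
rewrite big_map big_filter big_enum_cond/=; apply: eq_bigr => e _.
by rewrite /F /vv /= !extend_val.
Qed.

(** The couplings that touch [A] form the inner energy of [rivasseau]; the others
    do not involve the angles of [A], so they belong to the outer weight. *)
Lemma corr_separation V E J (A : {pred T}) (B : seq T) a x : edges_in E V ->
  {in E, forall e, 0 <= J e} -> {subset B <= V} -> {in B, forall b, b \notin A} ->
  {in E, forall e, (e.1 \in A -> (e.2 \in A) || (e.2 \in B)) /\
                   (e.2 \in A -> (e.1 \in A) || (e.1 \in B))} ->
  a \in V -> a \in A -> x \in V -> x \notin A ->
  corr V E J a x <= \sum_(b <- B)
    corr V E (fun e => J e * ((e.1 \in A) || (e.2 \in A))%:R) a b * corr V E J b x.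
Proof.
move=> EV J0 BV BA sep aV aA xV xA.
pose A' : {pred V} := [pred v | val v \in A].
pose B' := [seq insubd [` aV] b | b <- B].
have B'E (v : V) : (v \in B') = (val v \in B).
  apply/mapP/idP => [[b bB ->]|vB]; first by rewrite val_insubd BV.
  by exists (val v) => //; rewrite valKd.
pose vv (e : V * V) := (val e.1, val e.2).
pose inn (e : V * V) := (val e.1 \in A) || (val e.2 \in A).
pose E' := [seq e <- enum {: V * V} | (vv e \in E) && inn e].
pose J' e := `|J (vv e)|.
have E'ok : all (inner_edge A' B') E'.
  apply/allP => e; rewrite mem_filter => /andP[/andP[/sep[/= s1 s2] _] _].
  by rewrite /inner_edge !B'E; apply/andP; split; apply/implyP.
have BA' : {in B', forall b, b \notin A'} by move=> b; rewrite B'E => /BA.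
have J'0 e : 0 <= J' e by rewrite normr_ge0.
pose U (eta : V -> R) := \sum_(e : V * V | (vv e \in E) && ~~ inn e)
   J (vv e) * cos (eta e.1 - eta e.2).
have cU : cone (@outer_cosine R V A') U.
  rewrite /U; apply: (@cone_eq _ _ _ (fun eta => \sum_(e <- [seq e <- enum {: V * V} | (vv e \in E) && ~~ inn e])
    J (vv e) * cos (eta e.1 - eta e.2))).
    by move=> eta; rewrite big_filter big_enum_cond.
  apply: cone_sum_seq => e; rewrite mem_filter => /andP[/andP[eE]].
  rewrite negb_or => /andP[e1 e2] _; apply: coneZ; first exact: J0.
  have m0 : {in A', forall v, edge_charge e v = 0}.
    move=> v vA; rewrite !ffunE; case: eqP vA => [->|_]; first by rewrite inE (negbTE e1).
    by case: eqP => [->|_]; rewrite ?inE ?(negbTE e2)// subrr.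
  by apply: cone_eq (cone_gen (OuterCosine m0)) => eta; rewrite dot_edge.
have innE (eta : V -> R) : energy E (fun e => J e * ((e.1 \in A) || (e.2 \in A))%:R) (extend eta) =
    edge_energy E' J' eta.
  rewrite energy_extend// /edge_energy big_filter big_enum_cond/= big_mkcondr/=.
  apply: eq_bigr => e eE; rewrite /inn /J' /vv ger0_norm ?J0//.
  by case: ifP => _; rewrite ?mulr1// mulr0 mul0r.
have fullE (eta : V -> R) : energy E J (extend eta) = edge_energy E' J' eta + U eta.
  rewrite energy_extend// (bigID inn)/=; congr (_ + _).
  rewrite /edge_energy big_filter big_enum_cond/=.
  by apply: eq_bigr => e /andP[eE _]; rewrite /J' ger0_norm// J0.
have := rivasseau BA' J'0 E'ok cU (a := [` aV]) (x := [` xV]).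
rewrite inE/= aA inE/= xA => /(_ isT isT).
rewrite big_map (corr_expect E J [` aV] [` xV]) (funext fullE).
congr (_ <= _); apply: eq_big_seq => b bB.
have bV := BV b bB; rewrite (corr_expect E J [` bV] [` xV]).
rewrite (corr_expect E _ [` aV] [` bV]) (funext fullE) (funext innE).
by rewrite -{1 2}[b]/(val [` bV]) !valKd.
Qed.

End Separation.

(** * The clean model on the square lattice *)

Section LatticeGraph.
Context {R : realType}.
Implicit Types (V : {fset Z2}) (u v x y : Z2) (beta : R).
Local Open Scope fset_scope.
Local Open Scope ring_scope.

Definition step u v : bool := (v == u + (1, 0)) || (v == u + (0, 1)).

Definition adj u v : bool := `|u.1 - v.1| + `|u.2 - v.2| == 1.

Definition nn_edges V : {fset Z2 * Z2} :=
  [fset e in V `*` V | (e.2 == e.1 + (1, 0)) || (e.2 == e.1 + (0, 1))].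

Lemma stepE u v : step u v =
  (v.1 == u.1 + 1) && (v.2 == u.2) || (v.1 == u.1) && (v.2 == u.2 + 1).
Proof. by case: u v => [a b] [c d]; rewrite /step /= !xpair_eqE /= !addr0. Qed.

Lemma adjE u v : (adj u v : nat) = (step u v + step v u)%N.
Proof. by rewrite !stepE /adj; lia. Qed.

Lemma in_nn_edges V e : (e \in nn_edges V) = [&& e.1 \in V, e.2 \in V & step e.1 e.2].
Proof. by rewrite !inE/= -andbA. Qed.

Lemma nn_edges_in V : edges_in (nn_edges V) V.
Proof. by move=> e; rewrite in_nn_edges in_fsetM => /and3P[-> ->]. Qed.

Lemma nn_edges_mono V V' : V `<=` V' -> nn_edges V `<=` nn_edges V'.
Proof.
move=> /fsubsetP sV; apply/fsubsetP => e.
by rewrite !in_nn_edges => /and3P[/sV -> /sV ->].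
Qed.

(** Forgets the orientation of the edges, which lattice automorphisms do not
    preserve. *)
Lemma energy_symmetric V beta (th : Z2 -> R) :
  2 * energy (nn_edges V) (fun=> beta) th =
  \sum_(u <- V) \sum_(v <- V) beta * (adj u v)%:R * cos (th u - th v).
Proof.
have E : energy (nn_edges V) (fun=> beta) th =
    \sum_(u <- V) \sum_(v <- V) beta * (step u v)%:R * cos (th u - th v).
  pose F (e : Z2 * Z2) := beta * (step e.1 e.2)%:R * cos (th e.1 - th e.2).
  have -> : \sum_(u <- V) \sum_(v <- V) beta * (step u v)%:R * cos (th u - th v) =
      \sum_(e <- [seq (u, v) | u <- V, v <- V]) F e by rewrite big_allpairs.
  rewrite (bigID (fun e => step e.1 e.2))/= [X in _ + X]big1 ?addr0; last first.
    by move=> e /negbTE se; rewrite /F se mulr0 mul0r.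
  have Pm : perm_eq (nn_edges V) [seq e <- [seq (u, v) | u <- V, v <- V] | step e.1 e.2].
    apply: uniq_perm; [exact: fset_uniq| |].
      apply: filter_uniq; apply: allpairs_uniq; [exact: fset_uniq|exact: fset_uniq|].
      by move=> [? ?] [? ?] _ _.
    move=> e; rewrite in_nn_edges mem_filter; apply/and3P/andP => [[e1 e2 se]|[se]].
      by split => //; apply/allpairsP; exists e; split => //; case: e {e1 e2 se}.
    by case/allpairsP => -[u v] /= [uV vV eE]; move: se; rewrite eE.
  rewrite -[RHS]big_filter /energy (perm_big _ Pm)/= !big_filter; apply: eq_bigr => e se.
  by rewrite /F se mulr1.
rewrite mulr_natl mulr2n {1}E E [X in _ + X]exchange_big -big_split/=.
apply: eq_bigr => u _; rewrite -big_split/=; apply: eq_bigr => v _.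
by rewrite -[th v - th u]opprB cosN adjE natrD; ring.
Qed.

Definition clean_corr beta V x y : R := corr V (nn_edges V) (fun=> beta) x y.

Lemma clean_corr_mono beta V V' x y : 0 <= beta -> V `<=` V' -> x \in V -> y \in V ->
  clean_corr beta V x y <= clean_corr beta V' x y.
Proof.
move=> b0 VV xV yV; apply: corr_mono; rewrite ?nn_edges_mono//; try exact: nn_edges_in.
by move=> e _; rewrite lexx b0.
Qed.

Lemma clean_corr_ge0 beta V x y : 0 <= beta -> x \in V -> y \in V -> 0 <= clean_corr beta V x y.
Proof. by move=> b0 xV yV; apply: corr_ge0 => //; exact: nn_edges_in. Qed.

Lemma clean_corr_le1 beta V x y : x \in V -> y \in V -> clean_corr beta V x y <= 1.
Proof. by move=> xV yV; apply: corr_le1 => //; exact: nn_edges_in. Qed.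

Lemma clean_corr_automorphism beta V (tau : Z2 -> Z2) x y : injective tau ->
  (forall u v, adj (tau u) (tau v) = adj u v) -> x \in V -> y \in V ->
  clean_corr beta (tau @` V) (tau x) (tau y) = clean_corr beta V x y.
Proof.
move=> it at_ xV yV; apply: corr_relabel => //.
- exact: nn_edges_in.
- by move=> u v _ _; exact: it.
- by move=> v vV; apply: in_imfset.
move=> th; apply: (mulfI (_ : 2 != 0)) => //.
rewrite !energy_symmetric big_imfset/=; last by move=> u v _ _; exact: it.
apply: eq_bigr => u _; rewrite big_imfset/=; last by move=> u' v _ _; exact: it.
by apply: eq_bigr => v _; rewrite at_.
Qed.

Lemma clean_corr_reflection beta V (rho : Z2 -> Z2) (s : Z2 -> int) a x : 0 <= beta ->
  involutive rho -> (forall v, s (rho v) = - s v) ->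
  (forall v, [|| s v == 1, s v == 0 | s v == -1]) ->
  (forall v, s v = 0 -> rho v = v) ->
  (forall u v, adj (rho u) (rho v) = adj u v) ->
  (forall u v, s u * s v = -1 -> adj u v -> v = rho u) ->
  {in V, forall v, rho v \in V} -> a \in V -> x \in V -> 0 <= s a -> 0 <= s x ->
  clean_corr beta V a (rho x) <= clean_corr beta V a x.
Proof.
move=> b0 rK sr sv sf ra sc rV aV xV sa sx.
pose rho' (v : V) : V := [` rV (val v) (valP v)].
pose s' (v : V) := s (val v).
pose K (u v : V) : R := beta / 2 * (adj (val u) (val v))%:R.
have eE (eta : V -> R) : energy (nn_edges V) (fun=> beta) (extend eta) = pair_energy K eta.
  apply: (mulfI (_ : 2 != 0 :> R)) => //.
  rewrite energy_symmetric /pair_energy big_seq_fsetE/= mulr_sumr.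
  apply: eq_bigr => u _; rewrite big_seq_fsetE/= mulr_sumr; apply: eq_bigr => v _.
  by rewrite !extend_val /K; field.
rewrite /clean_corr (corr_expect _ _ [` aV] [` xV]) -[rho x]/(val (rho' [` xV])).
rewrite (corr_expect _ _ [` aV] (rho' [` xV])) (funext eE).
apply: (@reflection_ineq R V rho' s') => //.
- by move=> v; apply: val_inj; rewrite /= rK.
- by move=> v; exact: sr.
- by move=> v; exact: sv.
- by move=> v /sf e; apply: val_inj.
- by move=> u v; rewrite mulr_ge0// divr_ge0.
- by move=> u v; rewrite /K /= ra.
- move=> u v suv; rewrite /K; case: (boolP (adj _ _)) => [uv _|_]; last by rewrite mulr0 eqxx.
  by apply: val_inj; exact: sc.
Qed.

End LatticeGraph.

Section InfiniteVolume.
Context {R : realType}.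
Implicit Types (V : {fset Z2}) (u v x y : Z2) (beta : R).
Local Open Scope classical_set_scope.
Local Open Scope fset_scope.
Local Open Scope ring_scope.

(** The first boxes may miss the two points, hence the shift by [N]. *)
Lemma eventually_nondecreasing_cvg (u : nat -> R) N M :
  (forall n, (N <= n)%N -> u n <= u n.+1) -> (forall n, (N <= n)%N -> u n <= M) ->
  cvgn u /\ forall n, (N <= n)%N -> u n <= limn u.
Proof.
move=> ui uM; pose w n := u (n + N)%N.
have wi : nondecreasing_seq w.
  by apply/nondecreasing_seqP => n; rewrite /w addSn ui// leq_addl.
have wb : has_ubound (range w).
  by exists M => _ [n _ <-]; apply: uM; rewrite leq_addl.
have cw := nondecreasing_is_cvgn wi wb.
have uw : u @ \oo --> limn w by rewrite -(cvg_shiftn N).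
have E := cvg_lim (@Rhausdorff R) uw.
split=> [|n Nn]; first exact: cvgP uw.
rewrite E -(subnK Nn); exact: nondecreasing_cvgn_le.
Qed.

Lemma box_mono n m : (n <= m)%N -> box n `<=` box m.
Proof. by move=> nm; apply/fsubsetP => x; rewrite !in_box; lia. Qed.

Lemma box_large V : exists n, V `<=` box n.
Proof.
have [n h] : exists n, forall x, x \in V -> (absz x.1 + absz x.2 <= n)%N.
  exists (\max_(x <- V) (absz x.1 + absz x.2))%N => x xV.
  by rewrite (big_rem x)//= leq_maxl.
by exists n; apply/fsubsetP => x /h; rewrite in_box; lia.
Qed.

Lemma F_clean_limit beta x y N : 0 <= beta -> x \in box N -> y \in box N ->
  cvgn (fun n => clean_corr beta (box n) x y) /\
  forall n, (N <= n)%N -> clean_corr beta (box n) x y <= F_clean beta x y.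
Proof.
move=> b0 xN yN; have inb z n : z \in box N -> (N <= n)%N -> z \in box n.
  by move=> zN Nn; exact: (fsubsetP (box_mono Nn)).
apply: (@eventually_nondecreasing_cvg _ N 1) => n Nn.
  by apply: clean_corr_mono; rewrite ?box_mono// inb.
by apply: clean_corr_le1; exact: inb.
Qed.

(** With [F_clean_le], this makes the infinite-volume correlation a supremum
    over all finite volumes, so that the boxes can be replaced by volumes that are
    translated or symmetric under a reflection. *)
Lemma clean_corr_le_F beta V x y : 0 <= beta -> x \in V -> y \in V ->
  clean_corr beta V x y <= F_clean beta x y.
Proof.
move=> b0 xV yV; have [n Vn] := box_large V.
have xn := fsubsetP Vn _ xV; have yn := fsubsetP Vn _ yV.
apply: le_trans (clean_corr_mono b0 Vn xV yV) _.
by have [_] := F_clean_limit b0 xn yn; exact.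
Qed.

Lemma F_clean_le beta x y c : 0 <= beta ->
  (forall V, x \in V -> y \in V -> clean_corr beta V x y <= c) -> F_clean beta x y <= c.
Proof.
move=> b0 clc; have [N VN] := box_large [fset x; y].
have xN : x \in box N by apply: (fsubsetP VN); rewrite !inE eqxx.
have yN : y \in box N by apply: (fsubsetP VN); rewrite !inE eqxx orbT.
have [cv _] := F_clean_limit b0 xN yN.
apply: limr_le cv _; exists N => // n /= Nn.
by apply: clc; exact: (fsubsetP (box_mono Nn)).
Qed.

Lemma F_clean_ge0 beta x y : 0 <= beta -> 0 <= F_clean beta x y.
Proof.
move=> b0; apply: (@le_trans _ _ (clean_corr beta [fset x; y] x y)).
  by apply: clean_corr_ge0; rewrite // !inE eqxx ?orbT.
by apply: clean_corr_le_F; rewrite // !inE eqxx ?orbT.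
Qed.

Lemma F_clean_le1 beta x y : 0 <= beta -> F_clean beta x y <= 1.
Proof. by move=> b0; apply: F_clean_le => // V xV yV; exact: clean_corr_le1. Qed.

Lemma F_clean_automorphism beta (tau : Z2 -> Z2) x y : 0 <= beta -> injective tau ->
  (forall u v, adj (tau u) (tau v) = adj u v) ->
  F_clean beta x y <= F_clean beta (tau x) (tau y).
Proof.
move=> b0 it at_; apply: F_clean_le => // V xV yV.
rewrite -(clean_corr_automorphism beta it at_ xV yV); apply: clean_corr_le_F => //; exact: in_imfset.
Qed.

(** The volume [V] is enlarged to a symmetric one before reflecting. *)
Lemma F_clean_reflection beta (rho : Z2 -> Z2) (s : Z2 -> int) a x : 0 <= beta ->
  involutive rho -> (forall v, s (rho v) = - s v) ->
  (forall v, [|| s v == 1, s v == 0 | s v == -1]) ->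
  (forall v, s v = 0 -> rho v = v) ->
  (forall u v, adj (rho u) (rho v) = adj u v) ->
  (forall u v, s u * s v = -1 -> adj u v -> v = rho u) ->
  0 <= s a -> 0 <= s x ->
  F_clean beta a (rho x) <= F_clean beta a x.
Proof.
move=> b0 rK sr sv sf ra sc sa sx; apply: F_clean_le => // V aV xV.
pose V' := V `|` rho @` V.
have VV' : V `<=` V' by rewrite fsubsetUl.
have rV' : {in V', forall v, rho v \in V'}.
  move=> v; rewrite !inE => /orP[vV|/imfsetP[w /= wV ->]].
    by rewrite in_imfset ?orbT.
  by rewrite rK wV.
have aV' := fsubsetP VV' _ aV; have rxV' := fsubsetP VV' _ xV.
have xV' : x \in V' by rewrite -(rK x); exact: rV'.
apply: le_trans (clean_corr_mono b0 VV' aV xV) _.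
apply: le_trans (clean_corr_le_F b0 aV' xV').
by apply: (clean_corr_reflection b0 rK sr).
Qed.

Lemma F_clean_translation beta x y : 0 <= beta ->
  F_clean beta 0 (y - x) <= F_clean beta x y.
Proof.
move=> b0; have := @F_clean_automorphism beta (fun v => v + x) 0 (y - x) b0.
rewrite add0r subrK; apply; first exact: addIr.
by case: x => x1 x2 [a b] [c d]; rewrite /adj /=; lia.
Qed.

(** The line [2 x.1 = c] passes through sites or halfway between them
    according to the parity of [c]; an edge that crosses it joins a vertex to its
    mirror image. *)
Lemma F_clean_vertical beta c x : 0 <= beta -> 0 <= c -> 2 * x.1 <= c ->
  F_clean beta 0 (c - x.1, x.2) <= F_clean beta 0 x.
Proof.
move=> b0 c0 xc.
pose rho (v : Z2) : Z2 := (c - v.1, v.2).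
pose s (v : Z2) : int := if 2 * v.1 < c then 1 else if 2 * v.1 == c then 0 else -1.
rewrite -[(_, _)]/(rho x); apply: (@F_clean_reflection _ _ s) => //.
- by case=> a b; rewrite /rho /=; congr (_, _); lia.
- by case=> a b; rewrite /s /rho /=; do !case: ifP; lia.
- by case=> a b; rewrite /s; do !case: ifP.
- by case=> a b; rewrite /s /rho/= => h; congr (_, _); move: h; do !case: ifP; lia.
- by case=> a b [c' d]; rewrite /adj /rho/=; lia.
- case=> a b [c' d]; rewrite /adj /rho /s/= => h1 h2.
  by congr (_, _); move: h1 h2; do !case: ifP; lia.
- by rewrite /s /=; do !case: ifP; lia.
- by rewrite /s; do !case: ifP; lia.
Qed.

(** The line [x.1 - x.2 = c] is not crossed by any edge, as [x.1 - x.2] changes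
    by 1 along an edge. *)
Lemma F_clean_diagonal beta c x : 0 <= beta -> c <= 0 -> c <= x.1 - x.2 ->
  F_clean beta 0 (x.2 + c, x.1 - c) <= F_clean beta 0 x.
Proof.
move=> b0 c0 xc.
pose rho (v : Z2) : Z2 := (v.2 + c, v.1 - c).
pose s (v : Z2) : int := if c < v.1 - v.2 then 1 else if v.1 - v.2 == c then 0 else -1.
rewrite -[(_, _)]/(rho x); apply: (@F_clean_reflection _ _ s) => //.
- by case=> a b; rewrite /rho /=; congr (_, _); lia.
- by case=> a b; rewrite /s /rho /=; do !case: ifP; lia.
- by case=> a b; rewrite /s; do !case: ifP.
- by case=> a b; rewrite /s /rho/= => h; congr (_, _); move: h; do !case: ifP; lia.
- by case=> a b [c' d]; rewrite /adj /rho/=; lia.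
- case=> a b [c' d]; rewrite /adj /rho /s/= => h1 h2.
  by congr (_, _); move: h1 h2; do !case: ifP; lia.
- by rewrite /s /=; do !case: ifP; lia.
- by rewrite /s; do !case: ifP; lia.
Qed.

Lemma F_clean_quadrant beta x : 0 <= beta ->
  F_clean beta 0 (`|x.1|, `|x.2|) = F_clean beta 0 x.
Proof.
move=> b0.
pose s1 : int := if x.1 < 0 then -1 else 1; pose s2 : int := if x.2 < 0 then -1 else 1.
pose tau (v : Z2) : Z2 := (s1 * v.1, s2 * v.2).
have it : injective tau.
  case=> a b [c d] []; rewrite /s1 /s2; do 2 case: ifP => _; move=> h1 h2;
  by congr (_, _); lia.
have at_ u v : adj (tau u) (tau v) = adj u v.
  by rewrite /adj /tau /= /s1 /s2; do 2 case: ifP => _; lia.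
have t0 : tau 0 = 0 by rewrite /tau /= !mulr0.
have tx : tau x = (`|x.1|, `|x.2|).
  by rewrite /tau /s1 /s2; congr (_, _); case: ifP; lia.
have tx' : tau (`|x.1|, `|x.2|) = x.
  by rewrite [RHS]surjective_pairing /tau /s1 /s2 /=; congr (_, _); case: ifP; lia.
apply/eqP; rewrite eq_le; apply/andP; split.
  have := @F_clean_automorphism beta tau 0 (`|x.1|, `|x.2|) b0 it at_.
  by rewrite t0 tx'.
have := @F_clean_automorphism beta tau 0 x b0 it at_.
by rewrite t0 tx.
Qed.

Lemma F_clean_swap beta a b : 0 <= beta -> F_clean beta 0 (a, b) <= F_clean beta 0 (b, a).
Proof.
move=> b0; apply: (@F_clean_automorphism beta (fun v => (v.2, v.1)) 0 (a, b)) => //.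
  by case=> c d [c' d'] [] -> ->.
by move=> u v; rewrite /adj /= addrC.
Qed.

(** On the boundary of a square the corner is the least correlated point: a
    vertical reflection sends [(k, n)] to the corner [(n, n)]. *)
Lemma F_clean_corner_le beta n x : 0 <= beta -> Order.max `|x.1| `|x.2| = n ->
  F_clean beta 0 (n, n) <= F_clean beta 0 x.
Proof.
move=> b0 xn; rewrite -(F_clean_quadrant x b0).
wlog le12 : x xn / `|x.1| <= `|x.2| => [hw|].
  have [/hw->//|/ltW le21] := leP `|x.1| `|x.2|.
  apply: le_trans (F_clean_swap _ _ b0).
  by apply: (hw (x.2, x.1)) => //; rewrite maxC.
have {}xn : `|x.2| = n by rewrite -xn max_r.
rewrite xn; rewrite xn in le12.
have := @F_clean_vertical beta (n + `|x.1|) (`|x.1|, n) b0.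
by rewrite /= addrK; apply; lia.
Qed.

(** On the boundary of the circumscribed diamond the corner is the most correlated
    point: a diagonal reflection sends it to any point of the same side. *)
Lemma F_clean_corner_ge beta n x : 0 <= beta -> `|x.1| + `|x.2| = 2 * n ->
  F_clean beta 0 x <= F_clean beta 0 (n, n).
Proof.
move=> b0 xn; rewrite -(F_clean_quadrant x b0).
wlog le12 : x xn / `|x.1| <= `|x.2| => [hw|].
  have [/hw->//|/ltW le21] := leP `|x.1| `|x.2|.
  apply: le_trans (F_clean_swap _ _ b0) _.
  by apply: (hw (x.2, x.1)) => //; rewrite addrC.
have := @F_clean_diagonal beta (`|x.1| - n) (n, n) b0.
rewrite /= subrKC (_ : n - (`|x.1| - n) = `|x.2|); last by lia.
by apply; lia.
Qed.

End InfiniteVolume.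

(** * Decay below the critical point *)

Section Decay.
Context {R : realType}.
Implicit Types (V : {fset Z2}) (u v x y : Z2) (beta t : R).
Local Open Scope classical_set_scope.
Local Open Scope fset_scope.
Local Open Scope ring_scope.

Definition norm1 x : nat := (absz x.1 + absz x.2)%N.

Definition diamond N : {pred Z2} := [pred v | (norm1 v < N)%N].

(** One list of [N] points for each side of the diamond, so that the number
    [4 N] of points is immediate. *)
Definition sphere (N : nat) : seq Z2 :=
  [seq (i%:Z, N%:Z - i%:Z) | i <- iota 0 N] ++
  [seq (N%:Z - i%:Z, - i%:Z) | i <- iota 0 N] ++
  [seq (- i%:Z, i%:Z - N%:Z) | i <- iota 0 N] ++
  [seq (i%:Z - N%:Z, i%:Z) | i <- iota 0 N].

Lemma size_sphere N : size (sphere N) = (4 * N)%N.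
Proof. by rewrite !size_cat !size_map !size_iota; lia. Qed.

Lemma sphere_norm1 N v : v \in sphere N -> norm1 v = N.
Proof.
rewrite !mem_cat => /or4P[] /mapP[i]; rewrite mem_iota => /andP[_ iN] ->;
by rewrite /norm1 /=; lia.
Qed.

Lemma mem_sphere N v : (0 < N)%N -> norm1 v = N -> v \in sphere N.
Proof.
case: v => a b; rewrite /norm1 /= => N0 vN; rewrite !mem_cat.
have [a0|a0] := ltP a 0; have [b0|b0] := ltP b 0.
- apply/or4P; apply: Or43; apply/mapP; exists (absz a); first by rewrite mem_iota; lia.
  by congr (_, _); lia.
- have [b00|b00] := eqVneq b 0.
    apply/or4P; apply: Or44; apply/mapP; exists 0%N; first by rewrite mem_iota; lia.
    by congr (_, _); lia.
  apply/or4P; apply: Or44; apply/mapP; exists (absz b); first by rewrite mem_iota; lia.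
  by congr (_, _); lia.
- have [a00|a00] := eqVneq a 0.
    apply/or4P; apply: Or43; apply/mapP; exists 0%N; first by rewrite mem_iota; lia.
    by congr (_, _); lia.
  apply/or4P; apply: Or42; apply/mapP; exists (absz b); first by rewrite mem_iota; lia.
  by congr (_, _); lia.
- have [b00|b00] := eqVneq b 0.
    apply/or4P; apply: Or42; apply/mapP; exists 0%N; first by rewrite mem_iota; lia.
    by congr (_, _); lia.
  apply/or4P; apply: Or41; apply/mapP; exists (absz a); first by rewrite mem_iota; lia.
  by congr (_, _); lia.
Qed.

Definition inside N (e : Z2 * Z2) : R := ((e.1 \in diamond N) || (e.2 \in diamond N))%:R.

Definition sphere_corr N beta b : R :=
  corr (box N) (nn_edges (box N)) (fun e => beta * inside N e) 0 b.

(** A finite-volume quantity, hence continuous in the coupling, whereas a limit of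
    increasing volumes is a priori only lower semicontinuous; this is what makes
    the critical point itself accessible. *)
Definition sphere_sum N beta : R := \sum_(b <- sphere N) sphere_corr N beta b.

Lemma norm1_in_box N b : (norm1 b <= N)%N -> b \in box N.
Proof. by rewrite in_box /norm1; lia. Qed.

Lemma sphere_in_box N b : norm1 b = N -> b \in box N.
Proof. by move=> bN; rewrite norm1_in_box ?bN. Qed.

Lemma zero_in_box N : 0 \in box N.
Proof. by rewrite in_box. Qed.

Lemma norm1_step u v : step u v -> (norm1 u <= (norm1 v).+1)%N && (norm1 v <= (norm1 u).+1)%N.
Proof. by rewrite stepE /norm1; lia. Qed.

Lemma inside_ge0 N e : 0 <= inside N e.
Proof. by rewrite ler0n. Qed.

Lemma sphere_corr_ge0 N beta b : 0 <= beta -> b \in sphere N -> 0 <= sphere_corr N beta b.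
Proof.
move=> b0 /sphere_norm1 /sphere_in_box bN; apply: corr_ge0 => //.
- exact: nn_edges_in.
- by move=> e _; rewrite mulr_ge0 ?inside_ge0.
- exact: zero_in_box.
Qed.

Lemma sphere_corr_le_F N beta b : 0 <= beta -> b \in sphere N ->
  sphere_corr N beta b <= F_clean beta 0 b.
Proof.
move=> b0 /sphere_norm1 /sphere_in_box bN.
apply: le_trans (clean_corr_le_F b0 (zero_in_box N) bN).
apply: corr_coupling_mono => //; [exact: nn_edges_in| |exact: zero_in_box].
move=> e _; rewrite mulr_ge0 ?inside_ge0//= ler_piMr// /inside.
by case: (_ || _).
Qed.

Lemma sphere_sum_continuous N : continuous (sphere_sum N).
Proof.
move=> t; rewrite /sphere_sum.
have h b : b \in sphere N -> {for t, continuous (fun s => sphere_corr N s b)}.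
  move=> /sphere_norm1 /sphere_in_box bN.
  apply: (@corr_continuous R _ (box N) (nn_edges (box N)) (inside N) 0 b) => //.
  - exact: nn_edges_in.
  - exact: zero_in_box.
elim: (sphere N) h => [|b r IH] h.
  rewrite (_ : (fun s => _) = fun=> 0); first exact: cst_continuous.
  by apply: funext => s; rewrite big_nil.
rewrite (_ : (fun s => _) = fun s => sphere_corr N s b + \sum_(b <- r) sphere_corr N s b); last first.
  by apply: funext => s; rewrite big_cons.
have c1 := h b (mem_head _ _).
have c2 : {for t, continuous (fun s => \sum_(b <- r) sphere_corr N s b)}.
  by apply: IH => b' b'r; apply: h; rewrite inE b'r orbT.
exact: continuousD c1 c2.
Qed.

(** Every path from the origin to [x] visits the sphere, so [corr_separation]
    applies with the open diamond as inner region. The inner factors do not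
    depend on the volume. *)
Lemma F_clean_separation N beta x : 0 <= beta -> (0 < N)%N -> (N <= norm1 x)%N ->
  F_clean beta 0 x <= \sum_(b <- sphere N) sphere_corr N beta b * F_clean beta b x.
Proof.
move=> b0 N0 Nx; apply: F_clean_le => // V zV xV.
pose V' := V `|` box N.
have VV' : V `<=` V' by rewrite fsubsetUl.
have BV' : box N `<=` V' by rewrite fsubsetUr.
apply: le_trans (clean_corr_mono b0 VV' zV xV) _.
have zV' := fsubsetP VV' _ zV; have xV' := fsubsetP VV' _ xV.
have sV' b : b \in sphere N -> b \in V'.
  by move=> /sphere_norm1 /sphere_in_box; exact: (fsubsetP BV').
have := @corr_separation R _ V' (nn_edges V') (fun=> beta) (diamond N) (sphere N) 0 x.
move=> /(_ (@nn_edges_in V')) h.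
apply: le_trans (h _ _ _ _ _ _ _ _) _ => //.
- by move=> b /sphere_norm1 bN; rewrite inE bN ltnn.
- move=> e; rewrite in_nn_edges => /and3P[_ _ /norm1_step /andP[e1 e2]].
  rewrite !inE; split=> h1; case: ltnP => //= h2; apply: mem_sphere => //; apply/eqP;
  rewrite eqn_leq h2 andbT.
    exact: leq_trans e2 h1.
  exact: leq_trans e1 h1.
- by rewrite inE -leqNgt.
rewrite big_seq [leRHS]big_seq; apply: ler_sum => b bS.
have bB := sphere_in_box (sphere_norm1 bS).
rewrite (_ : corr V' _ _ 0 b = sphere_corr N beta b); last first.
  apply: (@corr_relabel R _ (box N) V' _ _ _ _ id) => //.
  - exact: nn_edges_in.
  - by move=> v; exact: (fsubsetP BV').
  - move=> th; rewrite /energy.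
    have sub : nn_edges (box N) `<=` nn_edges V' by exact: nn_edges_mono.
    rewrite (bigID (mem (nn_edges (box N))))/= [X in _ + X]big1_seq ?addr0; last first.
      move=> e /andP[eN]; rewrite in_nn_edges => /and3P[_ _ se].
      rewrite (_ : _ || _ = false) ?mulr0 ?mul0r//; apply: contraNF eN => eA.
      suff : e \in nn_edges (box N) by [].
      rewrite in_nn_edges se andbT; move: eA (norm1_step se); rewrite 2!inE.
      move: (norm1_in_box (N := N) (b := e.1)) (norm1_in_box (N := N) (b := e.2)).
      move=> h1 h2 eA /andP[le12 le21].
      have l1 : (norm1 e.1 <= N)%N.
        by case/orP: eA => [/ltnW//|eA]; exact: leq_trans le12 eA.
      have l2 : (norm1 e.2 <= N)%N.
        by case/orP: eA => [eA|/ltnW//]; exact: leq_trans le21 eA.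
      by rewrite h1// h2.
    rewrite -big_filter; apply: perm_big; apply: uniq_perm.
    - exact/filter_uniq/fset_uniq.
    - exact: fset_uniq.
    - by move=> e; rewrite mem_filter; apply: andb_idr => eE; exact: (fsubsetP sub).
  - exact: zero_in_box.
rewrite ler_wpM2l ?sphere_corr_ge0//.
by apply: clean_corr_le_F => //; exact: sV'.
Qed.

Lemma norm1_triangle x b : (norm1 x <= norm1 b + norm1 (x - b)%R)%N.
Proof. by case: x b => [a c] [d e]; rewrite /norm1 /=; lia. Qed.

Lemma norm_eucl_le x : norm_eucl x <= (norm1 x)%:R :> R.
Proof.
rewrite /norm_eucl -[leRHS]ger0_norm// -sqrtr_sqr ler_sqrt ?sqr_ge0//.
rewrite /norm1 natrD sqrrD !natr_absz !intr_norm !real_normK ?num_real// addrAC lerDl.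
by rewrite mulrn_wge0// mulr_ge0.
Qed.

(** The separation inequality is iterated from sphere to sphere. *)
Lemma sphere_decay N beta q : 0 <= beta -> (0 < N)%N -> 0 <= q -> sphere_sum N beta <= q ->
  forall k x, (k * N <= norm1 x)%N -> F_clean beta 0 x <= q ^+ k.
Proof.
move=> b0 N0 q0 Sq; elim=> [|k IH] x kx; first by rewrite expr0 F_clean_le1.
have Nx : (N <= norm1 x)%N by apply: leq_trans kx; rewrite mulSn leq_addr.
apply: le_trans (F_clean_separation b0 N0 Nx) _.
apply: (@le_trans _ _ (sphere_sum N beta * q ^+ k)); last first.
  by rewrite exprS ler_wpM2r// exprn_ge0.
rewrite /sphere_sum mulr_suml big_seq [leRHS]big_seq; apply: ler_sum => b bS.
rewrite ler_wpM2l ?sphere_corr_ge0//.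
have -> : F_clean beta b x = F_clean beta 0 (x - b).
  apply/eqP; rewrite eq_le F_clean_translation// andbT.
  have := @F_clean_automorphism R beta (fun v => v - b) b x b0.
  rewrite subrr; apply; first exact: addIr.
  by case: b {bS} => b1 b2 [a c] [d e]; rewrite /adj /=; lia.
apply: IH; have := norm1_triangle x b; rewrite (sphere_norm1 bS).
by rewrite mulSn in kx => h; lia.
Qed.

(** The maximum with one half avoids a zero rate of contraction, which has no
    logarithm. *)
Lemma sphere_sum_exp_decay N beta : 0 <= beta -> (0 < N)%N -> sphere_sum N beta < 1 ->
  exp_decay (@F_clean R beta 0).
Proof.
move=> b0 N0 S1; pose q := Order.max (sphere_sum N beta) 2^-1.
have q0 : 0 < q by rewrite lt_max invr_gt0 ltr0n orbT.
have q1 : q < 1 by rewrite gt_max S1 invf_lt1// ltr1n.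
have Sq : sphere_sum N beta <= q by rewrite le_max lexx.
have NR : 0 < N%:R :> R by rewrite ltr0n.
pose m := - ln q / N%:R.
have m0 : 0 < m by rewrite divr_gt0// oppr_gt0 ln_lt0// q0.
exists (expR (m * N%:R)), m; split=> // x.
rewrite ger0_norm ?F_clean_ge0// -expRD.
have := @sphere_decay N beta q b0 N0 (ltW q0) Sq (norm1 x %/ N) x (leq_trunc_div _ _).
move=> /le_trans; apply.
rewrite -(lnK q0) -expRM_natl ler_expR.
have -> : ln q = - (m * N%:R) by rewrite /m divfK ?gt_eqF// opprK.
have h1 := norm_eucl_le x.
have h2 : (norm1 x)%:R <= (norm1 x %/ N)%:R * N%:R + N%:R :> R.
  by rewrite -natrM -natrD ler_nat {1}(divn_eq (norm1 x) N) leq_add2l ltnW// ltn_pmod.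
nra.
Qed.

Lemma sphere_sum0 N : (0 < N)%N -> sphere_sum N 0 = 0.
Proof.
move=> N0; rewrite /sphere_sum big_seq big1// => b bS.
have bB := sphere_in_box (sphere_norm1 bS).
rewrite /sphere_corr (corr_expect _ _ [` zero_in_box N] [` bB]) /expect.
rewrite (_ : haar _ = 0) ?mul0r//.
have nb : [` zero_in_box N] != [` bB].
  apply/negP => /eqP /(congr1 val) /= b0; have := sphere_norm1 bS.
  by rewrite -b0 /norm1/=; lia.
transitivity (haar (fun th : box N -> R => cos (dot (edge_charge ([` zero_in_box N], [` bB])) th))).
  apply: eq_haar => th; rewrite dot_edge /energy big1 ?expR0 ?mulr1// => e _.
  by rewrite !mul0r.
rewrite haar_cosine; case: eqP => // /ffunP /(_ [` bB]).
by rewrite !ffunE eqxx eq_sym (negbTE nb).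
Qed.

Lemma beta_BKT_ge0 : (0%:E <= @beta_BKT R)%E.
Proof.
apply: ereal_sup_ubound; exists 0 => //; split=> //.
by apply: (@sphere_sum_exp_decay 1) => //; rewrite sphere_sum0.
Qed.

(** A contracting sphere would still contract at a slightly larger coupling, by
    continuity, and correlations would decay exponentially beyond the critical
    point. *)
Lemma sphere_sum_ge1 N beta : (0 < N)%N -> (beta_BKT <= beta%:E)%E -> 1 <= sphere_sum N beta.
Proof.
move=> N0 bb; rewrite leNgt; apply/negP => S1.
have b0 : 0 <= beta by rewrite -lee_fin (le_trans beta_BKT_ge0).
have /cvgr_lt /(_ _ S1) := @sphere_sum_continuous N beta.
move=> /nbhs_ballP[e /= e0 eS].
have bt : beta < beta + e / 2 by rewrite ltrDl divr_gt0.
have St : sphere_sum N (beta + e / 2) < 1.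
  apply: eS; rewrite /ball/= opprD addrA subrr sub0r normrN gtr0_norm ?divr_gt0//.
  by rewrite ltr_pdivrMr// ltr_pMr// ltr1n.
have t0 := le_trans b0 (ltW bt).
have : ((beta + e / 2)%:E <= @beta_BKT R)%E.
  apply: ereal_sup_ubound; exists (beta + e / 2) => //; split=> //.
  exact: sphere_sum_exp_decay St.
by move=> /le_trans /(_ bb); rewrite lee_fin leNgt bt.
Qed.

(** The diamond of radius [2 n] has [8 n] points on its boundary and its sum is
    at least 1; none of its points is more correlated with the origin than the
    corner [(n, n)], nor is this corner more than any point of sup norm [n]. *)
Lemma F_clean_lower beta x : (beta_BKT <= beta%:E)%E -> x != 0 ->
  1 / (8 * norm_sup x) <= F_clean beta 0 x.
Proof.
move=> bb x0.
have b0 : 0 <= beta by rewrite -lee_fin (le_trans beta_BKT_ge0).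
pose n := maxn (absz x.1) (absz x.2).
have nE : Order.max `|x.1| `|x.2| = n%:Z by rewrite /n; lia.
have n0 : (0 < n)%N.
  by move: x0; rewrite /n; case: (x) => a b; rewrite xpair_eqE /=; lia.
have N0 : (0 < 2 * n)%N by rewrite muln_gt0.
have S1 := sphere_sum_ge1 N0 bb.
rewrite /norm_sup nE -pmulrn.
apply: le_trans (F_clean_corner_le b0 nE).
have nR : 0 < n%:R :> R by rewrite ltr0n.
rewrite ler_pdivrMr ?mulr_gt0// mulrC; apply: le_trans S1 _.
apply: (@le_trans _ _ (\sum_(b <- sphere (2 * n)) F_clean beta 0 (n%:Z, n%:Z))).
  rewrite /sphere_sum big_seq [leRHS]big_seq; apply: ler_sum => b bS.
  apply: le_trans (sphere_corr_le_F b0 bS) _.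
  by apply: F_clean_corner_ge => //; have := sphere_norm1 bS; rewrite /norm1; lia.
rewrite big_const_seq count_predT size_sphere iter_addr_0.
rewrite [leLHS](_ : _ = 8 * n%:R * F_clean beta 0 (n%:Z, n%:Z))//.
by rewrite -[LHS]mulr_natl !natrM; ring.
Qed.

Lemma F_clean_lower_pair beta x y : (beta_BKT <= beta%:E)%E -> x != y ->
  1 / (8 * norm_sup (x - y)) <= F_clean beta x y.
Proof.
move=> bb xy; have b0 : 0 <= beta by rewrite -lee_fin (le_trans beta_BKT_ge0).
apply: le_trans (F_clean_translation x y b0).
have -> : norm_sup (x - y) = norm_sup (y - x) :> R.
  by case: x y {xy} => [a b] [c d]; rewrite /norm_sup /= -[a - c]opprB -[b - d]opprB !normrN.
by apply: F_clean_lower => //; rewrite subr_eq0 eq_sym.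
Qed.

End Decay.

(** * Dilution *)

Section BernoulliMean.
Context {R : realType} {K : choiceType}.
Implicit Types (S A : {fset K}) (p : R) (x : K).
Local Open Scope fset_scope.
Local Open Scope ring_scope.

Lemma bernoulli_mean0 p (f : {fset K} -> R) : bernoulli_mean p fset0 f = f fset0.
Proof.
rewrite /bernoulli_mean fpowerset0 big_seq_fset1.
by rewrite fsetDv cardfs0 !expr0 !mul1r.
Qed.

Lemma bernoulli_mean_insert p x S (f : {fset K} -> R) : x \notin S ->
  bernoulli_mean p (x |` S) f =
  (1 - p) * bernoulli_mean p S f + p * bernoulli_mean p S (fun A => f (x |` A)).
Proof.
move=> xS; rewrite /bernoulli_mean.
have notin A : A \in fpowerset S -> x \notin A.
  by rewrite fpowersetE => /fsubsetP AS; apply: contra xS => /AS.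
have Pm : perm_eq (fpowerset (x |` S))
    (fpowerset S ++ [seq x |` A | A <- fpowerset S]).
  apply: uniq_perm; first exact: fset_uniq.
    rewrite cat_uniq fset_uniq map_inj_in_uniq ?fset_uniq ?andbT/=.
      apply/hasPn => _ /mapP[A _ ->] /=; apply/negP => /notin.
      by rewrite !inE eqxx.
    move=> A A' /notin xA /notin xA' e.
    by rewrite -(fsetU1K xA) e fsetU1K.
  move=> A; rewrite mem_cat fpowersetE; apply/idP/orP.
    move=> AS; have [xA|xA] := boolP (x \in A).
      right; apply/mapP; exists (A `\ x); last by rewrite fsetD1K.
      by rewrite fpowersetE fsubDset.
    left; rewrite fpowersetE; apply/fsubsetP => y yA.
    have /fsubsetP /(_ _ yA) := AS; rewrite !inE => /orP[/eqP yx|//].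
    by move: xA; rewrite -yx yA.
  case=> [|/mapP[A' + ->]]; rewrite fpowersetE.
    by move=> AS; apply: fsubset_trans AS _; exact: fsubsetUr.
  by move=> AS; exact: fsetUS.
rewrite (perm_big _ Pm)/= big_cat big_map/=; congr (_ + _); rewrite mulr_sumr;
  apply: eq_big_seq => A AS; have xA := notin _ AS.
  have -> : (x |` S) `\` A = x |` (S `\` A).
    by apply/fsetP => y; rewrite !inE; case: eqP => // ->; rewrite xA.
  rewrite cardfsU1 !inE negb_and negbK xS orbT exprS; ring.
have -> : (x |` S) `\` (x |` A) = S `\` A.
  by apply/fsetP => y; rewrite !inE negb_or; case: eqP => // ->; rewrite (negbTE xS) andbF.
rewrite cardfsU1 xA exprS; ring.
Qed.

Lemma eq_bernoulli_mean p S (f g : {fset K} -> R) :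
  (forall A, A `<=` S -> f A = g A) -> bernoulli_mean p S f = bernoulli_mean p S g.
Proof. by move=> fg; apply: eq_big_seq => A; rewrite fpowersetE => /fg ->. Qed.

Lemma le_bernoulli_mean p S (f g : {fset K} -> R) : 0 <= p <= 1 ->
  (forall A, A `<=` S -> f A <= g A) -> bernoulli_mean p S f <= bernoulli_mean p S g.
Proof.
move=> /andP[p0 p1] fg; rewrite /bernoulli_mean big_seq [leRHS]big_seq.
apply: ler_sum => A; rewrite fpowersetE => /fg h.
by rewrite ler_wpM2l// mulr_ge0// exprn_ge0// subr_ge0.
Qed.

Lemma bernoulli_mean_cst p S (c : R) : bernoulli_mean p S (fun=> c) = c.
Proof.
elim/fset1U_rect: S => [|x S xS IH]; first by rewrite bernoulli_mean0.
by rewrite bernoulli_mean_insert// IH; ring.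
Qed.

Lemma bernoulli_mean_union p S S' (f : {fset K} -> R) : [disjoint S & S']%fset ->
  bernoulli_mean p (S `|` S') f =
  bernoulli_mean p S (fun A => bernoulli_mean p S' (fun A' => f (A `|` A'))).
Proof.
elim/fset1U_rect: S f => [|x S xS IH] f dS.
  rewrite fset0U bernoulli_mean0; apply: eq_bernoulli_mean => A _.
  by rewrite fset0U.
move: dS; rewrite fdisjointU1X => /andP[xS' dS].
rewrite -fsetUA bernoulli_mean_insert; last by rewrite inE negb_or xS.
rewrite bernoulli_mean_insert// !IH//; congr (_ + _ * _).
apply: eq_bernoulli_mean => A _; apply: eq_bernoulli_mean => A' _.
by rewrite fsetUA.
Qed.

(** The elements of [S] are averaged one after the other, the values of those
    already treated being deterministic. *)
Lemma bernoulli_mean_replace p S (f : (K -> R) -> R) (hi mid : R) (a0 : K -> R) :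
  0 <= p <= 1 -> 0 <= hi -> 0 <= mid ->
  (forall (a : K -> R) x, (forall y, 0 <= a y) -> x \in S ->
    f (upd a x mid) <= (1 - p) * f (upd a x 0) + p * f (upd a x hi)) ->
  (forall y, 0 <= a0 y) ->
  f (fun y => if y \in S then mid else a0 y) <=
  bernoulli_mean p S (fun A => f (fun y => if y \in S then hi * (y \in A)%:R else a0 y)).
Proof.
move=> p01 h0 m0; elim/fset1U_rect: S a0 => [|x S xS IH] a0 hf a00.
  by rewrite bernoulli_mean0.
have hS a z : (forall y, 0 <= a y) -> z \in S ->
    f (upd a z mid) <= (1 - p) * f (upd a z 0) + p * f (upd a z hi).
  by move=> a_0 zS; apply: hf => //; rewrite !inE zS orbT.
have a0t t : 0 <= t -> forall y, 0 <= upd a0 x t y.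
  by move=> t0 y; rewrite updE; case: ifP.
pose a y := if y \in S then mid else a0 y.
have a_0 y : 0 <= a y by rewrite /a; case: ifP.
have aE t : upd a x t = fun y => if y \in S then mid else upd a0 x t y.
  apply: funext => y; rewrite !updE /a; case: eqP => // ->.
  by rewrite (negbTE xS).
rewrite (_ : (fun y => _) = upd a x mid); last first.
  by apply: funext => y; rewrite updE /a !inE; case: eqP.
apply: le_trans (hf a x a_0 _) _; first by rewrite !inE eqxx.
rewrite bernoulli_mean_insert//; case/andP: p01 => p0 p1.
apply: lerD; apply: ler_wpM2l; rewrite ?subr_ge0//.
  rewrite aE; apply: le_trans (IH _ hS (a0t _ (lexx _))) _.
  rewrite le_eqVlt; apply/orP; left; apply/eqP/eq_bernoulli_mean => A AS; congr f.
  apply: funext => y; rewrite updE !inE; case: eqP => //= ->; rewrite (negbTE xS).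
  have /negbTE -> : x \notin A by apply: contra xS; exact: (fsubsetP AS).
  by rewrite mulr0.
rewrite aE; apply: le_trans (IH _ hS (a0t _ h0)) _.
rewrite le_eqVlt; apply/orP; left; apply/eqP/eq_bernoulli_mean => A AS; congr f.
apply: funext => y; rewrite updE !inE; case: eqP => //= ->; rewrite (negbTE xS).
by rewrite mulr1.
Qed.

End BernoulliMean.

Section Comparison.
Context {R : realType}.
Implicit Types (p beta : R) (x y : Z2) (V : {fset Z2}).
Local Open Scope fset_scope.
Local Open Scope ring_scope.

Lemma effective_coupling (k p beta : R) : 0 < k -> 0 <= p <= 1 -> 0 <= beta ->
  exists beta', [/\ 0 <= beta', beta' <= beta &
    1 - expR (- (2 * k * beta')) = p * (1 - expR (- (2 * k * beta)))].
Proof.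
move=> k0 /andP[p0 p1] b0; set w := expR (- (2 * k * beta)).
have w0 : 0 < w by exact: expR_gt0.
have w1 : w <= 1 by rewrite -expR0 ler_expR oppr_le0 !mulr_ge0// ltW.
have k2 : 0 < 2 * k by rewrite mulr_gt0.
have q0 : w <= 1 - p * (1 - w).
  by rewrite -subr_ge0 (_ : _ - w = (1 - p) * (1 - w)); [rewrite mulr_ge0// subr_ge0|ring].
have q1 : 1 - p * (1 - w) <= 1 by rewrite gerBl mulr_ge0// subr_ge0.
have qp := lt_le_trans w0 q0.
have E : expR (- (2 * k * (- ln (1 - p * (1 - w)) / (2 * k)))) = 1 - p * (1 - w).
  by rewrite mulrC divfK ?gt_eqF// opprK lnK.
exists (- ln (1 - p * (1 - w)) / (2 * k)); split.
- by rewrite divr_ge0 ?(ltW k2)// oppr_ge0 ln_le0.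
- have : w <= expR (- (2 * k * (- ln (1 - p * (1 - w)) / (2 * k)))) by rewrite E.
  by rewrite ler_expR lerN2 ler_pM2l.
- by rewrite E opprB addrC subrK.
Qed.

Lemma bond_comparison V p beta beta' x y : 0 <= p <= 1 -> 0 <= beta' -> beta' <= beta ->
  1 - expR (- (2 * 1 * beta')) = p * (1 - expR (- (2 * 1 * beta))) ->
  x \in V -> y \in V ->
  clean_corr beta' V x y <= bernoulli_mean p (nn_edges V) (fun A =>
      corr V (nn_edges V) (fun e => beta * (e \in A)%:R) x y).
Proof.
move=> p01 b'0 b'b hb xV yV; have EV := @nn_edges_in V.
have b0 := le_trans b'0 b'b; case/andP: (p01) => p0 p1.
pose f (a : Z2 * Z2 -> R) := corr V (nn_edges V) a x y.
have := @bernoulli_mean_replace R _ p (nn_edges V) f beta beta' (fun=> 0) p01 b0 b'0.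
have -> : f (fun e => if e \in nn_edges V then beta' else 0) = clean_corr beta' V x y.
  by apply: eq_corr => e ->.
have -> : bernoulli_mean p (nn_edges V) (fun A => f (fun e =>
    if e \in nn_edges V then beta * (e \in A)%:R else 0)) =
    bernoulli_mean p (nn_edges V) (fun A =>
      corr V (nn_edges V) (fun e => beta * (e \in A)%:R) x y).
  by apply: eq_bernoulli_mean => A _; apply: eq_corr => e ->.
apply=> // a e a0 eE.
have fE t : f (upd a e t) = corr V (nn_edges V) (fun e' => upd a e 0 e' + t * (e' == e)%:R) x y.
  apply: eq_corr => e' _; rewrite !updE; case: eqP => _; first by rewrite mulr1 add0r.
  by rewrite mulr0 addr0.
have f0 : f (upd a e 0) = corr V (nn_edges V) (upd a e 0) x y by [].
rewrite f0 !fE.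
apply: (@corr_chord R _ V (nn_edges V) (upd a e 0) (fun e' => (e' == e)%:R) 1) => //.
- by move=> e' _; rewrite updE; case: ifP.
- rewrite (big_rem e)//= eqxx big1_seq ?addr0// => e' /andP[_].
  by rewrite mem_rem_uniq ?fset_uniq// inE => /andP[/negbTE -> _].
Qed.

(** Every edge joins an even to an odd vertex, so that in the site model
    each coupling depends on a single random variable once the variables of the
    other sublattice are fixed. *)
Definition even_vertex x : bool := ~~ odd (absz (x.1 + x.2)).

Definition even_end (e : Z2 * Z2) := if even_vertex e.1 then e.1 else e.2.
Definition odd_end (e : Z2 * Z2) := if even_vertex e.1 then e.2 else e.1.

Lemma step_parity u v : step u v -> even_vertex v = ~~ even_vertex u.
Proof. by rewrite stepE /even_vertex; lia. Qed.

Lemma even_endP V e : e \in nn_edges V -> even_vertex (even_end e).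
Proof.
rewrite in_nn_edges => /and3P[_ _ /step_parity h]; rewrite /even_end.
by case: ifP => // /negbT; rewrite -h.
Qed.

Lemma odd_endP V e : e \in nn_edges V -> ~~ even_vertex (odd_end e).
Proof.
rewrite in_nn_edges => /and3P[_ _ /step_parity h]; rewrite /odd_end.
by case: ifP => [h'|/negbT//]; rewrite h h'.
Qed.

Lemma even_end_in V e : e \in nn_edges V -> even_end e \in V.
Proof. by rewrite in_nn_edges /even_end => /and3P[e1 e2 _]; case: ifP. Qed.

Lemma odd_end_in V e : e \in nn_edges V -> odd_end e \in V.
Proof. by rewrite in_nn_edges /odd_end => /and3P[e1 e2 _]; case: ifP. Qed.

(** The weights [g] leave room for random variables at the neighbours. *)
Lemma degree_le4 V x (g : Z2 * Z2 -> R) (q : pred (Z2 * Z2)) :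
  (forall e, 0 <= g e <= 1) -> (forall e, q e -> (e.1 == x) || (e.2 == x)) ->
  \sum_(e <- nn_edges V) (q e)%:R * g e <= 4.
Proof.
move=> g01 qx.
have le1 : \sum_(e <- nn_edges V) (q e)%:R * g e <= (count q (nn_edges V))%:R.
  rewrite -sum1_count natr_sum [leRHS]big_mkcond/=; apply: ler_sum => e _.
  have /andP[g0 g1] := g01 e.
  by case: (q e); rewrite ?mul1r// mul0r.
apply: le_trans le1 _; rewrite ler_nat -size_filter.
pose nb := [:: (x, x + (1, 0)); (x, x + (0, 1)); (x - (1, 0), x); (x - (0, 1), x)].
apply: (@uniq_leq_size _ _ nb); first exact/filter_uniq/fset_uniq.
move=> [u v]; rewrite mem_filter in_nn_edges /= => /andP[/qx /= ux /and3P[_ _]].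
rewrite /step !inE => /orP[] /eqP vE; move: ux; rewrite {}vE => /orP[/eqP ->|/eqP <-];
by rewrite ?addrK ?eqxx ?orbT.
Qed.

(** Two rounds of replacement: the even variables first, for fixed odd
    ones, which turns [beta] into [beta1], then the odd ones. Each round costs a
    factor [p], and changing one variable varies at most 4 couplings. *)
Lemma site_comparison V p beta beta1 beta' x y : 0 <= p <= 1 -> 0 <= beta' ->
  beta' <= beta1 -> beta1 <= beta ->
  1 - expR (- (2 * 4 * beta1)) = p * (1 - expR (- (2 * 4 * beta))) ->
  1 - expR (- (2 * 4 * beta')) = p * (1 - expR (- (2 * 4 * beta1))) ->
  x \in V -> y \in V ->
  clean_corr beta' V x y <= bernoulli_mean p V (fun A =>
      corr V (nn_edges V) (fun e => beta * (e.1 \in A)%:R * (e.2 \in A)%:R) x y).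
Proof.
move=> p01 b'0 b'b1 b1b hb1 hb' xV yV; have EV := @nn_edges_in V.
have b10 := le_trans b'0 b'b1; have b0 := le_trans b10 b1b; case/andP: (p01) => p0 p1.
pose S1 := [fset v in V | even_vertex v]; pose S2 := [fset v in V | ~~ even_vertex v].
have VE : V = S2 `|` S1.
  by apply/fsetP => v; rewrite !inE /=; case: (v \in V); case: (even_vertex v).
have dS : [disjoint S2 & S1]%fset.
  apply/fdisjointP => v; rewrite !inE /= => /andP[_ ov].
  by rewrite negb_and ov orbT.
have J0 (A : {fset Z2}) (a : Z2 -> R) : (forall v, 0 <= a v) ->
    {in nn_edges V, forall e, 0 <= a (even_end e) * (odd_end e \in A)%:R}.
  by move=> a0 e _; rewrite mulr_ge0.
pose g (A2 : {fset Z2}) := corr V (nn_edges V) (fun e => beta1 * (odd_end e \in A2)%:R) x y.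
have inner A2 : g A2 <= bernoulli_mean p S1 (fun A1 =>
    corr V (nn_edges V) (fun e => beta * (even_end e \in A1)%:R * (odd_end e \in A2)%:R) x y).
  pose f (a : Z2 -> R) := corr V (nn_edges V) (fun e => a (even_end e) * (odd_end e \in A2)%:R) x y.
  have := @bernoulli_mean_replace R _ p S1 f beta beta1 (fun=> 0) p01 b0 b10.
  have eS1 e : e \in nn_edges V -> even_end e \in S1.
    by move=> eE; rewrite !inE /= (even_end_in eE) (even_endP eE).
  have -> : f (fun v => if v \in S1 then beta1 else 0) = g A2.
    by apply: eq_corr => e /eS1 ->.
  rewrite (eq_bernoulli_mean p (g := fun A1 => corr V (nn_edges V)
     (fun e => beta * (even_end e \in A1)%:R * (odd_end e \in A2)%:R) x y)); last first.
    by move=> A _; apply: eq_corr => e /eS1 ->.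
  apply=> // a v a0 vS.
  pose J1 (e : Z2 * Z2) : R := (even_end e == v)%:R * (odd_end e \in A2)%:R.
  pose J (e : Z2 * Z2) : R := upd a v 0 (even_end e) * (odd_end e \in A2)%:R.
  have fE t : f (upd a v t) = corr V (nn_edges V) (fun e => J e + t * J1 e) x y.
    apply: eq_corr => e _; rewrite /J /J1 !updE; case: eqP => _.
      by rewrite ?mul0r add0r mul1r ?mulr1.
    by rewrite mul0r mulr0 addr0.
  have f0 : f (upd a v 0) = corr V (nn_edges V) J x y by [].
  rewrite f0 !fE; apply: (@corr_chord R _ V (nn_edges V) J J1 4) => //.
  - by move=> e _; rewrite mulr_ge0// updE; case: ifP.
  - by move=> e _; rewrite mulr_ge0.
  - apply: (@degree_le4 V v) => e; first by case: (_ \in _); rewrite lexx ler01.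
    by rewrite /even_end; case: ifP => _ /eqP ->; rewrite eqxx ?orbT.
have outer : clean_corr beta' V x y <= bernoulli_mean p S2 g.
  pose f (a : Z2 -> R) := corr V (nn_edges V) (fun e => a (odd_end e)) x y.
  have := @bernoulli_mean_replace R _ p S2 f beta1 beta' (fun=> 0) p01 b10 b'0.
  have eS2 e : e \in nn_edges V -> odd_end e \in S2.
    by move=> eE; rewrite !inE /= (odd_end_in eE) (odd_endP eE).
  have -> : f (fun v => if v \in S2 then beta' else 0) = clean_corr beta' V x y.
    by apply: eq_corr => e /eS2 ->.
  rewrite (eq_bernoulli_mean p (g := g)); last first.
    by move=> A _; apply: eq_corr => e /eS2 ->.
  apply=> // a v a0 vS.
  pose J1 (e : Z2 * Z2) : R := (odd_end e == v)%:R * 1.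
  pose J (e : Z2 * Z2) : R := upd a v 0 (odd_end e).
  have fE t : f (upd a v t) = corr V (nn_edges V) (fun e => J e + t * J1 e) x y.
    apply: eq_corr => e _; rewrite /J /J1 !updE; case: eqP => _.
      by rewrite ?mul0r add0r mul1r ?mulr1.
    by rewrite mul0r mulr0 addr0.
  have f0 : f (upd a v 0) = corr V (nn_edges V) J x y by [].
  rewrite f0 !fE; apply: (@corr_chord R _ V (nn_edges V) J J1 4) => //.
  - by move=> e _; rewrite /J updE; case: ifP.
  - by move=> e _; rewrite mulr_ge0.
  - apply: (@degree_le4 V v) => e; first by rewrite ler01 lexx.
    by rewrite /odd_end; case: ifP => _ /eqP ->; rewrite eqxx ?orbT.
apply: le_trans outer _; rewrite [X in _ <= bernoulli_mean p X _]VE bernoulli_mean_union//.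
apply: le_bernoulli_mean => // A2 A2S; apply: le_trans (inner A2) _.
rewrite le_eqVlt; apply/orP; left; apply/eqP/eq_bernoulli_mean => A1 A1S.
have oddA1 v : ~~ even_vertex v -> (v \in A2 `|` A1) = (v \in A2).
  move=> ov; rewrite inE orb_idr// => /(fsubsetP A1S); rewrite !inE /= (negbTE ov).
  by rewrite andbF.
have evenA2 v : even_vertex v -> (v \in A2 `|` A1) = (v \in A1).
  move=> ev; rewrite inE orb_idl// => /(fsubsetP A2S); rewrite !inE /= ev.
  by rewrite andbF.
apply: eq_corr => e eE; have := even_endP eE; have := odd_endP eE.
rewrite /even_end /odd_end; case: ifP => _ h1 h2; rewrite (evenA2 _ h2) (oddA1 _ h1)//.
by rewrite mulrAC.
Qed.

End Comparison.

Section DilutedLimit.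
Context {R : realType}.
Implicit Types (p beta : R) (x y : Z2) (star : dilution).
Local Open Scope fset_scope.
Local Open Scope ring_scope.

Lemma kappa_gt0 star : 0 < kappa star :> R.
Proof. by case: star. Qed.

Lemma F_box_comparison star p beta beta' n x y : 0 <= p <= 1 -> 0 <= beta -> 0 <= beta' ->
  1 - expR (- (2 * kappa star * beta')) =
    p ^+ alpha star * (1 - expR (- (2 * kappa star * beta))) ->
  x \in box n -> y \in box n -> clean_corr beta' (box n) x y <= F_box star p beta n x y.
Proof.
move=> p01 b0 b'0 hb xn yn.
have exp_inj k b1 b2 : 0 < k -> 1 - expR (- (2 * k * b1)) = 1 - expR (- (2 * k * b2)) ->
    b1 = b2 :> R.
  move=> k0 /addrI /oppr_inj /expR_inj /oppr_inj /mulfI; apply.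
  by rewrite gt_eqF// mulr_gt0.
case: star hb => /= hb.
  have [b1 [b10 b1b E]] := effective_coupling ltr01 p01 b0.
  have {hb} -> : beta' = b1 by apply: (exp_inj 1) => //; rewrite hb E expr1.
  exact: bond_comparison.
have k4 : 0 < 4 :> R by [].
have [b1 [b10 b1b E]] := effective_coupling k4 p01 b0.
have [b2 [b20 b2b E2]] := effective_coupling k4 p01 b10.
have {hb} -> : beta' = b2 by apply: (exp_inj 4) => //; rewrite hb E2 E expr2 mulrA.
exact: (@site_comparison R _ p beta b1).
Qed.

Lemma F_box_le1 star p beta n x y : 0 <= p <= 1 -> x \in box n -> y \in box n ->
  F_box star p beta n x y <= 1.
Proof.
move=> p01 xn yn; case: star => /=.
  rewrite -[leRHS](bernoulli_mean_cst p (box_edges n)).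
  by apply: le_bernoulli_mean => // A _; apply: corr_le1 => //; exact: nn_edges_in.
rewrite -[leRHS](bernoulli_mean_cst p (box n)).
by apply: le_bernoulli_mean => // A _; apply: corr_le1 => //; exact: nn_edges_in.
Qed.

Lemma bernoulli_mean_mono (K : choiceType) p (S S' : {fset K}) (f f' : {fset K} -> R) :
  0 <= p <= 1 -> S `<=` S' ->
  (forall A A', A `<=` S -> f A <= f' (A `|` A')) ->
  bernoulli_mean p S f <= bernoulli_mean p S' f'.
Proof.
move=> p01 /fsubsetP SS ff'; have -> : S' = S `|` (S' `\` S).
  by apply/fsetP => z; rewrite !inE; have [/SS ->|] := boolP (z \in S).
rewrite bernoulli_mean_union; last by apply/fdisjointP => z zS; rewrite !inE zS.
apply: le_bernoulli_mean => // A AS.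
rewrite -[leLHS](bernoulli_mean_cst p (S' `\` S)).
by apply: le_bernoulli_mean => // A' _; exact: ff'.
Qed.

Lemma F_box_mono star p beta n x y : 0 <= p <= 1 -> 0 <= beta ->
  x \in box n -> y \in box n ->
  F_box star p beta n x y <= F_box star p beta n.+1 x y.
Proof.
move=> p01 b0 xn yn; have bn := box_mono (leqnSn n); have en := nn_edges_mono bn.
have natb (b c : bool) : (b -> c) -> (b%:R <= c%:R :> R).
  by case: b => [->|_]//; rewrite ler0n.
case: star => /=; apply: bernoulli_mean_mono => // A A' AS;
  apply: corr_mono => //; try exact: nn_edges_in.
- move=> e _; rewrite mulr_ge0//= ler_wpM2l// natb// => eA.
  by rewrite inE eA.
- by move=> e _; rewrite mulr_ge0.
- move=> e _; rewrite !mulr_ge0//= ler_pM ?mulr_ge0//.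
    by rewrite ler_wpM2l// natb// => eA; rewrite inE eA.
  by rewrite natb// => eA; rewrite inE eA.
- by move=> e _; rewrite !mulr_ge0.
Qed.

(** Both sides are monotone limits over the boxes, where the comparison holds. *)
Lemma F_comparison star p beta beta' x y : 0 <= p <= 1 -> 0 <= beta -> 0 <= beta' ->
  1 - expR (- (2 * kappa star * beta')) =
    p ^+ alpha star * (1 - expR (- (2 * kappa star * beta))) ->
  F_clean beta' x y <= F star p beta x y.
Proof.
move=> p01 b0 b'0 hb.
have [N VN] := box_large [fset x; y].
have inN z n : z \in [fset x; y] -> (N <= n)%N -> z \in box n.
  by move=> zV Nn; apply: (fsubsetP (box_mono Nn)); exact: (fsubsetP VN).
have xN n : (N <= n)%N -> x \in box n by apply: inN; rewrite !inE eqxx.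
have yN n : (N <= n)%N -> y \in box n by apply: inN; rewrite !inE eqxx orbT.
have [cv leF] := @eventually_nondecreasing_cvg R (fun n => F_box star p beta n x y) N 1
  (fun n Nn => F_box_mono star p01 b0 (xN n Nn) (yN n Nn))
  (fun n Nn => F_box_le1 star beta p01 (xN n Nn) (yN n Nn)).
have [cv' _] := F_clean_limit b'0 (xN N (leqnn N)) (yN N (leqnn N)).
apply: limr_le cv' _; exists N => // n /= Nn.
apply: le_trans (leF n Nn).
by apply: (F_box_comparison p01 b0 b'0 hb); [exact: xN|exact: yN].
Qed.

(** If the critical point were infinite, the condition would require
    [1 - e^{-2 kappa beta'}] to be at least 1. *)
Lemma F_lower star p beta x y : 0 < p -> p <= 1 -> 0 <= beta ->
  (H (kappa star) beta_BKT <= (p ^+ alpha star)%:E * H (kappa star) beta%:E)%E ->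
  x != y -> 1 / (8 * norm_sup (x - y)) <= F star p beta x y.
Proof.
move=> p0 p1 b0 hH xy.
have k0 := kappa_gt0 star; have k2 : 0 < 2 * kappa star :> R by rewrite mulr_gt0.
have q01 : 0 <= p ^+ alpha star <= 1 by rewrite exprn_ge0 ?exprn_ile1// ltW.
have p01 : 0 <= p <= 1 by rewrite ltW.
have [b' [b'0 b'b E]] := effective_coupling k0 q01 b0.
apply: le_trans (F_comparison x y p01 b0 b'0 E).
apply: F_clean_lower_pair xy.
move: hH; rewrite H_fin -EFinM -E; have := @beta_BKT_ge0 R.
case: beta_BKT => [r| |] // _.
- rewrite H_fin !lee_fin lerD2l lerN2 ler_expR lerN2 ler_pM2l//.
- rewrite /H mulNe gt0_muley ?lte_fin//= sube0 => h.
  have {}h : 1 <= 1 - expR (- (2 * kappa star * b')) by rewrite -lee_fin.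
  by exfalso; have := expR_gt0 (- (2 * kappa star * b')); lra.
Qed.

Lemma norm_sup_le x : norm_sup x <= norm_eucl x :> R.
Proof.
rewrite /norm_sup /norm_eucl; have [_|_] := leP `|x.1| `|x.2|; rewrite intr_norm -sqrtr_sqr ler_sqrt.
- by rewrite lerDr sqr_ge0.
- by rewrite addr_ge0 ?sqr_ge0.
- by rewrite lerDl sqr_ge0.
- by rewrite addr_ge0 ?sqr_ge0.
Qed.

Lemma norm_sup_gt0 x : x != 0 -> 0 < norm_sup x :> R.
Proof. by case: x => a b; rewrite xpair_eqE /norm_sup /= ltr0z; lia. Qed.

End DilutedLimit.

Theorem corollary1p2 (R : realType) (star : dilution) :
  (forall p beta : R, 0 < p -> p <= 1 -> 0 <= beta ->
     ((p ^+ alpha star)%:E * H (kappa star) beta%:E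
        >= H (kappa star) beta_BKT)%E ->
     forall x y : Z2, x != y ->
       F star p beta x y >= 1 / (8 * norm_sup (x - y)))
  /\
  (forall beta : R, (beta_BKT < beta%:E)%E ->
     exists p0 : R, [/\ 0 <= p0, p0 < 1 &
       forall p : R, p0 <= p -> p <= 1 ->
         exists c s : R, [/\ 0 < c, 0 <= s &
           forall x : Z2, x != 0 ->
             F star p beta 0 x >= c * (1 + norm_eucl x) `^ (- s)]]).
Proof.
split=> [p beta p0 p1 b0 hH x y xy|beta bb]; first exact: F_lower.
have k0 := @kappa_gt0 R star; have k2 : 0 < 2 * kappa star :> R by rewrite mulr_gt0.
have BKT0 := @beta_BKT_ge0 R.
have b0 : 0 < beta by rewrite -lte_fin (le_lt_trans BKT0).
have [r bE] : exists r, beta_BKT = r%:E :> \bar R.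
  by move: bb BKT0; case: beta_BKT => [r _ _| |] //; exists r.
rewrite bE in bb BKT0.
pose h (t : R) := 1 - expR (- (2 * kappa star * t)).
have h0 : 0 <= h r.
  by rewrite subr_ge0 -[leRHS]expR0 ler_expR oppr_le0 mulr_ge0// ?ltW// -lee_fin.
have hr : h r < h beta.
  by rewrite ltrD2l ltrN2 ltr_expR ltrN2 ltr_pM2l// -lte_fin.
have hb := le_lt_trans h0 hr.
pose q := h r / h beta.
have q0 : 0 <= q by exact: divr_ge0 h0 (ltW hb).
have q1 : q < 1 by rewrite ltr_pdivrMr// mul1r.
have [m0 m1] : 0 < (1 + q) / 2 /\ (1 + q) / 2 < 1.
  by split; lra.
exists ((1 + q) / 2); split=> [||p pq p1]; [exact: ltW|exact: m1|].
have p0 : 0 < p by exact: lt_le_trans pq.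
exists (1 / 8), 1; split=> // x x0.
have hp : q <= p ^+ alpha star.
  have [-> | ->] : alpha star = 1%N \/ alpha star = 2%N by case: (star); [left|right].
    by rewrite expr1; lra.
  have q2 : 0 <= (1 - q) ^+ 2 by exact: sqr_ge0.
  have p2 : ((1 + q) / 2) ^+ 2 <= p ^+ 2.
    by rewrite lerXn2r// nnegrE ?(ltW m0) ?(ltW p0).
  apply: le_trans p2; rewrite -subr_ge0 (_ : _ - q = (1 - q) ^+ 2 / 4); last by field.
  by rewrite divr_ge0.
have x0' : 0 != x by rewrite eq_sym.
have := F_lower (star := star) p0 p1 (ltW b0) _ x0'.
rewrite bE !H_fin -EFinM lee_fin -/(h r) -/(h beta) -ler_pdivrMr// => /(_ hp).
apply: le_trans.
have ns := norm_sup_gt0 (R := R) x0; have nn := norm_sup_le (R := R) x.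
have -> : norm_sup (0 - x) = norm_sup x :> R.
  by case: (x) => a b; rewrite /norm_sup /= !sub0r !normrN.
have ne : 0 < 1 + norm_eucl x :> R by lra.
rewrite powR_inv1 ?(ltW ne)// [1 / (8 * _)](_ : _ = 1 / 8 * (norm_sup x)^-1); last first.
  by rewrite invfM mulrA.
by rewrite ler_wpM2l// lef_pV2 ?posrE//; lra.
Qed.
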